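(* Let $\Omega\subset\mathbb R^2$ be a polygon (not necessarily convex), and let $\phi\in C_0^\infty(\mathbb R^2)$ be real-valued. Then, for each choice of sign, $$\lambda_k^{(\pm)}(A_\Omega[\phi])=O(k^{-1}\log k),\qquad k\to\infty.$$
   Context: For $\Omega\subset\mathbb R^2$ and $\phi\in C_0^\infty(\mathbb R^2)$ real-valued, $A_\Omega[\phi]$ is the compact (in fact Hilbert-Schmidt) self-adjoint operator on $L^2(\mathbb R)$ given by $$(A_\Omega[\phi]u)(x)=\frac1{2\pi}\iint_{\mathbb R^2}e^{i(x-y)\xi}\,\mathbf 1_\Omega\Big(\frac{x+y}2,\xi\Big)\phi\Big(\frac{x+y}2,\xi\Big)u(y)\,dy\,d\xi,$$ where $\mathbf 1_\Omega$ is the indicator function of $\Omega$ (here $\Omega$ is understood as the planar region, i.e. the domain bounded by the polygonal line). $\lambda_k^{(+)}(A)$ and $-\lambda_k^{(-)}(A)$, $k=1,2,\dots$, denote the positive and negative eigenvalues of a compact self-adjoint operator $A$, with each of the sequences $\lambda_k^{(+)}$, $\lambda_k^{(-)}$ enumerated in non-increasing order counting multiplicity (if there are only finitely many, the sequence is continued by zeros). *)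

(* Defs.v *)
From HB Require Import structures.
From mathcomp Require Import all_boot all_order all_algebra.
From mathcomp Require Import complex.
From mathcomp Require Import all_classical all_reals all_analysis.

Set Implicit Arguments.
Unset Strict Implicit.
Unset Printing Implicit Defensive.

Import Order.TTheory GRing.Theory Num.Theory.
Import numFieldNormedType.Exports.

Local Open Scope classical_set_scope.
Local Open Scope ring_scope.
Local Open Scope complex_scope.

Section Polygon.
Variable R : realType.

Definition segment2 (a b : R * R) : set (R * R) :=
  [set p | exists2 t : R, 0 <= t <= 1 &
     p = ((1 - t) * a.1 + t * b.1, (1 - t) * a.2 + t * b.2)].

(* [ordS i] is the cyclic successor of [i] in ['I_n]. *)
Definition edge n (v : 'I_n -> R * R) (i : 'I_n) : set (R * R) :=
  segment2 (v i) (v (ordS i)).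

Definition polygonal_line n (v : 'I_n -> R * R) : set (R * R) :=
  \bigcup_i edge v i.

Definition simple_polygonal_line n (v : 'I_n -> R * R) : Prop :=
  [/\ (3 <= n)%N,
      injective v,
      forall i, edge v i `&` edge v (ordS i) = [set v (ordS i)] &
      forall i j, i != j -> j != ordS i -> i != ordS j ->
        edge v i `&` edge v j = set0].

(* The domain bounded by a simple closed polygonal line, i.e. the bounded
   connected component of its complement. *)
Definition polygon (Omega : set (R * R)) : Prop :=
  exists n (v : 'I_n -> R * R),
    [/\ simple_polygonal_line v,
        exists2 p, ~ polygonal_line v p &
          Omega = connected_component (~` polygonal_line v) p &
        bounded_set Omega].

End Polygon.

Section TestFunctions.
Variable R : realType.

Definition partial1 (f : R * R -> R) : R * R -> R :=
  fun p => derive1 (fun t : R => f (t, p.2)) p.1.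

Definition partial2 (f : R * R -> R) : R * R -> R :=
  fun p => derive1 (fun t : R => f (p.1, t)) p.2.

Fixpoint Ck (k : nat) (f : R * R -> R) : Prop :=
  match k with
  | 0 => continuous f
  | k'.+1 =>
    [/\ continuous f,
        forall p, derivable (fun t => f (t, p.2)) p.1 1,
        forall p, derivable (fun t => f (p.1, t)) p.2 1,
        Ck k' (partial1 f) & Ck k' (partial2 f)]
  end.

Definition test_function (f : R * R -> R) : Prop :=
  (forall k, Ck k f) /\ compact (closure [set p | f p != 0]).

End TestFunctions.

Section Operators.
Variable R : realType.
Local Notation mu := (@lebesgue_measure R).

Definition expi (t : R) : R[i] := cos t +i* sin t.

Definition cintegral d (T : measurableType d) (m : {measure set T -> \bar R})
    (f : T -> R[i]) : R[i] :=
  Rintegral m setT (fun x => complex.Re (f x)) +i*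
  Rintegral m setT (fun x => complex.Im (f x)).

(* Elements of L^2(R; C) are represented by functions, and identified when they
   agree almost everywhere. *)
Definition L2 (u : R -> R[i]) : Prop :=
  (fun x => complex.Re (u x)) \in Lfun mu 2%:E /\
  (fun x => complex.Im (u x)) \in Lfun mu 2%:E.

Definition eigenfunction (A : (R -> R[i]) -> (R -> R[i])) (z : R)
    (u : R -> R[i]) : Prop :=
  L2 u /\ {ae mu, forall x, A u x = z%:C * u x}.

(* The space of solutions of A u = z u has dimension [n]: it has a basis
   [b 0, ..., b (n-1)]; in particular [n = 0] when [z] is no eigenvalue. *)
Definition eigenspace_dim (A : (R -> R[i]) -> (R -> R[i])) (z : R)
    (n : nat) : Prop :=
  exists b : 'I_n -> R -> R[i],
    [/\ forall j, eigenfunction A z (b j),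
        forall c : 'I_n -> R[i],
          {ae mu, forall x, \sum_j c j * b j x = 0} -> forall j, c j = 0 &
        forall u, eigenfunction A z u ->
          exists c : 'I_n -> R[i],
            {ae mu, forall x, u x = \sum_j c j * b j x}].

(* [lam 1, lam 2, ...] are the positive eigenvalues of [A] (for [neg = false])
   or the moduli of its negative eigenvalues (for [neg = true]), in
   non-increasing order and counted with multiplicity. When there are only
   finitely many of them, the other terms must be 0, being nonnegative and not
   accounted for by any eigenvalue. The value [lam 0] is irrelevant. *)
Definition eigenvalue_sequence (neg : bool) (A : (R -> R[i]) -> (R -> R[i]))
    (lam : nat -> R) : Prop :=
  [/\ forall k, (1 <= k)%N -> 0 <= lam k,
      forall k l, (1 <= k <= l)%N -> lam l <= lam k &
      forall z : R, 0 < z -> exists2 n,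
        eigenspace_dim A ((-1) ^+ neg * z) n &
        ([set k | (1 <= k)%N /\ lam k = z] #= `I_n)%card].

Definition weyl (Omega : set (R * R)) (phi : R * R -> R) (u : R -> R[i])
    (x : R) : R[i] :=
  ((2 * pi)^-1)%:C *
  cintegral (mu \x mu)%E (fun p =>
    let: (y, xi) := p in
    let: q := ((x + y) / 2, xi) in
    expi ((x - y) * xi) * (\1_Omega q)%:C * (phi q)%:C * u y).

End Operators.

(* Main.v *)
(** Write s = (x + y) / 2 and t = x - y, so that the kernel of the operator is
    K(x, y) = (2 pi)^-1 \int exp(i t xi) 1_Omega(s, xi) phi(s, xi) d xi.
    The sides of the polygon cut the plane into convex cells, each contained in
    Omega or disjoint from it, so 1_Omega is a linear combination of indicators
    of the sets {s < c, xi < b s + d}.  For one such set, the substitution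
    xi = eta + b s + d produces the phase t (b s + d) = theta(x) - theta(y) with
    theta(x) = b x^2 / 2 + d x, which is harmless, and leaves the kernel
    p(x, y) = 1_{s < c} \int_{eta < 0} exp(i t eta) phi(s, eta + b s + d) d eta.
    Integration by parts gives |p| <= C / (1 + |t|), the same bound for its
    Lipschitz constant away from the line s = c, and p vanishes unless s is
    bounded.  Freezing x on the geometric grid 1 + |x| = exp(r / N) therefore
    approximates p by a kernel of rank O(N log N) with an error
    O((log N / N)^(1/2)) in Hilbert-Schmidt norm.

    If lambda_k > 0, the span of k orthogonal eigenfunctions with eigenvalues
    >= lambda_k contains an orthonormal family of k - O(N log N) functions on
    which the operator coincides with its error term, and Bessel's inequality
    yields lambda_k^2 (k - O(N log N)) = O(log N / N).  It remains to take N of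
    the order of k / log k. *)
Require Import Defs.
From HB Require Import structures.
From mathcomp Require Import all_boot all_order all_algebra.
From mathcomp Require Import complex.
From mathcomp Require Import all_classical all_reals all_analysis.
From mathcomp Require Import measurable_realfun.
From mathcomp Require Import ring lra.
Set Implicit Arguments.
Unset Strict Implicit.
Unset Printing Implicit Defensive.
Import Order.TTheory GRing.Theory Num.Theory.
Import numFieldNormedType.Exports.
Local Open Scope classical_set_scope.
Local Open Scope ring_scope.


(** * Square-integrable functions and measurability *)

Section SquareIntegrable.
Variable R : realType.
Local Notation mu := (@lebesgue_measure R).
Implicit Types f g : R -> R.

(** The cutoff [s < c] shapes the estimate. Rows of [p] at [x] and [x'] differ by about
    [1 / (1 + |x|)] on a set of length [|x - x'|], however close they are, so the squared distance
    of the rows is only of first order, [|x - x'| / (1 + |x|)^2]. A grid step proportional to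
    [1 + |x|] turns this into [1 / (N (1 + |x|))], whose integral up to [|x|] of order [N] is
    [log N / N]; farther out the rows have square norm [O((1 + |x|)^(-2))] and contribute
    [O(1 / N)].

    The phase [theta] has an unbounded derivative and has to be removed before [x] is frozen: its
    part in [x] multiplies rows by scalars, its part in [y] goes into the kernel.

    The analysis is carried out over the reals. A complex function is a pair of real ones, the
    Hermitian kernel a symmetric cosine part and an antisymmetric sine part, and only real
    combinations of eigenfunctions occur, at the price of a constant factor in the number of linear
    conditions. The basis of an eigenspace need not be orthogonal, so a Gram matrix takes the place
    of an orthogonal family. *)

Definition sqint f := measurable_fun setT f /\
  mu.-integrable setT (EFin \o (fun x => f x ^+ 2)).

Lemma Lfun2_sqint f : f \in Lfun mu 2%:E -> sqint f.
Proof.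
move=> hf; split; last exact: Lfun2_integrable_sqr.
by move: hf; rewrite inE => /andP[]; rewrite inE.
Qed.

Lemma integrable_le (f g : R -> R) : measurable_fun setT f ->
  mu.-integrable setT (EFin \o g) -> (forall x, `|f x| <= g x) ->
  mu.-integrable setT (EFin \o f).
Proof.
move=> mf ig fg; apply: le_integrable ig => //.
  exact/measurable_EFinP.
by move=> x _ /=; rewrite lee_fin (le_trans (fg x))// ler_norm.
Qed.

Lemma sqint_mul f g : sqint f -> sqint g ->
  mu.-integrable setT (EFin \o (fun x => f x * g x)).
Proof.
move=> [mf f2] [mg g2].
apply: (@integrable_le _ (fun x => f x ^+ 2 + g x ^+ 2)).
- exact: measurable_funM.
- have := integrableD measurableT f2 g2; exact.
- move=> x; rewrite normrM -[f x ^+ 2]real_normK ?num_real//.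
  rewrite -[g x ^+ 2]real_normK ?num_real//.
  by have := sqr_ge0 (`|f x| - `|g x|); have := sqr_ge0 (`|f x| + `|g x|); nra.
Qed.

Lemma sqintD f g : sqint f -> sqint g -> sqint (fun x => f x + g x).
Proof.
move=> [mf f2] [mg g2]; split; first exact: measurable_funD.
apply: (@integrable_le _ (fun x => 2 * (f x ^+ 2) + 2 * (g x ^+ 2))).
- by apply: measurable_funX; exact: measurable_funD.
- have h1 := integrableZl measurableT 2 f2.
  have h2 := integrableZl measurableT 2 g2.
  by have := integrableD measurableT h1 h2; exact.
- move=> x; rewrite ger0_norm ?sqr_ge0//.
  by have := sqr_ge0 (f x - g x); nra.
Qed.

Lemma sqintZ a f : sqint f -> sqint (fun x => a * f x).
Proof.
move=> [mf f2]; split; first exact: measurable_funM.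
under [X in integrable _ _ X]funext do rewrite /= exprMn EFinM.
exact: integrableZl.
Qed.

Lemma sqint0 : sqint (fun=> 0).
Proof.
split; first exact: measurable_cst.
rewrite (_ : _ \o _ = cst 0%E); first exact: integrable0.
by apply/funext => x /=; rewrite expr0n.
Qed.

Lemma sqint_sum (I : Type) (s : seq I) (c : I -> R) (F : I -> R -> R) :
  (forall i, sqint (F i)) -> sqint (fun x => \sum_(i <- s) c i * F i x).
Proof.
move=> hF; elim: s => [|i s IH].
  by under eq_fun do rewrite big_nil; exact: sqint0.
under eq_fun do rewrite big_cons.
by apply: sqintD => //; exact: sqintZ.
Qed.

Lemma integrable_box (a b : R) : mu.-integrable setT (EFin \o \1_(`[a, b]%classic)).
Proof. exact: integrable_indic_itv. Qed.

Lemma sqint_bounded f M a b : measurable_fun setT f ->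
  (forall x, `|f x| <= M) -> (forall x, ~~ (a <= x <= b) -> f x = 0) -> sqint f.
Proof.
move=> mf fM f0; split => //.
apply: (@integrable_le _ (fun x => M ^+ 2 * \1_(`[a, b]%classic) x)).
- exact: measurable_funX.
- exact: (integrableZl measurableT (M ^+ 2) (integrable_box a b)).
- move=> x; rewrite ger0_norm ?sqr_ge0// indicE.
  have [xab|xab] := boolP (a <= x <= b).
    rewrite mem_set/= ?in_itv//= mulr1 -[f x ^+ 2]real_normK ?num_real//.
    by rewrite lerXn2r ?nnegrE// (le_trans _ (fM x)).
  by rewrite f0// expr0n mulr_ge0 ?sqr_ge0.
Qed.

End SquareIntegrable.

Section Measurability.
Variable R : realType.
Local Notation mu := (@lebesgue_measure R).

(** Tonelli's measurability statement asks for a nonnegative integrand, so the integrable majorant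
    [I] of [|f|] is added and its integral, a constant, subtracted again. *)
Lemma measurable_parameter_integral d (T : measurableType d)
    (f : T * R -> R) (M B : R) :
  measurable_fun setT f -> (forall z, `|f z| <= M) ->
  (forall z, ~~ (`|z.2| <= B) -> f z = 0) ->
  measurable_fun setT (fun x => \int[mu]_y f (x, y)).
Proof.
move=> mf fM f0.
pose I (y : R) : R := M * \1_(`[- B, B]%classic) y.
have iI : mu.-integrable setT (EFin \o I).
  exact: (integrableZl measurableT M (integrable_box (- B) B)).
have mI : measurable_fun setT I.
  by apply: measurable_funM => //; exact: measurable_indic.
have fI z : `|f z| <= I z.2.
  rewrite /I indicE; have [zB|zB] := boolP (`|z.2| <= B).
    by rewrite mem_set/= ?mulr1// in_itv/= -ler_norml.
  by rewrite f0// normr0 mulr_ge0// (le_trans _ (fM z)).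
have if1 x : mu.-integrable setT (EFin \o (fun y => f (x, y))).
  apply: (integrable_le _ iI) => [|y]; first exact: measurableT_comp mf _.
  exact: fI.
have mI2 : measurable_fun setT (fun z : T * R => I z.2) by exact: measurableT_comp.
have mF : measurable_fun setT (fubini_F mu (fun z => (f z + I z.2)%:E)).
  apply: measurable_fun_fubini_tonelli_F.
    by apply/measurable_EFinP; exact: measurable_funD.
  by move=> z; rewrite lee_fin; have := fI z; have := ler_norm (- f z); rewrite normrN; lra.
set F := (X in measurable_fun _ X) in mF.
have -> : (fun x => \int[mu]_y f (x, y)) = (fun x =>
    fine (F x) - \int[mu]_y I y).
  apply/funext => x /=.
  rewrite -/(Rintegral mu setT (fun y => f (x, y) + I y)) RintegralD//.
  by rewrite addrK.
apply: measurable_funB; last exact: measurable_cst.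
exact: measurableT_comp mF.
Qed.

(** Measurability refers to the product sigma-algebra. Rounding the first coordinate down to a
    multiple of [1 / (n + 1)] gives functions that on each of countably many vertical strips depend
    measurably on the second coordinate alone; by continuity they converge pointwise to [f]. *)
Lemma continuous2_measurable (f : R * R -> R) : continuous f ->
  measurable_fun [set: measurableTypeR R * measurableTypeR R] f.
Proof.
move=> cf.
pose g (n : nat) (z : R * R) : R := ((Num.floor (z.1 * n.+1%:R))%:~R / n.+1%:R).
pose fn (n : nat) (z : R * R) : R := f (g n z, z.2).
have gz (z : R * R) : (g n z) @[n --> \oo] --> z.1.
  apply/cvgrPdist_lt => /= e e0; near=> n.
  have n0 : (0 : R) < n.+1%:R by [].
  apply: (@le_lt_trans _ _ (n.+1%:R^-1)).
    rewrite /g -[X in X - _](mulfK (lt0r_neq0 n0)) -mulrBl normrM.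
    rewrite [`|_^-1|]gtr0_norm ?invr_gt0// ler_piMl ?invr_ge0 ?(ltW n0)//.
    have := floor_le (z.1 * n.+1%:R); have := floorD1_gt (z.1 * n.+1%:R).
    by rewrite intrD ler_norml; lra.
  near: n; exact: (near_infty_natSinv_lt (PosNum e0)).
have fnf z : fn n z @[n --> \oo] --> f z.
  case: z => s y.
  have h : (g n (s, y), y) @[n --> \oo] --> (s, y).
    have h1 := gz (s, y). have h2 : (fun=> y) @ \oo --> y by exact: cvg_cst.
    exact: (cvg_pair h1 h2).
  exact: (cvg_comp _ _ h (cf (s, y))).
apply: (measurable_fun_cvg (h := fn)) => // n.
move=> _ A mA; rewrite setTI.
rewrite (_ : fn n @^-1` A = \bigcup_(k in [set: int])
   ([set z : R * R | k%:~R <= z.1 * n.+1%:R < (k + 1)%:~R] `&`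
    [set z | A (f (k%:~R / n.+1%:R, z.2))])).
  apply: countable_bigcupT_measurable => // k; apply: measurableI.
    rewrite (_ : [set z | _] = fst @^-1` [set x : R | k%:~R <= x * n.+1%:R < (k + 1)%:~R]) //.
    rewrite -[X in measurable X]setTI; apply: measurable_fst => //.
    rewrite (_ : [set x | _] = (fun x : R => x * n.+1%:R) @^-1` `[k%:~R, (k + 1)%:~R[).
      by rewrite -[X in measurable X]setTI; exact: measurable_funM.
    by apply/seteqP; split => x /=; rewrite in_itv.
  have mf2 : measurable_fun setT (fun y : R => f (k%:~R / n.+1%:R, y)).
    apply: continuous_measurable_fun => y.
    have h1 : (fun=> k%:~R / n.+1%:R : R) @ y --> (k%:~R / n.+1%:R : R) by exact: cvg_cst.
    have h2 : id @ y --> y by exact: cvg_id.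
    have h3 := cf (k%:~R / n.+1%:R, y). 
    have h4 : (k%:~R / n.+1%:R : R, x) @[x --> y] --> (k%:~R / n.+1%:R : R, y) by exact: (cvg_pair h1 h2).
    have h5 := cvg_comp _ _ h4 h3. exact: h5.
  rewrite (_ : [set z | _] = snd @^-1` ((fun y => f (k%:~R / n.+1%:R, y)) @^-1` A)) //.
  rewrite -[X in measurable X]setTI; apply: measurable_snd => //.
  by rewrite -[X in measurable X]setTI; exact: mf2.
apply/seteqP; split => [z /= Az|z [k _ [/= hk]]].
  exists (Num.floor (z.1 * n.+1%:R)) => //; split => //=.
  exact: floor_itv.
by rewrite /fn /g; move/floor_def: hk => ->.
Unshelve. all: by end_near.
Qed.

End Measurability.

(** * Test functions *)

Section TestFunctionBounds.
Variable R : realType.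
Implicit Types f : R * R -> R.

Definition supported_in_box (B : R) f :=
  forall p, (B < `|p.1|) || (B < `|p.2|) -> f p = 0.

Lemma compact_support_box f : continuous f ->
  compact (closure [set p | f p != 0]) -> exists2 B, 0 < B & supported_in_box B f.
Proof.
move=> cf cK; set K := closure _ in cK.
have c1 : compact (fst @` K).
  apply: continuous_compact => //; apply: continuous_subspaceT => x; exact: cvg_fst.
have c2 : compact (snd @` K).
  apply: continuous_compact => //; apply: continuous_subspaceT => x; exact: cvg_snd.
have [M1 M10 h1] := ex_strict_bound_gt0 (compact_bounded c1).
have [M2 M20 h2] := ex_strict_bound_gt0 (compact_bounded c2).
exists (M1 + M2); first exact: addr_gt0.
move=> p hp; apply/eqP; apply: contraTT hp => fp0.
have Kp : K p by exact: subset_closure.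
have /h1 := (ex_intro2 _ _ p Kp erefl : (fst @` K) p.1).
have /h2 := (ex_intro2 _ _ p Kp erefl : (snd @` K) p.2).
by rewrite negb_or -!leNgt => /= ? ?; apply/andP; split; lra.
Qed.

Lemma continuous_box_bounded B f : continuous f -> supported_in_box B f ->
  exists2 M, 0 <= M & forall p, `|f p| <= M.
Proof.
move=> cf f0.
have cK : compact (f @` (`[- B, B]%classic `*` `[- B, B]%classic)).
  apply: continuous_compact; first exact: continuous_subspaceT.
  by apply: compact_setX; exact: segment_compact.
have [M M0 hM] := ex_strict_bound_gt0 (compact_bounded cK).
exists M; first exact: ltW.
move=> p; have [hp|] := boolP ((B < `|p.1|) || (B < `|p.2|)).
  by rewrite f0// normr0 ltW.
rewrite negb_or -!leNgt !ler_norml => /andP[h1 h2].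
have Kp : (`[- B, B]%classic `*` `[- B, B]%classic) p by split; rewrite /= in_itv.
have := hM _ (ex_intro2 _ _ p Kp erefl). by move=> /= /ltW; rewrite ler_norml.
Qed.

Lemma derive1_eq0_out (g : R -> R) B x : (forall y, B < `|y| -> g y = 0) ->
  B < `|x| -> derive1 g x = 0.
Proof.
move=> g0 Bx; rewrite derive1E (@near_eq_derive _ _ _ g (cst 0)).
- by rewrite derive_cst.
- have : \forall y \near x, B < `|y|.
    have /cvgr_gt h : `|y| @[y --> x] --> `|x| by exact: cvg_norm.
    exact: h.
  by apply: filterS => y /g0.
Qed.

Lemma partial1_box B f : supported_in_box B f -> supported_in_box B (partial1 f).
Proof.
move=> f0 p /orP[h|h]; rewrite /partial1.
- by apply: (derive1_eq0_out _ h) => y hy; apply: f0; rewrite /= hy.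
- rewrite (_ : (fun t => _) = cst 0) ?derive1_cst//.
  by apply/funext => t; apply: f0; rewrite /= h orbT.
Qed.

Lemma partial2_box B f : supported_in_box B f -> supported_in_box B (partial2 f).
Proof.
move=> f0 p /orP[h|h]; rewrite /partial2.
- rewrite (_ : (fun t => _) = cst 0) ?derive1_cst//.
  by apply/funext => t; apply: f0; rewrite /= h.
- by apply: (derive1_eq0_out _ h) => y hy; apply: f0; rewrite /= hy orbT.
Qed.

Lemma derivable_lipschitz (g : R -> R) M a b : (forall x, derivable g x 1) ->
  (forall x, `|derive1 g x| <= M) -> `|g a - g b| <= M * `|a - b|.
Proof.
move=> dg hM.
wlog ab : a b / a <= b.
  move=> H; have [/H//|/ltW/H] := leP a b.
  by rewrite distrC [`|b - a|]distrC.
have h1 x : x \in `]a, b[%R -> is_derive x 1 g (derive1 g x).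
  by move=> _; rewrite derive1E; exact/derivableP.
have h2 : {within `[a, b], continuous g}.
  by apply: continuous_subspaceT => x; exact/differentiable_continuous/derivable1_diffP.
have [c _] := MVT_segment ab h1 h2.
move=> e; rewrite distrC e normrM [`|b - a|]distrC.
by rewrite ler_wpM2r.
Qed.

(** What the estimates use of a test function. [df] is the derivative in the frequency, the only
    variable in which one integrates by parts; its Lipschitz bound controls the derivative of the
    amplitude [phi(s, .) - phi(s', .)]. *)
Record lipschitz_test (f df : R * R -> R) (B M : R) : Prop := LipschitzTest {
  test_M0 : 0 <= M;
  test_B0 : 0 < B;
  test_box : supported_in_box B f;
  test_le : forall p, `|f p| <= M;
  test_dle : forall p, `|df p| <= M;
  test_lip : forall p q, `|f p - f q| <= M * (`|p.1 - q.1| + `|p.2 - q.2|);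
  test_dlip : forall p q, `|df p - df q| <= M * (`|p.1 - q.1| + `|p.2 - q.2|);
  test_cont : continuous f;
  test_dcont : continuous df;
  test_derive : forall s x : R, is_derive x (1 : R) (fun t : R => f (s, t)) (df (s, x)) }.

Lemma Ck1_lipschitz f B : Ck 1 f -> supported_in_box B f ->
  exists2 M, 0 <= M & (forall p, `|f p| <= M) /\
    forall p q, `|f p - f q| <= M * (`|p.1 - q.1| + `|p.2 - q.2|).
Proof.
move=> [cf d1 d2 c1 c2] f0.
have [M0 M00 h0] := continuous_box_bounded cf f0.
have [M1 M10 h1] := continuous_box_bounded c1 (partial1_box f0).
have [M2 M20 h2] := continuous_box_bounded c2 (partial2_box f0).
exists (M0 + M1 + M2); first by rewrite !addr_ge0.
split=> [p|[p1 p2] [q1 q2]]; first by have := h0 p; lra.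
have e1 : `|f (p1, p2) - f (q1, p2)| <= M1 * `|p1 - q1|.
  apply: (@derivable_lipschitz (fun t => f (t, p2))) => [x|x]; first exact: (d1 (x, p2)).
  exact: (h1 (x, p2)).
have e2 : `|f (q1, p2) - f (q1, q2)| <= M2 * `|p2 - q2|.
  apply: (@derivable_lipschitz (fun t => f (q1, t))) => [x|x]; first exact: (d2 (q1, x)).
  exact: (h2 (q1, x)).
apply: le_trans (ler_distD (f (q1, p2)) _ _) _ => /=.
have := normr_ge0 (p1 - q1); have := normr_ge0 (p2 - q2); nra.
Qed.

Lemma test_function_lipschitz f : test_function f ->
  exists B M, lipschitz_test f (partial2 f) B M.
Proof.
move=> [hf cK].
have [cf d1 d2 c1 c2] := hf 2.
have [B B0 f0] := compact_support_box cf cK.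
have [M1 M10 [h1 l1]] := Ck1_lipschitz (hf 1) f0.
have [M2 M20 [h2 l2]] := Ck1_lipschitz c2 (partial2_box f0).
have cdf : continuous (partial2 f) by case: c2.
exists B, (M1 + M2); split => //.
- by rewrite addr_ge0.
- by move=> p; have := h1 p; lra.
- by move=> p; have := h2 p; lra.
- move=> p q; apply: le_trans (l1 p q) _.
  by rewrite ler_wpM2r ?addr_ge0// lerDl.
- move=> p q; apply: le_trans (l2 p q) _.
  by rewrite ler_wpM2r ?addr_ge0// lerDr.
- move=> s x; rewrite /partial2 /= derive1E; apply/derivableP; exact: (d2 (s, x)).
Qed.

End TestFunctionBounds.

(** * Oscillatory integrals and the kernels p(x, y) *)

Section Oscillatory.
Variable R : realType.
Local Notation mu := (@lebesgue_measure R).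

Lemma continuous_integrable_itv (h : R -> R) a b : continuous h ->
  mu.-integrable `[a, b] (EFin \o h).
Proof.
move=> ch; apply: continuous_compact_integrable; first exact: segment_compact.
exact: continuous_subspaceT.
Qed.

Lemma Rintegral_itv_bound (h : R -> R) m a b : continuous h -> a <= b ->
  (forall x, a <= x <= b -> `|h x| <= m) ->
  `|\int[mu]_(x in `[a, b]) h x| <= m * (b - a).
Proof.
move=> ch ab hm.
have ih := continuous_integrable_itv a b ch.
apply: le_trans (le_normr_Rintegral _ ih) _ => //.
have e : \int[mu]_(x in `[a, b]) m = m * (b - a).
  rewrite Rintegral_cst//= lebesgue_measure_itv/= lte_fin.
  by case: ltgtP ab => // ->; rewrite /= ?subrr ?mulr0.
have i2 : mu.-integrable `[a, b] (EFin \o (fun=> m)).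
  by apply: continuous_integrable_itv; exact: cst_continuous.
by rewrite -e; apply: (le_Rintegral _ (integrable_norm ih) i2).
Qed.

Lemma is_derive_sin_affine (t tau x : R) :
  is_derive x 1 (fun y => sin (t * y + tau)) (cos (t * x + tau) * t).
Proof.
have h : is_derive x 1 (fun y : R => t * y + tau) t.
  have := is_deriveD (is_deriveZ t (is_derive_id x (1 : R))) (is_derive_cst tau x (1 : R)).
  by rewrite addr0 /GRing.scale/= mulr1.
exact: (is_derive1_comp _ h).
Qed.

Lemma continuous_cos_affine (t tau : R) : continuous (fun y : R => cos (t * y + tau)).
Proof.
move=> x; apply: (@continuous_comp _ _ _ (fun y : R => t * y + tau) cos).
  by apply: continuousD; [apply: continuousM; [exact: cvg_cst|exact: cvg_id]|exact: cvg_cst].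
exact: continuous_cos.
Qed.

Lemma derivable_continuous (q dq : R -> R) :
  (forall x : R, is_derive x (1 : R) q (dq x)) -> continuous q.
Proof. by move=> hq x; apply/differentiable_continuous/derivable1_diffP; case: (hq x). Qed.

(** The length of the interval gives the bound [B m]; one integration by parts gives
    [(2 m + B m) / |t|], from two boundary terms and one integral. The first plus [|t|] times the
    second yields the weight [1 + |t|]. The free phase [tau] covers cosine and sine at once. *)
Lemma oscillatory_bound (q dq : R -> R) B m t tau : 0 < B ->
  (forall x : R, is_derive x (1 : R) q (dq x)) -> continuous dq ->
  (forall x, - B <= x <= 0 -> `|q x| <= m /\ `|dq x| <= m) ->
  (1 + `|t|) * `|\int[mu]_(x in `[- B, 0]) (cos (t * x + tau) * q x)| <= (2 + 2 * B) * m.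
Proof.
move=> B0 hq cdq hm.
have cq := derivable_continuous hq.
have m0 : 0 <= m by have [|h _] := hm 0; [rewrite lexx oppr_le0 ltW|apply: le_trans h].
have b1 : `|\int[mu]_(x in `[- B, 0]) (cos (t * x + tau) * q x)| <= m * B.
  have := @Rintegral_itv_bound (fun x => cos (t * x + tau) * q x) m (- B) 0.
  rewrite sub0r opprK; apply => //.
  - by move=> x; apply: continuousM; [exact: continuous_cos_affine|exact: cq].
  - by rewrite oppr_le0 ltW.
  - move=> x /hm[h _]; rewrite normrM -[leRHS]mul1r ler_pM// ler_norml.
    by rewrite cos_geN1 cos_le1.
have [t0|t0] := eqVneq t 0.
  by rewrite {1}t0 normr0 addr0 mul1r (le_trans b1)//; nra.
pose G (x : R) := t^-1 * sin (t * x + tau).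
pose g (x : R) := cos (t * x + tau).
have dG (x : R) : is_derive x (1 : R) G (g x).
  have := is_derive_sin_affine t tau x => h.
  have := is_deriveZ (t^-1) h; rewrite /GRing.scale/=.
  by rewrite mulrC mulfK.
have cG := derivable_continuous dG.
have Gb x : `|G x| <= `|t|^-1.
  rewrite /G normrM normfV ler_piMr// ?invr_ge0// ler_norml.
  by rewrite sin_geN1 sin_le1.
have ibp : \int[mu]_(x in `[- B, 0]) (q x * g x) =
    (q 0 * G 0 - q (- B) * G (- B)) - \int[mu]_(x in `[- B, 0]) (dq x * G x).
  apply: Rintegration_by_parts.
  - by rewrite oppr_lt0.
  - exact: continuous_subspaceT.
  - split; last 2 first.
    + by apply: cvg_at_right_filter; exact: cq.
    + by apply: cvg_at_left_filter; exact: cq.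
    + by move=> x _; case: (hq x).
  - by move=> x _; rewrite derive1E; case: (hq x).
  - by apply: continuous_subspaceT => x; exact: continuous_cos_affine.
  - split; last 2 first.
    + by apply: cvg_at_right_filter; exact: cG.
    + by apply: cvg_at_left_filter; exact: cG.
    + by move=> x _; case: (dG x).
  - by move=> x _; rewrite derive1E; case: (dG x).
have b2 : `|\int[mu]_(x in `[- B, 0]) (dq x * G x)| <= m * `|t|^-1 * B.
  have := @Rintegral_itv_bound (fun x => dq x * G x) (m * `|t|^-1) (- B) 0.
  rewrite sub0r opprK; apply => //.
  - by move=> x; apply: continuousM; [exact: cdq|exact: cG].
  - by rewrite oppr_le0 ltW.
  - by move=> x /hm[_ h]; rewrite normrM ler_pM.
have b3 : `|\int[mu]_(x in `[- B, 0]) (cos (t * x + tau) * q x)| <= (2 * m + m * B) * `|t|^-1.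
  under eq_Rintegral do rewrite mulrC.
  rewrite ibp; apply: le_trans (ler_normB _ _) _.
  have h0 : `|q 0 * G 0| <= m * `|t|^-1.
    by rewrite normrM ler_pM//; apply: (hm 0 _).1; rewrite lexx oppr_le0 ltW.
  have h1 : `|q (- B) * G (- B)| <= m * `|t|^-1.
    by rewrite normrM ler_pM//; apply: (hm _ _).1; rewrite lexx oppr_le0 ltW.
  have := ler_normB (q 0 * G 0) (q (- B) * G (- B)).
  rewrite (_ : (2 * m + m * B) * _ = 2 * (m * `|t|^-1) + m * `|t|^-1 * B); last by ring.
  by lra.
have tp : 0 < `|t| by rewrite normr_gt0.
have := ler_wpM2l (ltW tp) b3; rewrite mulrCA mulfV ?gt_eqF// mulr1.
lra.
Qed.

End Oscillatory.

(** * Decay and regularity of the kernel attached to one half strip *)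

Section DecayingKernel.
Variable R : realType.
Local Notation mu := (@lebesgue_measure R).

Lemma measurable_lteif d (T : measurableType d) (e : bool) (g h : T -> R) :
  measurable_fun setT g -> measurable_fun setT h ->
  measurable_fun setT (fun x => (g x < h x ?<= if e)%:R : R).
Proof.
move=> mg mh.
rewrite (_ : (fun x => _) = \1_[set x | g x < h x ?<= if e]); last first.
  apply/funext => x; rewrite indicE; have [hx|hx] := boolP (g x < h x ?<= if e).
    by rewrite mem_set.
  by rewrite memNset//=; exact/negP.
apply: measurable_indic; rewrite -[X in measurable X]setTI; case: e => /=.
- by have := @measurable_fun_ler _ _ _ setT _ _ mg mh measurableT [set true] I; exact.
- by have := @measurable_fun_ltr _ _ _ setT _ _ mg mh measurableT [set true] I; exact.
Qed.

Lemma integral_scale_itv (a u w : R) : 0 <= a -> u <= w ->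
  (\int[mu]_y (a%:E * (\1_(`[u, w]%classic) y)%:E) = (a * (w - u))%:E)%E.
Proof.
move=> a0 uw; rewrite ge0_integralZl_EFin//.
- rewrite integral_indic// setIT EFinM; congr (_ * _)%E.
  have := lebesgue_measure_itv `[u, w]; rewrite /= lte_fin => ->.
  by case: ltgtP uw => // ->; rewrite subrr.
- by apply/measurable_EFinP; exact: measurable_indic.
Qed.

(** In [decay_diff] squares are integrated, yet [|x - x'|] appears to the first power: the jump of
    the cutoff produces a difference that is not small on a set of that length. The threshold 6
    exceeds the largest distance to the grid used later and keeps [1 + |x|] and [1 + |x'|]
    comparable. *)
Record decaying_kernel (p : R -> R -> R) (C D : R) : Prop := DecayingKernel {
  decay_C0 : 0 <= C;
  decay_D0 : 0 <= D;
  decay_meas : forall x, measurable_fun setT (p x);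
  decay_le : forall x y, `|p x y| <= C / (1 + `|x|);
  decay_supp : forall x y, D < `|x + y| -> p x y = 0;
  decay_diff : forall x x', `|x - x'| <= 6 ->
    (\int[mu]_y ((p x y - p x' y) ^+ 2)%:E <=
     (C * `|x - x'| / (1 + `|x|) ^+ 2)%:E)%E }.

Variables (phi dphi : R * R -> R) (B M : R).
Hypothesis ht : lipschitz_test phi dphi B M.
Variables (b d L tau : R).
Hypothesis L0 : 0 < L.

(** The integral over [eta < 0] truncated at [- L]: [tau = 0] gives its real part and
    [tau = - pi / 2] its imaginary part. *)
Definition oscillatory_integral (s t : R) : R :=
  \int[mu]_(x in `[- L, 0]) (cos (t * x + tau) * phi (s, x + (b * s + d))).
Local Notation J := oscillatory_integral.

Let psi (s x : R) := phi (s, x + (b * s + d)).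
Let dpsi (s x : R) := dphi (s, x + (b * s + d)).

Let dpsiE (s x : R) : is_derive x (1 : R) (psi s) (dpsi s x).
Proof.
have h1 : is_derive x (1 : R) (fun y : R => y + (b * s + d)) (1 : R).
  have := is_deriveD (is_derive_id x (1 : R)) (is_derive_cst (b * s + d) x (1 : R)).
  by rewrite addr0.
have h2 := test_derive ht s (x + (b * s + d)).
by have := @is_derive1_comp R (fun t => phi (s, t)) (fun y => y + (b * s + d)) x _ _ h2 h1; rewrite mulr1.
Qed.

Let cdpsi s : continuous (dpsi s).
Proof.
move=> x.
have h1 : (fun=> s) @ x --> s by exact: cvg_cst.
have h2 : (y + (b * s + d)) @[y --> x] --> x + (b * s + d).
  by apply: cvgD; [exact: cvg_id|exact: cvg_cst].
have h3 : (s, y + (b * s + d)) @[y --> x] --> (s, x + (b * s + d)) by exact: (cvg_pair h1 h2).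
have h4 := @test_dcont _ _ _ _ _ ht (s, x + (b * s + d)).
exact: (cvg_comp _ _ h3 h4).
Qed.

Let cpsi s : continuous (psi s).
Proof. exact: derivable_continuous (dpsiE s). Qed.

Lemma oscillatory_integral_le s t : (1 + `|t|) * `|J s t| <= (2 + 2 * L) * M.
Proof.
rewrite /oscillatory_integral -/(psi s).
apply: (oscillatory_bound (q := psi s) t tau L0 (dpsiE s) (@cdpsi s)) => x _.
by split; [exact: (test_le ht)|exact: (test_dle ht)].
Qed.

(** The difference is again an oscillatory integral, with amplitude [psi s - psi s']; the term [|b|]
    comes from the motion of the line with [s]. *)
Lemma oscillatory_integral_shift s s' t : (1 + `|t|) * `|J s t - J s' t| <=
  (2 + 2 * L) * (M * (1 + `|b|) * `|s - s'|).
Proof.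
have -> : J s t - J s' t = \int[mu]_(x in `[- L, 0]) (cos (t * x + tau) * (psi s x - psi s' x)).
  rewrite /J -RintegralB//; last 2 first.
  - apply: continuous_integrable_itv => x; apply: continuousM.
      exact: continuous_cos_affine.
    exact: cpsi.
  - apply: continuous_integrable_itv => x; apply: continuousM.
      exact: continuous_cos_affine.
    exact: cpsi.
  by apply: eq_Rintegral => x _; rewrite mulrBr.
have e x : `|s - s'| + `|x + (b * s + d) - (x + (b * s' + d))| <= (1 + `|b|) * `|s - s'|.
  have -> : x + (b * s + d) - (x + (b * s' + d)) = b * (s - s') by ring.
  by rewrite normrM mulrDl mul1r.
apply: (oscillatory_bound (q := fun x => psi s x - psi s' x)
  (dq := fun x => dpsi s x - dpsi s' x) t tau L0).
- by move=> x; have := is_deriveB (dpsiE s x) (dpsiE s' x).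
- by move=> x; apply: continuousB; exact: cdpsi.
- move=> x _; rewrite -mulrA; split.
  + apply: le_trans (test_lip ht _ _) _; rewrite ler_wpM2l ?(test_M0 ht)//; exact: e.
  + apply: le_trans (test_dlip ht _ _) _; rewrite ler_wpM2l ?(test_M0 ht)//; exact: e.
Qed.

Lemma sin_le_norm (x : R) : `|sin x| <= `|x|.
Proof.
have := @derivable_lipschitz R sin 1 x 0; rewrite sin0 !subr0 mul1r; apply => y.
  exact: ex_derive.
rewrite derive1E derive_val ler_norml; by rewrite cos_geN1 cos_le1.
Qed.

(* cos A - cos B = 2 cos ((A + B) / 2 + pi / 2) sin ((A - B) / 2) turns a change
   of frequency into a change of amplitude at the mean frequency. *)
Lemma oscillatory_integral_freq s t t' :
  (1 + `|(t + t') / 2|) * `|J s t - J s t'| <= (2 + 2 * L) * (M * (1 + L) * `|t - t'|).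
Proof.
pose k := (t - t') / 2; pose a := (t + t') / 2.
pose q x := 2 * sin (k * x) * psi s x.
pose dq x := 2 * (cos (k * x) * k) * psi s x + 2 * sin (k * x) * dpsi s x.
have hs (x : R) : is_derive x (1 : R) (fun y => 2 * sin (k * y)) (2 * (cos (k * x) * k)).
  have := is_derive_sin_affine k 0 x; rewrite addr0 => h.
  have := is_deriveZ 2 h; rewrite /GRing.scale/=.
  by under eq_fun do rewrite addr0.
have csin (x : R) : {for x, continuous (fun y : R => 2 * sin (k * y) : R)}.
  by apply/differentiable_continuous/derivable1_diffP; case: (hs x).
have dqE (x : R) : is_derive x (1 : R) q (dq x).
  have := is_deriveM (hs x) (dpsiE s x); rewrite /GRing.scale/= => h.
  have := is_derive_eq h; apply.
  by rewrite /dq addrC; congr (_ + _); ring.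
have ccos : continuous (fun y : R => 2 * (cos (k * y) * k) : R).
  have ck : continuous (fun y : R => cos (k * y)).
    by have := @continuous_cos_affine R k 0; under eq_fun do rewrite addr0.
  move=> x.
  have h1 : (fun=> 2 : R) @ x --> (2 : R) by exact: cvg_cst.
  have h2 : (fun=> k : R) @ x --> (k : R) by exact: cvg_cst.
  exact: (cvgM h1 (cvgM (ck x) h2)).
have cdq : continuous dq.
  move=> x.
  exact: (cvgD (cvgM (ccos x) (@cpsi s x)) (cvgM (csin x) (@cdpsi s x))).
have -> : J s t - J s t' = \int[mu]_(x in `[- L, 0]) (cos (a * x + (tau + pi / 2)) * q x).
  rewrite /J -RintegralB//; last 2 first.
  - apply: continuous_integrable_itv => x; apply: continuousM.
      exact: continuous_cos_affine.
    exact: cpsi.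
  - apply: continuous_integrable_itv => x; apply: continuousM.
      exact: continuous_cos_affine.
    exact: cpsi.
  apply: eq_Rintegral => x _; rewrite -mulrBl /q mulrA; congr (_ * _).
  rewrite addrA cosDpihalf.
  have -> : t * x + tau = (a * x + tau) + k * x by rewrite /a /k; lra.
  have -> : t' * x + tau = (a * x + tau) - k * x by rewrite /a /k; lra.
  by rewrite cosD cosB; ring.
have k2 : `|t - t'| = 2 * `|k|.
  by rewrite /k normrM normfV (ger0_norm (ler0n _ 2)); lra.
have M0 := test_M0 ht.
apply: (oscillatory_bound (q := q) (dq := dq) a (tau + pi / 2) L0 dqE cdq) => x /andP[x1 x2].
have xL : `|x| <= L by rewrite ler_norml x1/= (le_trans x2)// ltW.
have hsin : `|2 * sin (k * x)| <= `|t - t'| * L.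
  rewrite normrM ger0_norm// k2 -mulrA ler_wpM2l//.
  by apply: le_trans (sin_le_norm _) _; rewrite normrM ler_wpM2l.
have hcos : `|2 * (cos (k * x) * k)| <= `|t - t'|.
  rewrite normrM ger0_norm// k2 ler_wpM2l// normrM ler_piMl//.
  by rewrite ler_norml cos_geN1 cos_le1.
have t0 := normr_ge0 (t - t').
have e1 : `|2 * sin (k * x) * psi s x| <= `|t - t'| * L * M.
  by rewrite normrM ler_pM//; exact: (test_le ht).
have e2 : `|2 * sin (k * x) * dpsi s x| <= `|t - t'| * L * M.
  by rewrite normrM ler_pM//; exact: (test_dle ht).
have e3 : `|2 * (cos (k * x) * k) * psi s x| <= `|t - t'| * M.
  by rewrite normrM ler_pM//; exact: (test_le ht).
have -> : M * (1 + L) * `|t - t'| = `|t - t'| * M + `|t - t'| * L * M by ring.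
split; first by apply: le_trans e1 _; rewrite lerDr mulr_ge0.
by apply: le_trans (ler_normD _ _) _; exact: lerD.
Qed.

Variables (c : R) (e : bool).

Definition piece_kernel (x y : R) : R :=
  ((x + y) / 2 < c ?<= if e)%:R * J ((x + y) / 2) (x - y).

Lemma oscillatory_integral_out s t : B < `|s| -> J s t = 0.
Proof.
move=> sB; rewrite /oscillatory_integral.
under eq_Rintegral do rewrite (test_box ht) ?sB// mulr0.
by rewrite Rintegral_cst// mul0r.
Qed.

Let K := (2 + 2 * L) * M.

Let K0 : 0 <= K.
Proof. by rewrite mulr_ge0 ?(test_M0 ht)// addr_ge0// mulr_ge0// ltW. Qed.

(** Where the symbol lives, [|s| <= B], and [x = s + t / 2] gives [1 + |x| <= (1 + B) (1 + |t|)]: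
    decay in [t] becomes decay in [x]. *)
Lemma oscillatory_integral_decay x y :
  `|J ((x + y) / 2) (x - y)| <= K * (1 + B) / (1 + `|x|).
Proof.
have x1 : 0 < 1 + `|x| by rewrite ltr_wpDr.
have B0 := test_B0 ht.
have [sB|sB] := leP `|(x + y) / 2| B; last first.
  rewrite oscillatory_integral_out// normr0 divr_ge0// ?(ltW x1)//.
  by rewrite mulr_ge0// addr_ge0// ltW.
rewrite ler_pdivlMr// mulrC.
have := oscillatory_integral_le ((x + y) / 2) (x - y); rewrite -/K => h.
have h2 : 1 + `|x| <= (1 + B) * (1 + `|x - y|).
  have : `|x| <= `|(x + y) / 2| + `|(x - y) / 2|.
    by apply: le_trans (ler_normD _ _); rewrite le_eqVlt; apply/orP; left; apply/eqP; congr (`|_|); lra.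
  rewrite [`|(x - y) / 2|]normrM [`|2^-1|]ger0_norm//; have := normr_ge0 (x - y).
  by nra.
apply: (@le_trans _ _ ((1 + B) * (1 + `|x - y|) * `|J ((x + y) / 2) (x - y)|)).
  by rewrite ler_wpM2r.
by rewrite -mulrA [leRHS]mulrC ler_wpM2l// addr_ge0// ltW.
Qed.

Let K1 := K * (1 + B).
Let K2 := (6 + B) * K * (2 + `|b| + L).

Let K20 : 0 <= K2.
Proof.
have B0 := test_B0 ht.
by apply: mulr_ge0; [apply: mulr_ge0; [lra|exact: K0]|rewrite !addr_ge0// ltW].
Qed.

(** Moving [x] changes both [s] and [t]; the passage goes through [J s' t]. The frequency estimate
    decays in the mean frequency, which differs from [t] by at most 3; with [|s| <= B + 3] this
    bounds [1 + |x|] by [6 + B] times either weight. *)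
Lemma oscillatory_integral_lipschitz x x' y : `|x - x'| <= 6 ->
  `|J ((x + y) / 2) (x - y) - J ((x' + y) / 2) (x' - y)| <=
  K2 * `|x - x'| / (1 + `|x|).
Proof.
move=> hx.
have x1 : 0 < 1 + `|x| by rewrite ltr_wpDr.
have B0 := test_B0 ht; have M0 := test_M0 ht; have b0 := normr_ge0 b.
have dx0 := normr_ge0 (x - x').
have L1 := L0.
have [out|] := boolP ((B < `|(x + y) / 2|) && (B < `|(x' + y) / 2|)).
  case/andP: out => o1 o2; rewrite !oscillatory_integral_out// subrr normr0.
  by apply: divr_ge0; [exact: mulr_ge0|exact: ltW].
rewrite negb_and -!leNgt => sB.
set s := (x + y) / 2; set s' := (x' + y) / 2; set t := x - y; set t' := x' - y.
have ss : `|s - s'| = `|x - x'| / 2.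
  have -> : s - s' = (x - x') / 2 by rewrite /s /s'; lra.
  by rewrite normrM normfV (ger0_norm (ler0n _ 2)).
have tt : `|t - t'| = `|x - x'| by congr (`|_|); rewrite /t /t'; lra.
have sB3 : `|s| <= B + 3.
  case/orP: sB => h; first by rewrite (le_trans h)// lerDl.
  have -> : s = s' + (s - s') by lra.
  by apply: le_trans (ler_normD _ _) _; rewrite ss; apply: lerD => //; lra.
have xt : `|x| <= `|s| + `|t| / 2.
  have -> : x = s + t / 2 by rewrite /s /t; lra.
  apply: le_trans (ler_normD _ _) _.
  by rewrite [`|t / 2|]normrM normfV (ger0_norm (ler0n _ 2)) lexx.
pose tm := (t + t') / 2.
have ttm : `|t| <= `|tm| + 3.
  have -> : t = tm + (t - t') / 2 by rewrite /tm; lra.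
  apply: le_trans (ler_normD _ _) _.
  by rewrite [`|(t - t') / 2|]normrM normfV (ger0_norm (ler0n _ 2)) tt; lra.
have h1 := oscillatory_integral_shift s s' t.
have h2 := oscillatory_integral_freq s' t t'.
rewrite -/tm tt in h2; rewrite ss in h1.
rewrite ler_pdivlMr//.
have t0 := normr_ge0 t; have tm0 := normr_ge0 tm.
have xt1 : 1 + `|x| <= (6 + B) * (1 + `|t|) by nra.
have xt2 : 1 + `|x| <= (6 + B) * (1 + `|tm|) by nra.
set A1 := J s t - J s' t in h1; set A2 := J s' t - J s' t' in h2.
have -> : J s t - J s' t' = A1 + A2 by rewrite /A1 /A2; lra.
apply: (@le_trans _ _ ((`|A1| + `|A2|) * (1 + `|x|))).
  by rewrite ler_wpM2r ?(ltW x1)// ler_normD.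
have g1 : `|A1| * (1 + `|x|) <= (6 + B) * (K * (1 + `|b|) * `|x - x'|).
  apply: (@le_trans _ _ (`|A1| * ((6 + B) * (1 + `|t|)))); first by rewrite ler_wpM2l.
  rewrite mulrCA ler_wpM2l ?addr_ge0 ?(ltW B0)// mulrC; apply: le_trans h1 _.
  rewrite /K -!mulrA; rewrite !ler_wpM2l ?addr_ge0 ?mulr_ge0 ?(ltW L0)//; lra.
have g2 : `|A2| * (1 + `|x|) <= (6 + B) * (K * (1 + L) * `|x - x'|).
  apply: (@le_trans _ _ (`|A2| * ((6 + B) * (1 + `|tm|)))); first by rewrite ler_wpM2l.
  rewrite mulrCA ler_wpM2l ?addr_ge0 ?(ltW B0)// mulrC; apply: le_trans h2 _.
  by rewrite /K -!mulrA.
rewrite mulrDl; apply: le_trans (lerD g1 g2) _.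
by rewrite le_eqVlt; apply/orP; left; apply/eqP; rewrite /K2; ring.
Qed.

Lemma measurable_oscillatory_integral d0 (T : measurableType d0) (f g : T -> R) :
  measurable_fun setT f -> measurable_fun setT g ->
  measurable_fun setT (fun z => J (f z) (g z)).
Proof.
move=> mf mg.
pose F (z : T * R) : R := \1_(`[- L, 0]%classic) z.2 *
  (cos (g z.1 * z.2 + tau) * phi (f z.1, z.2 + (b * f z.1 + d))).
have mphi := continuous2_measurable (@test_cont _ _ _ _ _ ht).
have mcos : measurable_fun setT (@cos R).
  by apply: continuous_measurable_fun; exact: continuous_cos.
have mf1 : measurable_fun setT (fun z : T * R => f z.1) by exact: measurableT_comp.
have mg1 : measurable_fun setT (fun z : T * R => g z.1) by exact: measurableT_comp.
have mF : measurable_fun setT F.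
  apply: measurable_funM.
    exact: (measurableT_comp (f := \1_(`[- L, 0]%classic) : R -> R)).
  apply: measurable_funM.
    apply: (measurableT_comp mcos); apply: measurable_funD => //.
    by apply: measurable_funM.
  apply: (measurableT_comp mphi); apply: measurable_fun_pair => //.
  by apply: measurable_funD => //; apply: measurable_funD => //; exact: measurable_funM.
have := @measurable_parameter_integral R d0 T F M L mF.
rewrite (_ : (fun x => \int[mu]_y F (x, y)) = (fun z => J (f z) (g z))).
  apply.
  - move=> z; rewrite /F !normrM -[leRHS]mul1r ler_pM ?mulr_ge0//.
      by rewrite indicE; case: (_ \in _); rewrite ?normr1 ?normr0.
    rewrite -[leRHS]mul1r ler_pM//; last exact: (test_le ht).
    by rewrite ler_norml cos_geN1 cos_le1.
  - move=> z hz; rewrite /F indicE memNset ?mul0r//= in_itv/=.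
    apply/negP; apply: contra hz => /andP[z1 z2].
    by rewrite ler_norml z1 (le_trans z2)// ltW.
apply/funext => z; rewrite /oscillatory_integral [RHS]Rintegral_mkcond.
apply: eq_Rintegral => x _; rewrite /F/= patchE indicE; case: ifPn => _.
  by rewrite mul1r.
by rewrite mul0r.
Qed.

Lemma lteif_between (u v w : R) : (u < w ?<= if e) != (v < w ?<= if e) ->
  Num.min u v <= w <= Num.max u v.
Proof.
rewrite ge_min le_max; case: e => /=; rewrite ?leNgt => h;
  case: (ltgtP u w) h; case: (ltgtP v w) => //=; rewrite ?orbT//.
Qed.

Lemma piece_kernel_decaying : exists C D, decaying_kernel piece_kernel C D.
Proof.
(* [|x + y| <= W] as soon as one of the two midpoints lies in the support, because
   [|x - x'| <= 6]. *)
pose W := 2 * B + 6.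
have B0 := test_B0 ht; have W0 : 0 <= W by rewrite /W; lra.
have K10 : 0 <= K1 by apply: mulr_ge0; [exact: K0|lra].
(* The summands are the decay constant, [2 W K2^2] times 6 from the Lipschitz part, where one factor
   [|x - x'|] is bounded by 6, and [(7 K1)^2] from the jump. *)
pose C := K1 + 12 * W * K2 ^+ 2 + 49 * K1 ^+ 2.
have C1 : 0 <= 12 * W * K2 ^+ 2 by apply: mulr_ge0; [lra|exact: sqr_ge0].
have C2 : 0 <= 49 * K1 ^+ 2 by apply: mulr_ge0; [lra|exact: sqr_ge0].
have C0 : 0 <= C by rewrite /C; lra.
have mp x : measurable_fun setT (piece_kernel x).
  have ms : measurable_fun setT (fun y : R => (x + y) / 2).
    by apply: measurable_funM => //; exact: measurable_funD.
  apply: measurable_funM; first exact: measurable_lteif.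
  by apply: measurable_oscillatory_integral => //; exact: measurable_funB.
exists C, (2 * B); split => //.
- by lra.
- move=> x y; rewrite /piece_kernel normrM.
  apply: (@le_trans _ _ (K1 / (1 + `|x|))).
    rewrite -[leRHS]mul1r ler_pM//; last exact: oscillatory_integral_decay.
    by case: (_ < _ ?<= if _); rewrite ?normr1 ?normr0.
  rewrite ler_wpM2r ?invr_ge0 ?addr_ge0// /C; lra.
- move=> x y h; rewrite /piece_kernel oscillatory_integral_out ?mulr0//.
  by rewrite normrM normfV (ger0_norm (ler0n _ 2)); lra.
move=> x x' hx.
have x1 : 0 < 1 + `|x| by rewrite ltr_wpDr.
have dx0 := normr_ge0 (x - x').
(* [I1] carries the Lipschitz part of the difference; [I2], of length [|x - x'|], contains every [y]
   for which [c] separates the two midpoints. *)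
pose I1 := `[- x - W, - x + W]%classic : set R.
pose I2 := `[2 * c - Num.max x x', 2 * c - Num.min x x']%classic : set R.
have mI1 : measurable I1 by exact: measurable_itv.
have mI2 : measurable I2 by exact: measurable_itv.
pose v := (1 + `|x|) ^- 2.
have v0 : 0 <= v by rewrite invr_ge0 sqr_ge0.
pose a1 := (K2 * `|x - x'|) ^+ 2 * v; pose a2 := (7 * K1) ^+ 2 * v.
have a10 : 0 <= a1 by rewrite mulr_ge0 ?sqr_ge0.
have a20 : 0 <= a2 by rewrite mulr_ge0 ?sqr_ge0.
apply: (@le_trans _ _ (\int[mu]_y (a1%:E * (\1_I1 y)%:E + a2%:E * (\1_I2 y)%:E))%E).
  apply: ge0_le_integral => //.
  - by move=> y _; rewrite lee_fin sqr_ge0.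
  - by apply/measurable_EFinP/measurable_funX; apply: measurable_funB; exact: mp.
  - by apply: emeasurable_funD; apply: emeasurable_funM => //; apply/measurable_EFinP; exact: measurable_indic.
  move=> y _; rewrite -!EFinM -EFinD lee_fin.
  have [ho|ho] := boolP ((B < `|(x + y) / 2|) && (B < `|(x' + y) / 2|)).
    case/andP: ho => o1 o2; rewrite /piece_kernel !oscillatory_integral_out// !mulr0 subrr expr0n/=.
    by rewrite addr_ge0// mulr_ge0.
  have yW : `|x + y| <= W.
    move: ho; rewrite negb_and -!leNgt => /orP[] h.
      by move: h; rewrite normrM normfV (ger0_norm (ler0n _ 2)) /W; lra.
    have -> : x + y = 2 * ((x' + y) / 2) + (x - x') by lra.
    apply: le_trans (ler_normD _ _) _.
    by rewrite normrM (ger0_norm (ler0n _ 2)) /W; lra.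
  have -> : \1_I1 y = 1 :> R.
    rewrite indicE mem_set// /I1/= in_itv/=; move: yW; rewrite ler_norml => /andP[? ?].
    by apply/andP; split; lra.
  rewrite mulr1 /piece_kernel.
  have E (z w : R) : 0 <= w -> `|z| <= w / (1 + `|x|) -> z ^+ 2 <= w ^+ 2 * v.
    move=> w0 zw; rewrite -[z ^+ 2]real_normK ?num_real// /v -exprVn -exprMn.
    by rewrite lerXn2r ?nnegrE// divr_ge0// ltW.
  have hJ := oscillatory_integral_lipschitz y hx.
  have [tt|tt] := eqVneq ((x + y) / 2 < c ?<= if e) ((x' + y) / 2 < c ?<= if e).
    rewrite -tt -mulrBr exprMn.
    have h := E _ _ (mulr_ge0 K20 dx0) hJ.
    apply: (@le_trans _ _ a1); last by rewrite lerDl mulr_ge0.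
    apply: le_trans h; rewrite -[leRHS]mul1r ler_wpM2r ?sqr_ge0//.
    by case: (_ < _ ?<= if _); rewrite ?expr1n ?expr0n.
  have -> : \1_I2 y = 1 :> R.
    have /andP[h1 h2] := lteif_between tt.
    rewrite indicE mem_set// /I2/= in_itv/=; move: h1 h2.
    rewrite ge_min le_max => /orP h1 /orP h2.
    by have [xx|xx] := leP x x'; apply/andP; split; case: h1 => h1; case: h2 => h2; lra.
  rewrite mulr1; apply: (@le_trans _ _ a2); last by rewrite lerDr.
  apply: E; first by rewrite mulr_ge0.
  have d1 : `|J ((x + y) / 2) (x - y)| <= 7 * K1 / (1 + `|x|).
    apply: le_trans (oscillatory_integral_decay _ _) _; rewrite -/K1.
    by rewrite ler_wpM2r ?invr_ge0 ?(ltW x1)//; lra.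
  (* The factor 7 transfers the decay from [x'] to [x], since [1 + |x| <= 7 (1 + |x'|)]. *)
  have d2 : `|J ((x' + y) / 2) (x' - y)| <= 7 * K1 / (1 + `|x|).
    apply: le_trans (oscillatory_integral_decay _ _) _; rewrite -/K1.
    have x1' : 0 < 1 + `|x'| by rewrite ltr_wpDr.
    rewrite ler_pdivrMr// mulrAC ler_pdivlMr//.
    have : `|x| <= `|x'| + 6.
      have -> : x = x' + (x - x') by lra.
      by apply: le_trans (ler_normD _ _) _; rewrite lerD2l.
    by have := normr_ge0 x'; nra.
  move: tt d1 d2; rewrite -/K1.
  by do 2 case: (_ < _ ?<= if _) => //=; rewrite ?mul1r ?mul0r ?subr0 ?sub0r ?normrN.
rewrite ge0_integralD//; last 4 first.
- by move=> y _; rewrite -EFinM lee_fin mulr_ge0.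
- by apply: emeasurable_funM => //; apply/measurable_EFinP; exact: measurable_indic.
- by move=> y _; rewrite -EFinM lee_fin mulr_ge0.
- by apply: emeasurable_funM => //; apply/measurable_EFinP; exact: measurable_indic.
rewrite !integral_scale_itv//; last 2 first.
- by case: (leP x x'); lra.
- by lra.
have -> : 2 * c - Num.min x x' - (2 * c - Num.max x x') = `|x - x'|.
  case: (leP x x') => h; first by rewrite (ler0_norm (x := x - x')); lra.
  by rewrite (gtr0_norm (x := x - x')); lra.
have -> : - x + W - (- x - W) = 2 * W by lra.
rewrite -EFinD lee_fin -/v.
have -> : a1 * (2 * W) + a2 * `|x - x'| =
    (K2 ^+ 2 * 2 * W * `|x - x'| + 49 * K1 ^+ 2) * `|x - x'| * v by rewrite /a1 /a2; ring.
rewrite ler_wpM2r// ler_wpM2r// /C.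
have : K2 ^+ 2 * 2 * W * `|x - x'| <= K2 ^+ 2 * 2 * W * 6.
  rewrite ler_wpM2l//; apply: mulr_ge0 => //; apply: mulr_ge0 => //; exact: sqr_ge0.
by lra.
Qed.

End DecayingKernel.

(** * Approximation on a geometric grid *)

Section LogIntegral.
Variable R : realType.
Local Notation mu := (@lebesgue_measure R).

Lemma continuous_inv_affine (a : R) : 0 < a -> continuous (fun x : R => (a + `|x|)^-1).
Proof.
move=> a0 x; apply: cvgV; first by rewrite gt_eqF// ltr_wpDr.
by apply: cvgD; [exact: cvg_cst|exact: cvg_norm].
Qed.

Lemma is_derive_ln_affine (a x : R) : 0 < a + x ->
  is_derive x (1 : R) (fun y => ln (a + y)) (a + x)^-1.
Proof.
move=> ax.
have h1 : is_derive x (1 : R) (fun y : R => a + y) (1 : R).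
  by have := is_deriveD (is_derive_cst a x (1 : R)) (is_derive_id x (1 : R)); rewrite add0r.
have h2 := is_derive1_ln ax.
by have := @is_derive1_comp R (@ln R) (fun y => a + y) x _ _ h2 h1; rewrite mulr1.
Qed.

(** This weight dominates, up to constants, both error profiles of the grid: [1 / (1 + |x|)] up to
    [Y] and [Y / (1 + |x|)^2] beyond. Its integral is explicit, as [ln (1 + x) - ln (Y + x)] rises
    from [- ln Y] to 0 on the half line. *)
Lemma integral_log_tail (Y : R) : 1 < Y ->
  (\int[mu]_x ((1 + `|x|)^-1 - (Y + `|x|)^-1)%:E = (2 * ln Y)%:E)%E.
Proof.
move=> Y1; have Y0 : 0 < Y by lra.
pose f (x : R) := (1 + `|x|)^-1 - (Y + `|x|)^-1.
have f0 x : 0 <= f x.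
  have := normr_ge0 x => x0.
  by rewrite subr_ge0 lef_pV2 ?posrE; lra.
have cf : continuous f.
  move=> x; have h1 := @continuous_inv_affine 1 ltr01 x.
  by have h2 := @continuous_inv_affine Y Y0 x; exact: (cvgB h1 h2).
rewrite (ge0_symfun_integralT f0 cf); last by move=> x; rewrite /f/= normrN.
rewrite -set_itvcy EFinM; congr (_ * _)%E.
pose F (x : R) := ln (1 + x) - ln (Y + x).
have dF (x : R) : 0 <= x -> is_derive x (1 : R) F ((1 + x)^-1 - (Y + x)^-1).
  by move=> x0; apply: is_deriveB; apply: is_derive_ln_affine; lra.
rewrite (@ge0_continuous_FTC2y _ f F 0 0).
- by rewrite /F !addr0 ln1 sub0r EFinN sub0e oppeK.
- by move=> x _; exact: f0.
- exact: continuous_subspaceT.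
- have h1 : (1 + x : R) @[x --> +oo%R] --> +oo%R.
    apply: (cvgryPge (F := +oo%R) _).2 => A; near=> x.
    have xA : A <= x by near: x; apply: nbhs_pinfty_ge; exact: num_real.
    by lra.
  have h2 : (1 + x)^-1 @[x --> +oo%R] --> (0 : R).
    apply/gtr0_cvgV0 => //; near=> x.
    have x0 : 0 <= x by near: x; apply: nbhs_pinfty_ge; exact: num_real.
    by lra.
  have h3 : (fun _ : R => Y - 1 : R) @ +oo%R --> (Y - 1 : R) by exact: cvg_cst.
  have h4 : - ((Y - 1) * (1 + x)^-1) @[x --> +oo%R] --> (0 : R).
    rewrite -[X in _ --> X]oppr0 -[X in _ --> - X](mulr0 (Y - 1)).
    by apply: cvgN; exact: (cvgM h3 h2).
  have h5 : (fun _ : R => 0 : R) @ +oo%R --> (0 : R) by exact: cvg_cst.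
  apply: (squeeze_cvgr _ h4 h5); near=> x.
  have x0 : 0 <= x by near: x; apply: nbhs_pinfty_ge; exact: num_real.
  have x1 : 0 < 1 + x by lra.
  have Yx : 0 < Y + x by lra.
  rewrite /F /=; apply/andP; split; last by rewrite subr_le0 ler_ln ?posrE//; lra.
  have e : ln (Y + x) = ln (1 + (Y - 1) * (1 + x)^-1) + ln (1 + x).
    rewrite -lnM ?posrE//; last by rewrite ltr_wpDr// mulr_ge0 ?invr_ge0//; lra.
    by congr ln; rewrite mulrDl mul1r mulfVK ?gt_eqF//; lra.
  rewrite e opprD addrCA subrr addr0 lerN2; apply: le_ln1Dx.
  by apply: (@lt_le_trans _ _ 0) => //; rewrite mulr_ge0 ?invr_ge0//; lra.
- by move=> x x0; case: (dF x (ltW x0)).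
- apply: cvg_at_right_filter; apply/differentiable_continuous/derivable1_diffP.
  by case: (dF 0 (lexx 0)).
- move=> x; rewrite in_itv/= andbT => x0; rewrite derive1E.
  by case: (dF x (ltW x0)) => _ ->; rewrite /f gtr0_norm.
Unshelve. all: by end_near.
Qed.
End LogIntegral.

(** * Finite rank operators plus small Hilbert-Schmidt remainders *)

Section Approximable.
Variable R : realType.
Local Notation mu := (@lebesgue_measure R).

(** On functions orthogonal to [l 0, ..., l (r - 1)] the operator acts through a remainder whose row
    at [x] has square norm at most [E x], so the integral of [E] stands for the squared
    Hilbert-Schmidt norm. Rows are given separately for each [x]; only the majorant [E] has to be
    measurable in [x], so a nearby grid point may be selected arbitrarily. *)
Definition approximable (T : (R -> R) -> R -> R) : Prop :=
  exists2 C, 0 <= C & forall N : nat, (2 <= N)%N ->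
  exists (r : nat) (l : nat -> R -> R) (E : R -> R),
  [/\ r%:R <= C * (N%:R * ln N%:R),
      forall i, sqint (l i),
      measurable_fun setT E /\ (forall x, 0 <= E x),
      (\int[mu]_x (E x)%:E <= (C * (ln N%:R / N%:R))%:E)%E &
      forall x, exists k, [/\ sqint k, (\int[mu]_y (k y ^+ 2)%:E <= (E x)%:E)%E &
        forall u, sqint u -> (forall i, (i < r)%N -> \int[mu]_y (l i y * u y) = 0) ->
        T u x = \int[mu]_y (k y * u y)]].

Lemma lnN_ge (N : nat) : (2 <= N)%N -> 0 < ln (2 : R) <= ln (N%:R : R).
Proof.
move=> N2; rewrite ln_gt0 ?ltr1n//= ler_ln ?posrE ?ler_nat// ?ltr0n//.
exact: leq_trans N2.
Qed.

Lemma approximable_ext T T' : approximable T ->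
  (forall u x, sqint u -> T' u x = T u x) -> approximable T'.
Proof.
move=> [C C0 hT] e; exists C => // N /hT[r [l [E [h1 h2 h3 h4 h5]]]].
exists r, l, E; split => // x; have [k [k1 k2 k3]] := h5 x.
by exists k; split => // u hu hl; rewrite e// k3.
Qed.

(** A bounded factor in [x] multiplies the rows and leaves the functionals [l] untouched, however
    fast it oscillates. This absorbs the phase in [x]. *)
Lemma approximable_scale T (a : R -> R) c : (forall x, `|a x| <= c) ->
  approximable T -> approximable (fun u x => a x * T u x).
Proof.
move=> ac [C C0 hT].
have c0 : 0 <= c by apply: le_trans (ac 0).
have c21 : 1 <= 1 + c ^+ 2 by rewrite lerDl sqr_ge0.
exists (C * (1 + c ^+ 2)); first by rewrite mulr_ge0// (le_trans _ c21).
move=> N N2; have [r [l [E [h1 h2 [mE E0] h4 h5]]]] := hT N N2.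
have /andP[l2 lN] := lnN_ge N2.
have lN0 : 0 <= ln (N%:R : R) by rewrite (le_trans _ lN)// ltW.
exists r, l, (fun x => c ^+ 2 * E x); split => //.
- by apply: le_trans h1 _; rewrite ler_wpM2r ?mulr_ge0// ler_peMr.
- split; first exact: measurable_funM.
  by move=> x; rewrite mulr_ge0// sqr_ge0.
- under eq_integral do rewrite EFinM.
  rewrite ge0_integralZl_EFin ?sqr_ge0//; last 2 first.
  + by move=> x _; rewrite lee_fin.
  + exact/measurable_EFinP.
  apply: (@le_trans _ _ ((c ^+ 2)%:E * (C * (ln N%:R / N%:R))%:E)%E).
    by rewrite lee_wpmul2l// lee_fin sqr_ge0.
  rewrite -EFinM lee_fin mulrA ler_wpM2r ?divr_ge0// mulrC ler_wpM2l// lerDr//.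
move=> x; have [k [k1 k2 k3]] := h5 x.
exists (fun y => a x * k y); split; first exact: sqintZ.
- under eq_integral do rewrite exprMn EFinM.
  rewrite ge0_integralZl_EFin ?sqr_ge0//; last 2 first.
  + by move=> y _; rewrite lee_fin sqr_ge0.
  + by apply/measurable_EFinP/measurable_funX; case: k1.
  rewrite [X in (_ <= X)%E]EFinM; apply: lee_pmul => //; first by rewrite lee_fin sqr_ge0.
    by apply: integral_ge0 => y _; rewrite lee_fin sqr_ge0.
  by rewrite lee_fin -[leLHS]real_normK ?num_real// lerXn2r ?nnegrE.
move=> u hu hl; rewrite k3// -RintegralZl//; last exact: sqint_mul.
by apply: eq_Rintegral => y _; rewrite mulrA.
Qed.

Lemma approximableD T1 T2 : approximable T1 -> approximable T2 ->
  approximable (fun u x => T1 u x + T2 u x).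
Proof.
move=> [C1 C10 h1] [C2 C20 h2].
exists (2 * C1 + 2 * C2); first by rewrite addr_ge0// mulr_ge0.
move=> N N2; have /andP[l2 lN] := lnN_ge N2.
have lN0 : 0 <= ln (N%:R : R) by rewrite (le_trans _ lN)// ltW.
have [r1 [l1 [E1 [a1 a2 [mE1 E10] a4 a5]]]] := h1 N N2.
have [r2 [l_2 [E2 [b1 b2 [mE2 E20] b4 b5]]]] := h2 N N2.
(* The two lists of functionals are concatenated; the majorant below comes from
   [(a + b)^2 <= 2 a^2 + 2 b^2] applied to the sum of the rows. *)
exists (r1 + r2)%N, (fun i => if (i < r1)%N then l1 i else l_2 (i - r1)%N).
exists (fun x => 2 * E1 x + 2 * E2 x); split => //.
- rewrite natrD mulrDl; apply: lerD.
    by apply: le_trans a1 _; rewrite ler_wpM2r ?mulr_ge0//; lra.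
  by apply: le_trans b1 _; rewrite ler_wpM2r ?mulr_ge0//; lra.
- by move=> i; case: ifP.
- split; first by apply: measurable_funD; exact: measurable_funM.
  by move=> x; rewrite addr_ge0// mulr_ge0.
- under eq_integral do rewrite EFinD !EFinM.
  rewrite ge0_integralD//; last 4 first.
  + by move=> x _; rewrite -EFinM lee_fin mulr_ge0.
  + by apply: emeasurable_funM => //; exact/measurable_EFinP.
  + by move=> x _; rewrite -EFinM lee_fin mulr_ge0.
  + by apply: emeasurable_funM => //; exact/measurable_EFinP.
  rewrite !ge0_integralZl_EFin//; try exact/measurable_EFinP; try by move=> x _; rewrite lee_fin.
  apply: le_trans (leeD (lee_wpmul2l _ a4) (lee_wpmul2l _ b4)) _ => //.
  by rewrite -!EFinM -EFinD lee_fin le_eqVlt; apply/orP; left; apply/eqP; ring.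
move=> x; have [k1 [c1 c2 c3]] := a5 x; have [k2 [d1 d2 d3]] := b5 x.
have [mk1 _] := c1; have [mk2 _] := d1.
exists (fun y => k1 y + k2 y); split; first exact: sqintD.
- apply: (@le_trans _ _ (\int[mu]_y (2%:E * (k1 y ^+ 2)%:E + 2%:E * (k2 y ^+ 2)%:E))%E).
    apply: ge0_le_integral => //.
    + by move=> y _; rewrite lee_fin sqr_ge0.
    + by apply/measurable_EFinP/measurable_funX; exact: measurable_funD.
    + by apply: emeasurable_funD; apply: emeasurable_funM => //; apply/measurable_EFinP; exact: measurable_funX.
    move=> y _; rewrite -!EFinM -EFinD lee_fin.
    by have := sqr_ge0 (k1 y - k2 y); nra.
  rewrite ge0_integralD//; last 4 first.
  + by move=> y _; rewrite -EFinM lee_fin mulr_ge0// sqr_ge0.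
  + by apply: emeasurable_funM => //; apply/measurable_EFinP; exact: measurable_funX.
  + by move=> y _; rewrite -EFinM lee_fin mulr_ge0// sqr_ge0.
  + by apply: emeasurable_funM => //; apply/measurable_EFinP; exact: measurable_funX.
  rewrite !ge0_integralZl_EFin//; try (by move=> y _; rewrite lee_fin sqr_ge0);
    try (by apply/measurable_EFinP; exact: measurable_funX).
  apply: le_trans (leeD (lee_wpmul2l _ c2) (lee_wpmul2l _ d2)) _ => //.
move=> u hu hl; rewrite c3//; last first.
  by move=> i ir; have := hl i; rewrite ir => -> //; rewrite ltn_addr.
rewrite d3//; last first.
  move=> i ir; have := hl (r1 + i)%N; rewrite ltn_add2l ir => /(_ isT).
  by rewrite ltnNge leq_addr/= addKn.
rewrite -RintegralD//; try exact: sqint_mul.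
by apply: eq_Rintegral => y _; rewrite mulrDl.
Qed.

Lemma approximable0 : approximable (fun _ _ => 0).
Proof.
exists 0 => // N N2; exists 0%N, (fun=> fun=> 0), (fun=> 0); split => //.
- by rewrite mul0r.
- by move=> _; exact: sqint0.
- by rewrite integral0 mul0r.
move=> x; exists (fun=> 0); split; first exact: sqint0.
  by rewrite (eq_integral (cst 0%E)) ?integral0// => y _; rewrite expr0n.
by move=> u _ _; under eq_Rintegral do rewrite mul0r; rewrite Rintegral_cst// mul0r.
Qed.

Lemma approximable_sum (I : Type) (s : seq I) (T : I -> (R -> R) -> R -> R) (a : I -> R) :
  (forall i, approximable (T i)) -> approximable (fun u x => \sum_(i <- s) a i * T i u x).
Proof.
move=> hT; elim: s => [|i s IH].
  by apply: approximable_ext approximable0 _ => u x _; rewrite big_nil.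
have h : approximable (fun u x => a i * T i u x).
  exact: (@approximable_scale (T i) (fun=> a i) `|a i|).
by apply: approximable_ext (approximableD h IH) _ => u x _; rewrite big_cons.
Qed.

End Approximable.

(** * Sampling a decaying kernel on the geometric grid *)

Section DecayingKernelApproximable.
Variable R : realType.
Local Notation mu := (@lebesgue_measure R).

(** With [w = 1 + |x|]: from [w < Y <= 2 (Y - 1)] the second term is at most 3/4 of the first. *)
Lemma log_tail_ge_near (Y w : R) : 2 <= Y -> 1 <= w -> w < Y ->
  (4 * w)^-1 <= w^-1 - (Y - 1 + w)^-1.
Proof.
move=> Y2 w1 wY.
have w0 : 0 < w by lra.
have : (Y - 1 + w)^-1 <= (4 / 3 * w)^-1 by rewrite lef_pV2 ?posrE; lra.
have : 0 < w^-1 by rewrite invr_gt0.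
by rewrite !invfM invrK; lra.
Qed.

Lemma log_tail_ge_far (Y w : R) : 2 <= Y -> Y <= w ->
  Y / (4 * w ^+ 2) <= w^-1 - (Y - 1 + w)^-1.
Proof.
move=> Y2 Yw.
have w0 : 0 < w by lra.
have v0 : 0 < Y - 1 + w by lra.
have -> : w^-1 - (Y - 1 + w)^-1 = (Y - 1) / (w * (Y - 1 + w)) by field; lra.
rewrite ler_pdivrMr ?mulr_gt0 ?exprn_gt0// mulrAC ler_pdivlMr ?mulr_gt0//.
have h : Y * (Y - 1 + w) <= 2 * (Y - 1) * (2 * w) by rewrite ler_pM//; lra.
have -> : Y * (w * (Y - 1 + w)) = w * (Y * (Y - 1 + w)) by ring.
have -> : (Y - 1) * (4 * w ^+ 2) = w * (2 * (Y - 1) * (2 * w)) by ring.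
by rewrite ler_wpM2l// ltW.
Qed.

Lemma expR_sub1_le (h : R) : 0 <= h <= 1 / 2 -> expR h - 1 <= 2 * h.
Proof.
move=> /andP[h0 h1].
have e0 := expR_gt0 h.
have : expR h * (1 - h) <= 1.
  rewrite -[leRHS](expRxMexpNx_1 h).
  by apply: ler_wpM2l; [exact: ltW|exact: (expR_ge1Dx (- h))].
by nra.
Qed.

Variables (p : R -> R -> R) (C D : R).
Hypothesis hp : decaying_kernel p C D.

Lemma decaying_kernel_sqint x : sqint (p x).
Proof.
apply: (@sqint_bounded _ _ (C / (1 + `|x|)) (- x - D) (- x + D)).
- exact: (decay_meas hp).
- exact: (decay_le hp).
- move=> y hy; apply: (decay_supp hp); rewrite ltNge; apply: contra hy.
  by rewrite ler_norml => /andP[? ?]; apply/andP; split; lra.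
Qed.

Lemma decaying_kernel_sqr_le x :
  (\int[mu]_y (p x y ^+ 2)%:E <= (2 * D * C ^+ 2 / (1 + `|x|) ^+ 2)%:E)%E.
Proof.
have D0 := decay_D0 hp.
have x1 : 0 < 1 + `|x| by rewrite ltr_wpDr.
pose a := (C / (1 + `|x|)) ^+ 2.
apply: (@le_trans _ _ (\int[mu]_y (a%:E * (\1_(`[- x - D, - x + D]%classic) y)%:E))%E).
  apply: ge0_le_integral => //.
  - by move=> y _; rewrite lee_fin sqr_ge0.
  - by apply/measurable_EFinP/measurable_funX; exact: (decay_meas hp).
  - by apply: emeasurable_funM => //; apply/measurable_EFinP; exact: measurable_indic.
  move=> y _; rewrite -EFinM lee_fin indicE.
  have [hy|hy] := boolP (- x - D <= y <= - x + D).
    rewrite mem_set/= ?in_itv// mulr1 -[leLHS]real_normK ?num_real// /a.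
    by rewrite lerXn2r ?nnegrE//; [exact: le_trans (decay_le hp x y)|exact: (decay_le hp)].
  rewrite (decay_supp hp); first by rewrite expr0n/= mulr_ge0// sqr_ge0.
  rewrite ltNge; apply: contra hy.
  by rewrite ler_norml => /andP[? ?]; apply/andP; split; lra.
rewrite integral_scale_itv ?sqr_ge0//; last by lra.
rewrite lee_fin le_eqVlt; apply/orP; left; apply/eqP.
have -> : - x + D - (- x - D) = 2 * D by lra.
by rewrite /a exprMn exprVn; ring.
Qed.

Lemma decaying_kernel_approximable :
  approximable (fun u x => \int[mu]_y (p x y * u y)).
Proof.
have C0 := decay_C0 hp; have D0 := decay_D0 hp.
(* [2 C] serves the rows close to a grid point, [2 D C^2] the square norm of the far rows. *)
pose K := 2 * C + 2 * D * C ^+ 2.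
have DC0 : 0 <= 2 * D * C ^+ 2 by rewrite mulr_ge0 ?sqr_ge0// mulr_ge0.
have K0 : 0 <= K by rewrite /K; lra.
have l2 : 0 < ln (2 : R) by rewrite ln_gt0// ltr1n.
(* As [ln n >= ln 2], this factor absorbs the added 1 in [R0 <= n ln n + 1]. *)
pose c2 := 1 + (ln (2 : R))^-1.
have c20 : 0 <= c2 by rewrite addr_ge0// invr_ge0 ltW.
exists (2 * c2 + 8 * K * c2); first by rewrite addr_ge0// !mulr_ge0.
move=> N N2; have /andP[_ lN] := @lnN_ge R N N2.
set n : R := N%:R in lN *.
have n2 : 2 <= n by rewrite ler_nat.
have n0 : 0 < n by lra.
have lN0 : 0 < ln n by lra.
have one_le : 1 <= ln n / ln 2 by rewrite ler_pdivlMr// mul1r.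
(* [R0] exceeds [n ln n] by at most 1, so the end [Y = exp (R0 / n)] of the grid satisfies
   [n <= Y <= 2 n]. *)
pose R0 := (Num.truncn (n * ln n)).+1.
have R0gt : n * ln n < R0%:R by exact: truncnS_gt.
have R0le : R0%:R <= n * ln n + 1.
  rewrite /R0 -natr1 lerD2r truncn_le mulr_ge0// ltW//.
pose Y := expR (R0%:R / n).
have nY : n <= Y.
  by rewrite -[leLHS]lnK ?posrE// ler_expR ler_pdivlMr// mulrC ltW.
have Y2 : 2 <= Y by lra.
have ein : expR n^-1 - 1 <= 2 / n.
  apply: expR_sub1_le; rewrite invr_ge0 (ltW n0)/= div1r lef_pV2 ?posrE//.
have Yn : Y <= 2 * n.
  have : Y <= expR (ln n + n^-1).
    by rewrite ler_expR ler_pdivrMr// mulrDl mulVf ?gt_eqF// mulrC.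
  have : 2 / n <= 1 by rewrite ler_pdivrMr// mul1r.
  by rewrite expRD lnK ?posrE//; nra.
(* [1 + g i = exp (i / n)]; the parity of the index supplies the sign in [sg], so that [2 R0]
   samples cover both half lines. *)
pose g (i : nat) : R := expR (i%:R / n) - 1.
pose sg (i : nat) (x : R) := if odd i then - x else x.
pose l i := p (sg i (g i./2)).
pose E (x : R) := 4 * K / n * ((1 + `|x|)^-1 - (Y + `|x|)^-1).
have tail_ge0 (x : R) : 0 <= (1 + `|x|)^-1 - (Y + `|x|)^-1.
  by have := normr_ge0 x => x0; rewrite subr_ge0 lef_pV2 ?posrE; lra.
have mtail : measurable_fun setT (fun x : R => (1 + `|x|)^-1 - (Y + `|x|)^-1).
  by apply: measurable_funB; apply: continuous_measurable_fun;
    apply: continuous_inv_affine; lra.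
have K4 : 0 <= 4 * K / n by rewrite divr_ge0 ?mulr_ge0// ltW.
(* With [j] the integer part of [n ln (1 + |x|)], [g j] is the last grid point not exceeding [|x|].
   The ratio [exp (1 / n)] of consecutive values [1 + g] bounds the distance by [2 / n * (1 + |x|)],
   at most 4 because [Y <= 2 n]. *)
have near_grid x : 1 + `|x| < Y -> exists2 i, (i < R0.*2)%N &
    `|x - sg i (g i./2)| <= 2 / n * (1 + `|x|) /\ `|x - sg i (g i./2)| <= 6.
  move=> xY; have x0 := normr_ge0 x; have x1 : 0 < 1 + `|x| by lra.
  have lx0 : 0 <= ln (1 + `|x|) by rewrite -ln1 ler_ln ?posrE//; lra.
  pose j := Num.truncn (n * ln (1 + `|x|)).
  have /andP[j1 j2] : j%:R <= n * ln (1 + `|x|) < j.+1%:R.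
    by apply: truncn_itv; rewrite mulr_ge0// ltW.
  have g1 : g j <= `|x|.
    rewrite /g lerBlDl -[leRHS]lnK ?posrE// ler_expR ler_pdivrMr//.
    by rewrite mulrC.
  have g2 : `|x| - g j <= 2 / n * (1 + `|x|).
    have e1 : 1 + `|x| <= expR (j%:R / n) * expR n^-1.
      rewrite -expRD -[leLHS]lnK ?posrE// ler_expR.
      have -> : j%:R / n + n^-1 = j.+1%:R / n by rewrite -natr1 mulrDl mul1r.
      by rewrite ler_pdivlMr// mulrC ltW.
    have e2 : expR (j%:R / n) <= 1 + `|x| by move: g1; rewrite /g; lra.
    have e3 := expR_gt0 (j%:R / n).
    have e4 : 0 <= 2 / n by rewrite divr_ge0// ltW.
    have e5 : expR (j%:R / n) * (expR n^-1 - 1) <= 2 / n * (1 + `|x|).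
      rewrite mulrC; apply: ler_pM; [|exact: ltW|exact: ein|exact: e2].
      by rewrite subr_ge0 -[leLHS]expR0 ler_expR invr_ge0 ltW.
    by rewrite /g; lra.
  have g6 : `|x| - g j <= 6.
    apply: le_trans g2 _.
    have : 2 / n * (1 + `|x|) <= 2 / n * (2 * n).
      by rewrite ler_wpM2l ?divr_ge0// ?(ltW n0)//; lra.
    by rewrite mulrACA mulVf ?gt_eqF// mulr1; lra.
  have jR : (j < R0)%N.
    rewrite -(ltr_nat R); apply: le_lt_trans j1 _.
    by rewrite mulrC -ltr_pdivlMr// -ltr_expR lnK ?posrE.
  have E1 (i : nat) : i./2 = j -> odd i = (x < 0) -> `|x - sg i (g i./2)| = `|x| - g j.
    move=> ij oi; rewrite /sg oi ij; have [x00|x00] := ltP x 0.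
      by move: g1; rewrite opprK (ltr0_norm x00) => g1; rewrite ler0_norm; lra.
    by move: g1; rewrite (ger0_norm x00) => g1; rewrite ger0_norm; lra.
  exists (j.*2 + (x < 0)%R)%N.
    by case: (x < 0)%R; [rewrite addn1 -doubleS leq_double|rewrite addn0 ltn_double].
  have o1 : (j.*2 + (x < 0)%R)./2 = j.
    by case: (x < 0)%R; rewrite ?addn1 ?addn0 ?doubleK// -[RHS]uphalf_double.
  have o2 : odd (j.*2 + (x < 0)%R) = (x < 0)%R by rewrite oddD odd_double/=; case: (x < 0)%R.
  by rewrite (E1 _ o1 o2).
exists R0.*2, l, E; split.
- rewrite -muln2 natrM.
  have h1 : R0%:R <= n * ln n * c2.
    apply: le_trans R0le _; rewrite /c2 mulrDr mulr1 lerD2l.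
    by apply: le_trans one_le _; rewrite ler_wpM2r ?invr_ge0 ?(ltW l2)//; nra.
  have h2 : 0 <= 8 * K * c2 * (n * ln n) by rewrite !mulr_ge0// ltW.
  by lra.
- by move=> i; exact: decaying_kernel_sqint.
- split; first by apply: measurable_funM.
  by move=> x; exact: mulr_ge0.
- under eq_integral do rewrite EFinM.
  rewrite ge0_integralZl_EFin//; last 2 first.
  + by move=> x _; rewrite lee_fin.
  + exact/measurable_EFinP.
  rewrite integral_log_tail; last by lra.
  rewrite /Y expRK -EFinM lee_fin.
  have h1 : R0%:R / n <= ln n * c2.
    rewrite ler_pdivrMr//; apply: le_trans R0le _; rewrite /c2.
    have : ln n <= ln n * n by rewrite ler_peMr ?(ltW lN0)//; lra.
    have h3 : ln n / ln 2 <= ln n / ln 2 * n by rewrite ler_peMr//; lra.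
    by lra.
  have h2 : 4 * K / n * (2 * (R0%:R / n)) <= 4 * K / n * (2 * (ln n * c2)).
    by rewrite ler_wpM2l// ler_wpM2l.
  apply: le_trans h2 _.
  have h3 : 0 <= 2 * c2 * (ln n / n) by rewrite !mulr_ge0// ?invr_ge0// ltW.
  by lra.
move=> x.
have x1 : 0 < 1 + `|x| by rewrite ltr_wpDr.
have x1' : 1 <= 1 + `|x| by rewrite lerDl.
have YE : Y + `|x| = Y - 1 + (1 + `|x|) by lra.
have [xY|xY] := ltP (1 + `|x|) Y.
  have [i iR [hx hx6]] := near_grid x xY.
  have [mk k2] := decaying_kernel_sqint (sg i (g i./2)).
  have sk : sqint (fun y => p x y - p (sg i (g i./2)) y).
    have := sqintD (decaying_kernel_sqint x) (sqintZ (-1) (decaying_kernel_sqint (sg i (g i./2)))).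
    by under eq_fun do rewrite mulN1r.
  exists (fun y => p x y - p (sg i (g i./2)) y); split => //.
  - apply: le_trans (decay_diff hp hx6) _; rewrite lee_fin.
    apply: (@le_trans _ _ (C * (2 / n * (1 + `|x|)) / (1 + `|x|) ^+ 2)).
      by rewrite ler_wpM2r ?invr_ge0 ?sqr_ge0// ler_wpM2l.
    have -> : C * (2 / n * (1 + `|x|)) / (1 + `|x|) ^+ 2 = 4 * (2 * C) / n * (4 * (1 + `|x|))^-1.
      by field; rewrite ?gt_eqF.
    rewrite /E; apply: ler_pM.
    + by rewrite divr_ge0 ?(ltW n0)// mulr_ge0// mulr_ge0.
    + by rewrite invr_ge0 mulr_ge0// ltW.
    + by rewrite ler_wpM2r ?invr_ge0 ?(ltW n0)// /K; lra.
    + by rewrite YE; exact: log_tail_ge_near.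
  - move=> u hu hl.
    have h0 := hl i iR.
    under [RHS]eq_Rintegral do rewrite mulrBl.
    rewrite RintegralB//; [by rewrite h0 subr0| |]; apply: sqint_mul => //;
      exact: decaying_kernel_sqint.
(* Beyond the grid the whole row counts as remainder, and [Y >= n] supplies the factor [1 / n]. *)
exists (p x); split => //; first exact: decaying_kernel_sqint.
apply: le_trans (decaying_kernel_sqr_le x) _; rewrite lee_fin.
apply: (@le_trans _ _ (4 * (2 * D * C ^+ 2) / n * (Y / (4 * (1 + `|x|) ^+ 2)))).
  have -> : 4 * (2 * D * C ^+ 2) / n * (Y / (4 * (1 + `|x|) ^+ 2)) =
    (Y / n) * (2 * D * C ^+ 2 / (1 + `|x|) ^+ 2) by field; rewrite ?gt_eqF.
  rewrite ler_peMl ?divr_ge0 ?sqr_ge0//.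
  by rewrite ler_pdivlMr// mul1r.
rewrite /E; apply: ler_pM.
- by rewrite divr_ge0 ?(ltW n0)// mulr_ge0.
- by rewrite divr_ge0 ?mulr_ge0 ?sqr_ge0//; lra.
- by rewrite ler_wpM2r ?invr_ge0 ?(ltW n0)// /K; lra.
- by rewrite YE; exact: log_tail_ge_far.
Qed.

End DecayingKernelApproximable.

(** * Polygons as combinations of half strips *)

Section Geometry.
Variable R : realType.

Definition affine_form (a : R * R * R) (z : R * R) : R :=
  a.1.1 * z.1 + a.1.2 * z.2 + a.2.

(** The two comparisons distinguish negative, zero and positive values, so the classes are all faces
    of the line arrangement, those of lower dimension included. *)
Definition same_signs (I : Type) (a : I -> R * R * R) (z z' : R * R) : Prop :=
  forall i, (affine_form (a i) z < 0) = (affine_form (a i) z' < 0) /\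
            (0 < affine_form (a i) z) = (0 < affine_form (a i) z').

Lemma same_signs_segment I (a : I -> R * R * R) z z' w :
  same_signs a z z' -> segment2 z z' w -> same_signs a z w.
Proof.
move=> h [t /andP[t0 t1] ->] i; have [h1 h2] := h i.
rewrite {2 4}/affine_form /=.
have -> : (a i).1.1 * ((1 - t) * z.1 + t * z'.1) + (a i).1.2 * ((1 - t) * z.2 + t * z'.2) + (a i).2
  = (1 - t) * affine_form (a i) z + t * affine_form (a i) z'.
  by rewrite /affine_form; ring.
move: h1 h2; set u := affine_form _ z; set u' := affine_form _ z'.
have u1 : 0 <= 1 - t by rewrite subr_ge0.
have [t00|t0'] := eqVneq t 0; first by rewrite t00 subr0 mul1r mul0r addr0.
have tp : 0 < t by rewrite lt_neqAle eq_sym t0'.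
case: (ltgtP u 0) => hu; case: (ltgtP u' 0) => hu' //= _ _.
- have : (1 - t) * u + t * u' < 0 by nra.
  by move=> h3; rewrite h3 ltNge ltW.
- have : 0 < (1 - t) * u + t * u' by nra.
  by move=> h3; rewrite h3 ltNge ltW.
- by rewrite hu hu' !mulr0 addr0 ltxx.
Qed.

(** Membership in an edge becomes a condition on signs of affine functions, which [polygon_form]
    lists. Betweenness is asked of both coordinates because an edge may be vertical or
    horizontal. *)
Lemma segment2P (a b z : R * R) : segment2 a b z <->
  [/\ (b.1 - a.1) * (z.2 - a.2) - (b.2 - a.2) * (z.1 - a.1) = 0,
      (a.1 <= z.1 <= b.1) || (b.1 <= z.1 <= a.1) &
      (a.2 <= z.2 <= b.2) || (b.2 <= z.2 <= a.2)].
Proof.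
case: a b z => [a1 a2] [b1 b2] [z1 z2] /=; split.
  move=> [t /andP[t0 t1] [-> ->]]; split; first by ring.
  - have [h|h] := leP a1 b1; apply/orP; [left|right]; apply/andP; split; nra.
  - have [h|h] := leP a2 b2; apply/orP; [left|right]; apply/andP; split; nra.
move=> [cr h1 h2].
have [e1|e1] := eqVneq a1 b1.
  have z1E : z1 = a1 by case/orP: h1 => /andP[? ?]; lra.
  have [e2|e2] := eqVneq a2 b2.
    exists 0; first by rewrite lexx ler01.
    rewrite subr0 !mul1r !mul0r !addr0 z1E; congr pair => /=.
    by case/orP: h2 => /andP[? ?] /=; lra.
  have d0 : b2 - a2 != 0 by rewrite subr_eq0 eq_sym.
  exists ((z2 - a2) / (b2 - a2)).
    case: (ltgtP a2 b2) e2 => // hab _.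
      have p : 0 < b2 - a2 by lra.
      apply/andP; split; [apply: divr_ge0|rewrite ler_pdivrMr//]; case/orP: h2 => /andP[? ?]; lra.
    have p : 0 < a2 - b2 by lra.
    rewrite -(opprB a2 b2) -(opprB a2 z2) invrN mulrNN.
    apply/andP; split; [apply: divr_ge0|rewrite ler_pdivrMr//]; case/orP: h2 => /andP[? ?]; lra.
  rewrite /= -e1 z1E; congr pair; first by ring.
  by field.
have d0 : b1 - a1 != 0 by rewrite subr_eq0 eq_sym.
have z2E : z2 = a2 + (b2 - a2) * (z1 - a1) / (b1 - a1).
  suff : z2 - a2 = (b2 - a2) * (z1 - a1) / (b1 - a1) by lra.
  by apply: (mulIf d0); rewrite divfK//; lra.
exists ((z1 - a1) / (b1 - a1)).
  case: (ltgtP a1 b1) e1 => // hab _.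
    have p : 0 < b1 - a1 by lra.
    apply/andP; split; [apply: divr_ge0|rewrite ler_pdivrMr//]; case/orP: h1 => /andP[? ?]; lra.
  have p : 0 < a1 - b1 by lra.
  rewrite -(opprB a1 b1) -(opprB a1 z1) invrN mulrNN.
  apply/andP; split; [apply: divr_ge0|rewrite ler_pdivrMr//]; case/orP: h1 => /andP[? ?]; lra.
rewrite /= z2E; congr pair; by field.
Qed.

Lemma segment2_connected (z z' : R * R) : connected (segment2 z z').
Proof.
pose f (t : R) : R * R := ((1 - t) * z.1 + t * z'.1, (1 - t) * z.2 + t * z'.2).
have -> : segment2 z z' = f @` `[0, 1].
  apply/seteqP; split => [w [t ht ->]|w [t ht <-]].
    by exists t => //=; rewrite in_itv.
  by exists t => //; move: ht; rewrite /= in_itv.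
apply: connected_continuous_connected; first exact: segment_connected.
apply: continuous_subspaceT => t.
have h (u u' : R) : (1 - s) * u + s * u' @[s --> t] --> (1 - t) * u + t * u'.
  by apply: cvgD; apply: cvgM; [apply: cvgB; [exact: cvg_cst|exact: cvg_id]|exact: cvg_cst|exact: cvg_id|exact: cvg_cst].
exact: (cvg_pair (h _ _) (h _ _)).
Qed.

Lemma segment2_start (z z' : R * R) : segment2 z z' z.
Proof. by exists 0; [rewrite lexx ler01|case: z => ? ?; rewrite subr0 !mul1r !mul0r !addr0]. Qed.

Lemma segment2_end (z z' : R * R) : segment2 z z' z'.
Proof. by exists 1; [rewrite lexx ler01|case: z' => ? ?; rewrite subrr !mul1r !mul0r !add0r]. Qed.

Section PolygonForms.
Variables (n : nat) (v : 'I_n -> R * R).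

(* The functionals z.1 - v_i.1, z.2 - v_i.2 and (v_(i+1) - v_i) x (z - v_i). *)
Definition polygon_form (k : 'I_n * 'I_3) : R * R * R :=
  let: (i, j) := k in
  let a := v i in let b := v (ordS i) in
  match val j with
  | 0 => (1, 0, - a.1)
  | 1 => (0, 1, - a.2)
  | _ => (- (b.2 - a.2), b.1 - a.1, (b.2 - a.2) * a.1 - (b.1 - a.1) * a.2)
  end.

Lemma same_signs_polygonal_line z z' : same_signs polygon_form z z' ->
  polygonal_line v z -> polygonal_line v z'.
Proof.
move=> h [i _ /segment2P[h1 h2 h3]]; exists i => //; apply/segment2P.
have f0 j : affine_form (polygon_form (j, ord0)) =1 (fun z => z.1 - (v j).1).
  by move=> w; rewrite /affine_form /=; ring.
have f1 j : affine_form (polygon_form (j, lift ord0 ord0)) =1 (fun z => z.2 - (v j).2).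
  by move=> w; rewrite /affine_form /=; ring.
have f2 j : affine_form (polygon_form (j, ord_max)) =1
   (fun z => ((v (ordS j)).1 - (v j).1) * (z.2 - (v j).2) - ((v (ordS j)).2 - (v j).2) * (z.1 - (v j).1)).
  by move=> w; rewrite /affine_form /=; ring.
have := h (i, ord_max); rewrite !f2 h1 ltxx => -[g1 g2].
split; first by apply/eqP; rewrite eq_le !leNgt -g1 -g2.
- have := h (i, ord0); rewrite !f0 !subr_lt0 !subr_gt0 => -[e1 e2].
  have := h (ordS i, ord0); rewrite !f0 !subr_lt0 !subr_gt0 => -[e3 e4].
  by move: h2; rewrite !leNgt e1 e2 e3 e4.
- have := h (i, lift ord0 ord0); rewrite !f1 !subr_lt0 !subr_gt0 => -[e1 e2].
  have := h (ordS i, lift ord0 ord0); rewrite !f1 !subr_lt0 !subr_gt0 => -[e3 e4].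
  by move: h3; rewrite !leNgt e1 e2 e3 e4.
Qed.

Lemma same_signs_sym I (a : I -> R * R * R) z z' : same_signs a z z' -> same_signs a z' z.
Proof. by move=> h i; have [-> ->] := h i. Qed.

(** The segment from [z] to [z'] stays in one sign class, hence off the polygonal line, and it is
    connected. *)
Lemma same_signs_component p z z' : same_signs polygon_form z z' ->
  connected_component (~` polygonal_line v) p z ->
  connected_component (~` polygonal_line v) p z'.
Proof.
move=> h hz; have hzl := connected_component_sub hz.
apply: connected_component_trans hz _.
apply: (connected_component_max (segment2_start z z')) (segment2_end z z').
- move=> w hw wl; apply: hzl; apply: same_signs_polygonal_line wl.
  by apply: same_signs_sym; exact: same_signs_segment hw.
- exact: segment2_connected.
Qed.

End PolygonForms.

Lemma polygon_same_signs (Omega : set (R * R)) : polygon Omega ->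
  exists (I : finType) (a : I -> R * R * R), forall z z', same_signs a z z' ->
    Omega z -> Omega z'.
Proof.
move=> [n [v [_ [p _ ->] _]]].
exists ('I_n * 'I_3)%type, (polygon_form v) => z z'; exact: same_signs_component.
Qed.

End Geometry.

(** * Indicators of sign classes as combinations of half strips *)

Section HalfStrips.
Variable R : realType.

(** The flags for closedness are there because the decomposition holds at every point, edges
    included, and the complement of an open half plane is closed. *)
Record half_strip := HalfStrip {
  strip_closed : bool; strip_end : R;
  line_closed : bool; line_slope : R; line_offset : R }.

Definition half_strip_fun (q : half_strip) (z : R * R) : R :=
  (z.1 < strip_end q ?<= if strip_closed q)%:R *
  (z.2 < line_slope q * z.1 + line_offset q ?<= if line_closed q)%:R.

Variable B : R.

(** Half strips are unbounded only to the left and downwards. Restricting the identity to [z.1 < B]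
    and [z.2 < B] makes the constant 1 one of them and so gives access to complements. *)
Definition half_strip_span (f : R * R -> R) : Prop :=
  exists s : seq (R * half_strip), forall z, z.1 < B -> z.2 < B ->
    f z = \sum_(q <- s) q.1 * half_strip_fun q.2 z.

Lemma span_ext f g : half_strip_span f ->
  (forall z, z.1 < B -> z.2 < B -> g z = f z) -> half_strip_span g.
Proof. by move=> [s hs] e; exists s => z h1 h2; rewrite e// hs. Qed.

Lemma span_half_strip q : half_strip_span (half_strip_fun q).
Proof. by exists [:: (1, q)] => z _ _; rewrite big_seq1 mul1r. Qed.

Lemma span0 : half_strip_span (fun=> 0).
Proof. by exists [::] => z _ _; rewrite big_nil. Qed.

Lemma spanD f g : half_strip_span f -> half_strip_span g ->
  half_strip_span (fun z => f z + g z).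
Proof. by move=> [s hs] [t ht]; exists (s ++ t) => z h1 h2; rewrite big_cat hs// ht. Qed.

Lemma spanZ a f : half_strip_span f -> half_strip_span (fun z => a * f z).
Proof.
move=> [s hs]; exists [seq (a * q.1, q.2) | q <- s] => z h1 h2.
by rewrite big_map hs// mulr_sumr; apply: eq_bigr => q _; rewrite mulrA.
Qed.

Lemma spanB f g : half_strip_span f -> half_strip_span g ->
  half_strip_span (fun z => f z - g z).
Proof.
move=> hf hg; apply: span_ext (spanD hf (spanZ (-1) hg)) _ => z _ _.
by rewrite mulN1r.
Qed.

Lemma span_sum (I : Type) (s : seq I) (F : I -> R * R -> R) :
  (forall i, half_strip_span (F i)) -> half_strip_span (fun z => \sum_(i <- s) F i z).
Proof.
move=> hF; elim: s => [|i s IH].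
  by apply: span_ext span0 _ => z _ _; rewrite big_nil.
by apply: span_ext (spanD (hF i) IH) _ => z _ _; rewrite big_cons.
Qed.

Lemma span1 : half_strip_span (fun=> 1).
Proof.
apply: span_ext (span_half_strip (HalfStrip false B false 0 B)) _ => z h1 h2.
by rewrite /half_strip_fun /= h1 mul0r add0r h2 mulr1.
Qed.

Lemma span_mull (m : R * R -> R) f :
  (forall q, half_strip_span (fun z => m z * half_strip_fun q z)) ->
  half_strip_span f -> half_strip_span (fun z => m z * f z).
Proof.
move=> hm [s hs].
apply: span_ext (span_sum s (fun q => spanZ q.1 (hm q.2))) _ => z h1 h2.
by rewrite hs// mulr_sumr; apply: eq_bigr => q _; rewrite mulrCA.
Qed.

Lemma lteif_min (u c c' : R) (e e' : bool) :
  ((u < c ?<= if e) && (u < c' ?<= if e')) =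
  (if c < c' then u < c ?<= if e else if c' < c then u < c' ?<= if e'
   else u < c ?<= if e && e').
Proof.
case: (ltgtP c c') => [h|h|<-]; case: e; case: e' => //=; rewrite ?andbb //;
  apply/andP/idP => [[]|] *; (try split); try lra.
Qed.

Lemma span_strip (e : bool) (c : R) f : half_strip_span f ->
  half_strip_span (fun z => (z.1 < c ?<= if e)%:R * f z).
Proof.
apply: span_mull => -[e1 c1 e2 b d].
pose q := if c < c1 then HalfStrip e c e2 b d else
  if c1 < c then HalfStrip e1 c1 e2 b d else HalfStrip (e && e1) c e2 b d.
apply: span_ext (span_half_strip q) _ => z _ _.
rewrite /half_strip_fun /= mulrA -natrM mulnb lteif_min /q.
by case: (ltgtP c c1).
Qed.

Lemma span_affine1_lt0 (b d : R) f : half_strip_span f ->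
  half_strip_span (fun z => (b * z.1 + d < 0)%R%:R * f z).
Proof.
move=> hf; have [b0|b0|b0] := ltgtP b 0.
- apply: span_ext (spanB hf (span_strip true (- d / b) hf)) _ => z _ _.
  have -> : (b * z.1 + d < 0) = ~~ (z.1 <= - d / b).
    by rewrite -ltNge ltr_ndivrMr//; apply/idP/idP; lra.
  rewrite /=; by case: (_ <= _); rewrite ?mul1r ?mul0r ?subrr ?subr0.
- apply: span_ext (span_strip false (- d / b) hf) _ => z _ _.
  rewrite /= ltr_pdivlMr//; congr (_%:R * _); congr nat_of_bool.
  by apply/idP/idP; lra.
- apply: span_ext (spanZ (d < 0)%R%:R hf) _ => z _ _.
  by rewrite b0 mul0r add0r.
Qed.

(** A product of two regions below lines is split according to which line is lower, an affine
    condition on [z.1]: there the lower line alone remains. The difference involving [h3] isolates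
    the points where both lines have equal height and the flags combine to [e && e2]. *)
Lemma span_line (e : bool) (b d : R) f : half_strip_span f ->
  half_strip_span (fun z => (z.2 < b * z.1 + d ?<= if e)%:R * f z).
Proof.
apply: span_mull => -[e1 c1 e2 b2 d2].
have h1 := span_affine1_lt0 (b - b2) (d - d2) (span_half_strip (HalfStrip e1 c1 e b d)).
have h2 := span_affine1_lt0 (b2 - b) (d2 - d) (span_half_strip (HalfStrip e1 c1 e2 b2 d2)).
have h3 := span_half_strip (HalfStrip e1 c1 (e && e2) b d).
have h3a := span_affine1_lt0 (b - b2) (d - d2) h3.
have h3b := span_affine1_lt0 (b2 - b) (d2 - d) h3.
apply: span_ext (spanD (spanD h1 h2) (spanB h3 (spanD h3a h3b))) _ => z _ _.
have l1 : ((b - b2) * z.1 + (d - d2) < 0) = (b * z.1 + d < b2 * z.1 + d2).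
  by apply/idP/idP; lra.
have l2 : ((b2 - b) * z.1 + (d2 - d) < 0) = (b2 * z.1 + d2 < b * z.1 + d).
  by apply/idP/idP; lra.
rewrite l1 l2 /half_strip_fun /= [LHS]mulrCA -[X in _ * X = _]natrM mulnb lteif_min.
by case: (ltgtP (b * z.1 + d) (b2 * z.1 + d2)) => _; rewrite /=; ring.
Qed.

(** The coefficient [a2] decides: positive gives the region below a line, negative the complement of
    a closed one, zero a condition on [z.1] alone. *)
Lemma span_affine_lt0 (a : R * R * R) f : half_strip_span f ->
  half_strip_span (fun z => (affine_form a z < 0)%R%:R * f z).
Proof.
case: a => [[a1 a2] a3] hf; rewrite /affine_form /=.
have [h|h|h] := ltgtP a2 0.
- apply: span_ext (spanB hf (span_line true (- a1 / a2) (- a3 / a2) hf)) _ => z _ _.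
  have -> : (a1 * z.1 + a2 * z.2 + a3 < 0) = ~~ (z.2 <= - a1 / a2 * z.1 + - a3 / a2).
    rewrite -ltNge mulrAC -mulrDl ltr_ndivrMr//; apply/idP/idP; lra.
  rewrite /=; by case: (_ <= _); rewrite ?mul1r ?mul0r ?subrr ?subr0.
- apply: span_ext (span_line false (- a1 / a2) (- a3 / a2) hf) _ => z _ _.
  rewrite /= mulrAC -mulrDl ltr_pdivlMr//; congr (_%:R * _); congr nat_of_bool.
  by apply/idP/idP; lra.
- apply: span_ext (span_affine1_lt0 a1 a3 hf) _ => z _ _.
  by rewrite h mul0r addr0.
Qed.

Lemma span_affine_gt0 (a : R * R * R) f : half_strip_span f ->
  half_strip_span (fun z => (0 < affine_form a z)%R%:R * f z).
Proof.
move=> hf; apply: span_ext (span_affine_lt0 (- a.1.1, - a.1.2, - a.2) hf) _ => z _ _.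
congr (_%:R * _); congr nat_of_bool; rewrite /affine_form /=.
by apply/idP/idP; lra.
Qed.

Variables (I : finType) (a : I -> R * R * R).

Definition sign_pattern (z : R * R) : {ffun I -> bool * bool} :=
  [ffun i => (affine_form (a i) z < 0, 0 < affine_form (a i) z)].

Lemma sign_patternP z z' : sign_pattern z = sign_pattern z' -> same_signs a z z'.
Proof. by move=> /ffunP h i; have := h i; rewrite !ffunE => -[-> ->]. Qed.

Lemma span_sign_eq (i : I) (P : bool * bool) f : half_strip_span f ->
  half_strip_span (fun z => ((affine_form (a i) z < 0, 0 < affine_form (a i) z)%R == P)%:R * f z).
Proof.
move=> hf; case: P => p1 p2.
have h1 g : half_strip_span g ->
    half_strip_span (fun z => ((affine_form (a i) z < 0)%R == p1)%:R * g z).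
  move=> hg; case: p1.
    by apply: span_ext (span_affine_lt0 (a i) hg) _ => z _ _; rewrite eqb_id.
  apply: span_ext (spanB hg (span_affine_lt0 (a i) hg)) _ => z _ _.
  by case: (_ < _); rewrite ?mul1r ?mul0r ?subrr ?subr0.
have h2 g : half_strip_span g ->
    half_strip_span (fun z => ((0 < affine_form (a i) z)%R == p2)%:R * g z).
  move=> hg; case: p2.
    by apply: span_ext (span_affine_gt0 (a i) hg) _ => z _ _; rewrite eqb_id.
  apply: span_ext (spanB hg (span_affine_gt0 (a i) hg)) _ => z _ _.
  by case: (_ < _); rewrite ?mul1r ?mul0r ?subrr ?subr0.
apply: span_ext (h1 _ (h2 _ hf)) _ => z _ _.
by rewrite mulrA -natrM mulnb xpair_eqE.
Qed.

Lemma span_sign_pattern (P : {ffun I -> bool * bool}) :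
  half_strip_span (fun z => (sign_pattern z == P)%:R).
Proof.
have h (s : seq I) : half_strip_span
    (fun z => (all (fun i => sign_pattern z i == P i) s)%:R).
  elim: s => [|i s IH]; first exact: span1.
  apply: span_ext (span_sign_eq i (P i) IH) _ => z _ _.
  by rewrite /= -mulnb natrM ffunE.
apply: span_ext (h (enum I)) _ => z _ _; congr (_%:R); congr nat_of_bool.
apply/eqP/allP => [-> //|e]; apply/ffunP => i; apply/eqP/e.
by rewrite mem_enum.
Qed.

Lemma span_same_signs (f : R * R -> R) :
  (forall z z', same_signs a z z' -> f z = f z') -> half_strip_span f.
Proof.
move=> hf.
(* The value of [f] at some point with pattern [P]. For a pattern that never occurs the default
   [(0, 0)] is harmless, the indicator being zero. *)
pose c (P : {ffun I -> bool * bool}) := f (xget (0, 0) [set z | sign_pattern z = P]).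
apply: span_ext (span_sum (enum {ffun I -> bool * bool})
  (fun P => spanZ (c P) (span_sign_pattern P))) _ => z _ _.
rewrite big_enum (bigD1 (sign_pattern z)) //= eqxx mulr1 big1 ?addr0; last first.
  by move=> P hP; rewrite eq_sym (negbTE hP) mulr0.
rewrite /c; case: xgetP => [z' _ /sign_patternP|/(_ z)]; last by move=> /(_ erefl).
by move=> h; apply/esym/hf.
Qed.

End HalfStrips.

Lemma polygon_half_strips (R : realType) (Omega : set (R * R)) (B : R) :
  polygon Omega -> half_strip_span B (\1_Omega).
Proof.
move=> /polygon_same_signs[I [a ha]].
apply: (@span_same_signs R B I a) => z z' h.
have e : Omega z = Omega z'.
  by apply/propext; split; apply: ha => //; exact: same_signs_sym.
rewrite !indicE; have [hz|hz] := pselect (Omega z).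
  by rewrite !mem_set// -e.
by rewrite !memNset// -e.
Qed.

(** * Kernels with a phase *)

Section PhaseIntegral.
Variable R : realType.
Local Notation mu := (@lebesgue_measure R).

(** A factor in [y] does not touch the dependence on [x]. An oscillating factor in [x] would in
    general spoil [decay_diff] and is left to [approximable_scale]. *)
Lemma decaying_kernel_mulr (p : R -> R -> R) C D (w : R -> R) :
  decaying_kernel p C D -> measurable_fun setT w -> (forall y, `|w y| <= 1) ->
  decaying_kernel (fun x y => p x y * w y) C D.
Proof.
move=> [C0 D0 mp ple ps pd] mw w1; split => //.
- by move=> x; exact: measurable_funM.
- move=> x y; rewrite normrM -[leRHS]mulr1.
  by apply: ler_pM => //; exact: ple.
- by move=> x y h; rewrite ps// mul0r.
- move=> x x' h; apply: le_trans (pd x x' h); apply: ge0_le_integral => //.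
  + by move=> y _; rewrite lee_fin sqr_ge0.
  + apply/measurable_EFinP/measurable_funX; apply: measurable_funB.
      by apply: measurable_funM => //; exact: mp.
    by apply: measurable_funM => //; exact: mp.
  + by apply/measurable_EFinP/measurable_funX; apply: measurable_funB; exact: mp.
  + move=> y _; rewrite lee_fin -mulrBl exprMn -[leRHS]mulr1 ler_wpM2l ?sqr_ge0//.
    by rewrite -[w y ^+ 2]real_normK ?num_real// expr_le1.
Qed.

Lemma integrable_tensor (h1 h2 : R -> R) : mu.-integrable setT (EFin \o h1) ->
  mu.-integrable setT (EFin \o h2) ->
  (mu \x mu)%E.-integrable setT (EFin \o (fun z => h1 z.1 * h2 z.2)).
Proof.
move=> i1 i2.
have m1 : measurable_fun setT h1 by apply/measurable_EFinP; exact: measurable_int i1.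
have m2 : measurable_fun setT h2 by apply/measurable_EFinP; exact: measurable_int i2.
apply/integrable12ltyP.
  by apply/measurable_EFinP; apply: measurable_funM; exact: measurableT_comp.
apply: (@le_lt_trans _ _ (\int[mu]_x (`|(h1 x)%:E| * \int[mu]_y `|(h2 y)%:E|))%E).
  rewrite le_eqVlt; apply/orP; left; apply/eqP; apply: eq_integral => x _ /=.
  rewrite -ge0_integralZl//.
  - by apply: eq_integral => y _; rewrite /= normrM EFinM.
  - by apply/measurable_EFinP; exact: measurableT_comp.
have /integrableP[_ l1] := i1; have /integrableP[_ l2] := i2.
rewrite ge0_integralZr//.
- by rewrite lte_mul_pinfty// ?ge0_fin_numE//; apply: integral_ge0.
- by apply: measurableT_comp => //; exact/measurable_EFinP.
- exact: integral_ge0.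
Qed.

(** For [tau = 0] and [tau = - pi / 2], the real and imaginary parts of [2 pi] times the kernel of
    the operator with symbol [f]. *)
Definition phase_kernel (f : R * R -> R) (tau x y : R) : R :=
  \int[mu]_k (cos ((x - y) * k + tau) * f ((x + y) / 2, k)).

Definition phase_integral (f : R * R -> R) (tau : R) (u : R -> R) (x : R) : R :=
  \int[(mu \x mu)%E]_z
    (cos ((x - z.1) * z.2 + tau) * f ((x + z.1) / 2, z.2) * u z.1).

Record box_symbol (f : R * R -> R) (B M : R) : Prop := BoxSymbol {
  box_meas : measurable_fun [set: measurableTypeR R * measurableTypeR R] f;
  box_le : forall z, `|f z| <= M;
  box_supp : supported_in_box B f }.

Section BoxSymbol.
Variables (f : R * R -> R) (B M tau : R).
Hypothesis hf : box_symbol f B M.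

Let M0 : 0 <= M.
Proof. exact: le_trans (box_le hf (0, 0)). Qed.

Let mcos : measurable_fun setT (@cos R).
Proof. by apply: continuous_measurable_fun; exact: continuous_cos. Qed.

Let F (w : (R * R) * R) : R :=
  cos ((w.1.1 - w.1.2) * w.2 + tau) * f ((w.1.1 + w.1.2) / 2, w.2).

Let mF : measurable_fun setT F.
Proof.
have p1 : measurable_fun setT (fun w : (R * R) * R => w.1.1) by exact: measurableT_comp.
have p2 : measurable_fun setT (fun w : (R * R) * R => w.1.2) by exact: measurableT_comp.
apply: measurable_funM.
  apply: (measurableT_comp mcos); apply: measurable_funD => //.
  by apply: measurable_funM => //; exact: measurable_funB.
apply: (measurableT_comp (box_meas hf)); apply: measurable_fun_pair => //.
by apply: measurable_funM => //; exact: measurable_funD.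
Qed.

Let F_le w : `|F w| <= M.
Proof.
rewrite /F normrM -[leRHS]mul1r ler_pM//; last exact: box_le hf _.
by rewrite ler_norml cos_geN1 cos_le1.
Qed.

Let F_out w : ~~ (`|w.2| <= B) -> F w = 0.
Proof. by move=> h; rewrite /F (box_supp hf) ?mulr0//= orbC ltNge h. Qed.

Let F_out1 w : 2 * B < `|w.1.1 + w.1.2| -> F w = 0.
Proof.
move=> h; rewrite /F (box_supp hf) ?mulr0//=.
by rewrite normrM normfV (ger0_norm (ler0n _ 2)) ltr_pdivlMr// mulrC h.
Qed.

Let I (k : R) : R := M * \1_(`[- B, B]%classic) k.

Let F_I w : `|F w| <= I w.2.
Proof.
rewrite /I indicE; have [kB|kB] := boolP (`|w.2| <= B).
  by rewrite mem_set/= ?mulr1// in_itv/= -ler_norml.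
by rewrite F_out// normr0 mulr_ge0.
Qed.

Let iI : mu.-integrable setT (EFin \o I).
Proof. exact: (integrableZl measurableT M (integrable_box (- B) B)). Qed.

Lemma measurable_phase_kernel :
  measurable_fun setT (fun z : R * R => phase_kernel f tau z.1 z.2).
Proof. exact: (measurable_parameter_integral mF F_le F_out). Qed.

Let iF x y : mu.-integrable setT (EFin \o (fun k => F ((x, y), k))).
Proof.
apply: (integrable_le _ iI) => [|k]; last exact: F_I.
exact: measurableT_comp mF _.
Qed.

Lemma phase_kernel_integrable x y : mu.-integrable setT
  (EFin \o (fun k => cos ((x - y) * k + tau) * f ((x + y) / 2, k))).
Proof. exact: iF. Qed.

Lemma phase_kernel_le x y : `|phase_kernel f tau x y| <= \int[mu]_k I k.
Proof.
apply: le_trans (le_normr_Rintegral _ (iF x y)) _ => //.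
by apply: (le_Rintegral _ (integrable_norm (iF x y)) iI) => // k _; exact: F_I.
Qed.

Lemma phase_kernel_out x y : 2 * B < `|x + y| -> phase_kernel f tau x y = 0.
Proof.
move=> h; rewrite /phase_kernel -[RHS](mul0r (fine (mu setT))) -Rintegral_cst//.
by apply: eq_Rintegral => k _; exact: (@F_out1 ((x, y), k)).
Qed.

Lemma phase_kernel_sqint x : sqint (phase_kernel f tau x).
Proof.
apply: (@sqint_bounded _ _ (\int[mu]_k I k) (- x - 2 * B) (- x + 2 * B)).
- exact: (measurableT_comp measurable_phase_kernel (measurable_pair1 x)).
- by move=> y; exact: phase_kernel_le.
- move=> y hy; apply: phase_kernel_out; rewrite ltNge; apply: contra hy.
  by rewrite ler_norml => /andP[? ?]; apply/andP; split; lra.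
Qed.

(** The support of [f] confines [z.1] to a bounded interval around [- x], where the
    square-integrable [u] is integrable; a tensor product then dominates the integrand. This is what
    Fubini's theorem requires in [phase_integralE]. *)
Lemma phase_integrand_integrable u x : sqint u ->
  (mu \x mu)%E.-integrable setT (EFin \o (fun z : R * R =>
    cos ((x - z.1) * z.2 + tau) * f ((x + z.1) / 2, z.2) * u z.1)).
Proof.
move=> hu.
pose a := - x - 2 * B; pose b := - x + 2 * B.
pose h1 (y : R) : R := \1_(`[a, b]%classic) y * u y.
have s1 : sqint (\1_(`[a, b]%classic) : R -> R).
  apply: (@sqint_bounded _ _ 1 a b).
  - exact: measurable_indic.
  - by move=> y; rewrite indicE; case: (_ \in _); rewrite ?normr1 ?normr0.
  - by move=> y hy; rewrite indicE memNset// /= in_itv/=; exact/negP.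
have i1 : mu.-integrable setT (EFin \o (fun y => `|h1 y|)).
  exact: integrable_norm (sqint_mul s1 hu).
have := integrable_tensor i1 iI; apply: le_integrable => //.
- apply/measurable_EFinP; apply: measurable_funM; last by have [mu_ _] := hu; exact: measurableT_comp.
  have h : measurable_fun setT (fun z : R * R => ((x, z.1), z.2)).
    by apply: measurable_fun_pair => //; apply: measurable_fun_pair.
  exact: (measurableT_comp mF h).
- move=> z _; rewrite /= lee_fin [leRHS]ger0_norm; last first.
    by rewrite mulr_ge0// /I mulr_ge0// indicE.
  rewrite -/(F ((x, z.1), z.2)) normrM mulrC /h1 indicE.
  have [hz|hz] := boolP (a <= z.1 <= b).
    by rewrite mem_set/= ?in_itv// mul1r ler_wpM2l//; exact: (F_I ((x, z.1), z.2)).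
  rewrite F_out1; first by rewrite normr0 mulr0 mulr_ge0// /I mulr_ge0// indicE.
  rewrite /= ltNge; apply: contra hz.
  by rewrite ler_norml /a /b => /andP[? ?]; apply/andP; split; lra.
Qed.

Lemma phase_integralE u x : sqint u ->
  phase_integral f tau u x = \int[mu]_y (phase_kernel f tau x y * u y).
Proof.
move=> hu; rewrite /phase_integral /Rintegral.
rewrite -(integral12_prod_meas1 (phase_integrand_integrable x hu)).
congr fine; apply: eq_integral => y _; rewrite /fubini_F /=.
have i := iF x y.
rewrite -RintegralZr// /Rintegral fineK//.
have iu : mu.-integrable setT (EFin \o (fun k => F ((x, y), k) * u y)).
  by have := integrableZr measurableT (u y) i.
exact: integrable_fin_num.
Qed.

End BoxSymbol.

End PhaseIntegral.

(** * Reduction of a half strip symbol to decaying kernels *)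

Section HalfStripApproximable.
Variable R : realType.
Local Notation mu := (@lebesgue_measure R).

Lemma Rintegral_shift (G : R -> R) (L b : R) : 0 < L -> continuous G ->
  \int[mu]_(x in `[b - L, b]) G x = \int[mu]_(x in `[- L, 0]) G (x + b).
Proof.
move=> L0 cG; pose F (x : R) := x + b.
have dF (x : R) : is_derive x (1 : R) F (1 : R).
  by have := is_deriveD (is_derive_id x (1 : R)) (is_derive_cst b x (1 : R)); rewrite addr0.
have dF1 : derive1 F = cst 1 by apply/funext => x; rewrite derive1E; case: (dF x).
have cF : continuous F := derivable_continuous dF.
rewrite (_ : b - L = F (- L)); last by rewrite /F addrC.
rewrite (_ : `[F (- L), b] = `[F (- L), F 0]); last by rewrite /F add0r.
rewrite /Rintegral (@integration_by_substitution_increasing R F G (- L) 0).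
- by congr fine; apply: eq_integral => x _; rewrite /= dF1 /= mulr1.
- by rewrite oppr_le0 ltW.
- by move=> x y _ _ xy; rewrite /F ltrD2r.
- by move=> x _; rewrite dF1; exact: cvg_cst.
- by rewrite dF1; exact: is_cvg_cst.
- by rewrite dF1; exact: is_cvg_cst.
- split.
  + by move=> x _; case: (dF x).
  + by apply: cvg_at_right_filter; exact: cF.
  + by apply: cvg_at_left_filter; exact: cF.
- exact: continuous_subspaceT.
Qed.

(** The indicator vanishes above [b] and [G] below [b - L], which leaves an interval of length [L];
    whether its end [b] is included does not affect the integral. *)
Lemma Rintegral_below_line (G : R -> R) (L b : R) (e : bool) : 0 < L -> continuous G ->
  (forall x, x < b - L -> G x = 0) ->
  \int[mu]_x ((x < b ?<= if e)%:R * G x) = \int[mu]_(x in `[- L, 0]) G (x + b).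
Proof.
move=> L0 cG G0; rewrite -Rintegral_shift//.
have ic : mu.-integrable `[b - L, b] (EFin \o G) by exact: continuous_integrable_itv.
have -> : \int[mu]_(x in `[b - L, b]) G x =
    \int[mu]_(x in [set` Interval (BLeft (b - L)) (BSide (~~ e) b)]) G x.
  case: e => //=; rewrite Rintegral_itv_bndo_bndc//.
  apply: integrableS ic => //; apply: subset_itvl; by rewrite bnd_simp.
rewrite [RHS]Rintegral_mkcond; apply: eq_Rintegral => x _; rewrite patchE.
have [xb|xb] := ltP x (b - L).
  by rewrite G0// mulr0; case: ifP.
have -> : (x \in [set` Interval (BLeft (b - L)) (BSide (~~ e) b)]) = (x < b ?<= if e).
  by rewrite mem_setE; case: e; rewrite in_itv/= xb.
by case: (_ < _ ?<= if _); rewrite ?mul1r ?mul0r.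
Qed.

Variables (phi dphi : R * R -> R) (B M : R).
Hypothesis ht : lipschitz_test phi dphi B M.

Variable q : half_strip R.
Local Notation b := (line_slope q).
Local Notation d := (line_offset q).
(** For [|s| <= B] the line has height at most [|b| B + |d|], while [phi(s, .)] vanishes below
    [- B]; so after the shift nothing is left below [- L]. *)
Let L := `|b| * B + `|d| + B + 1.

Let L0 : 0 < L.
Proof. by have := test_B0 ht => B0; rewrite /L ltr_wpDl// !addr_ge0// ?mulr_ge0// ltW. Qed.

Let pk tau := piece_kernel phi b d L tau (strip_end q) (strip_closed q).

Let theta (x : R) := b * x ^+ 2 / 2 + d * x.

Lemma measurable_half_strip_fun :
  measurable_fun [set: measurableTypeR R * measurableTypeR R] (half_strip_fun q).
Proof.
apply: measurable_funM; first exact: measurable_lteif.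
by apply: measurable_lteif => //; apply: measurable_funD => //; exact: measurable_funM.
Qed.

Lemma box_symbol_half_strip : box_symbol (fun z => half_strip_fun q z * phi z) B M.
Proof.
split.
- apply: measurable_funM; first exact: measurable_half_strip_fun.
  exact: continuous2_measurable (@test_cont _ _ _ _ _ ht).
- move=> z; rewrite /half_strip_fun !normrM -[leRHS]mul1r.
  apply: ler_pM => //; last exact: (test_le ht).
  do 2 case: (_ < _ ?<= if _); rewrite /= ?normr1 ?normr0 ?mulr0 ?mul0r ?mulr1//.
- by move=> z hz; rewrite (test_box ht hz) mulr0.
Qed.

(* The phase (x - y) (b s + d) with s = (x + y) / 2 equals theta x - theta y, so
   the slope of the line contributes only unimodular functions of x and of y. *)
Lemma phase_kernel_half_strip tau x y :
  phase_kernel (fun z => half_strip_fun q z * phi z) tau x y =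
  cos (theta x + tau) * (pk 0 x y * cos (theta y) + pk (- (pi / 2)) x y * sin (theta y)) +
  sin (theta x + tau) * (pk 0 x y * sin (theta y) - pk (- (pi / 2)) x y * cos (theta y)).
Proof.
have B0 := test_B0 ht.
rewrite /phase_kernel /pk /piece_kernel.
set s := (x + y) / 2; set t := x - y; set S := (s < strip_end q ?<= if strip_closed q)%:R.
have [sB|sB] := ltP B `|s|.
  rewrite !(oscillatory_integral_out ht)// !mulr0 !mul0r addr0 subr0 !mulr0 addr0.
  rewrite -[RHS](mul0r (fine (mu setT))) -Rintegral_cst//; apply: eq_Rintegral => k _.
  by rewrite (test_box ht) ?mulr0//= sB.
pose be := b * s + d.
pose G (k : R) := cos (t * k + tau) * phi (s, k).
have cphi : continuous (fun k => phi (s, k)).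
  exact: derivable_continuous (test_derive ht s).
have cG : continuous G.
  by move=> k; apply: continuousM; [exact: continuous_cos_affine|exact: cphi].
have G0 k : k < be - L -> G k = 0.
  move=> hk; rewrite /G (test_box ht) ?mulr0//=; apply/orP; right.
  have h1 : be <= `|b| * B + `|d|.
    apply: le_trans (ler_norm _) _; apply: le_trans (ler_normD _ _) _.
    by rewrite lerD2r normrM ler_wpM2l.
  have : k < - B by move: hk; rewrite /L; lra.
  by move=> kB; rewrite ltr0_norm; lra.
have -> : \int[mu]_k (cos (t * k + tau) * (half_strip_fun q (s, k) * phi (s, k))) =
    S * \int[mu]_(k in `[- L, 0]) G (k + be).
  rewrite -(Rintegral_below_line (line_closed q) L0 cG G0) -RintegralZl//.
    apply: eq_Rintegral => k _; rewrite /half_strip_fun /= -/S /G -/be; ring.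
  apply: (integrable_le _ (integrableZl measurableT M (integrable_box (- B) B))).
    apply: measurable_funM; last exact: continuous_measurable_fun.
    exact: measurable_lteif.
  move=> k; rewrite indicE; have [kB|kB] := boolP (`|k| <= B).
    rewrite mem_set/= ?in_itv/= -?ler_norml// mulr1 normrM -[leRHS]mul1r ler_pM//.
      by case: (_ < _ ?<= if _); rewrite ?normr1 ?normr0.
    rewrite /G normrM -[leRHS]mul1r ler_pM//; last exact: (test_le ht).
    by rewrite ler_norml cos_geN1 cos_le1.
  rewrite /G (test_box ht) ?mulr0 ?normr0 ?mulr_ge0 ?(test_M0 ht)//=.
  by rewrite orbC ltNge kB.
rewrite -!mulrA; rewrite /oscillatory_integral -/be.
(* The shift by [be] turns the phase into [t k + A]; the addition formula then separates [A] from
   the integration variable. *)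
set A := theta x + tau - theta y.
have -> : \int[mu]_(k in `[- L, 0]) G (k + be) =
   cos A * \int[mu]_(k in `[- L, 0]) (cos (t * k + 0) * phi (s, k + be)) -
   sin A * \int[mu]_(k in `[- L, 0]) (cos (t * k + - (pi / 2)) * phi (s, k + be)).
  have cont (c : R) : continuous (fun k => cos (t * k + c) * phi (s, k + be)).
    move=> k; apply: continuousM; first exact: continuous_cos_affine.
    have h2 : (k' + be) @[k' --> k] --> k + be by apply: cvgD; [exact: cvg_id|exact: cvg_cst].
    exact: (cvg_comp _ _ h2 (cphi (k + be))).
  rewrite -!RintegralZl//; try exact: continuous_integrable_itv.
  have contZ (a c : R) : continuous (fun k => a * (cos (t * k + c) * phi (s, k + be))).
    by move=> k; apply: (cvgM (cvg_cst a) (cont c k)).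
  rewrite -RintegralB//; try exact: continuous_integrable_itv.
  apply: eq_Rintegral => k _; rewrite /G !mulrA -mulrBl; congr (_ * _).
  have -> : t * (k + be) + tau = t * k + A.
    by rewrite /A /theta /be /t /s; field.
  rewrite addr0 cosD; congr (_ - _); rewrite mulrC//; congr (_ * _).
  by rewrite cosB cos_pihalf sin_pihalf mulr0 mulr1 add0r.
rewrite /A cosB sinB.
move: (\int[mu]_(k in _) _) (\int[mu]_(k in _) _) => J0 J1.
ring.
Qed.

(** The factors in [y] are put inside the kernels, which makes four decaying kernels; the factors in
    [x] are attached afterwards. *)
Lemma half_strip_approximable tau :
  approximable (fun u x => phase_integral (fun z => half_strip_fun q z * phi z) tau u x).
Proof.
have mtheta : measurable_fun setT theta.
  by apply: measurable_funD; apply: measurable_funM => //; apply: measurable_funM => //; exact: measurable_funX.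
have mcos : measurable_fun setT (fun y => cos (theta y)).
  by apply: measurableT_comp mtheta; apply: continuous_measurable_fun; exact: continuous_cos.
have msin : measurable_fun setT (fun y => sin (theta y)).
  by apply: measurableT_comp mtheta; apply: continuous_measurable_fun; exact: continuous_sin.
have cos1 (x : R) : `|cos x| <= 1 by rewrite ler_norml cos_geN1 cos_le1.
have sin1 (x : R) : `|sin x| <= 1 by rewrite ler_norml sin_geN1 sin_le1.
have [C0 [D0 k0]] := @piece_kernel_decaying R _ _ _ _ ht b d L 0 L0 (strip_end q) (strip_closed q).
have [C1 [D1 k1]] := @piece_kernel_decaying R _ _ _ _ ht b d L (- (pi / 2)) L0 (strip_end q) (strip_closed q).
rewrite -/(pk 0) in k0; rewrite -/(pk (- (pi / 2))) in k1.
have d0c := decaying_kernel_mulr k0 mcos (fun y => cos1 (theta y)).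
have d0s := decaying_kernel_mulr k0 msin (fun y => sin1 (theta y)).
have d1c := decaying_kernel_mulr k1 mcos (fun y => cos1 (theta y)).
have d1s := decaying_kernel_mulr k1 msin (fun y => sin1 (theta y)).
have a0c := decaying_kernel_approximable d0c; have a0s := decaying_kernel_approximable d0s.
have a1c := decaying_kernel_approximable d1c; have a1s := decaying_kernel_approximable d1s.
have g1 := approximable_scale (fun x => cos1 (theta x + tau)) (approximableD a0c a1s).
have g2 := approximable_scale (fun x => sin1 (theta x + tau))
  (approximableD a0s (@approximable_scale R _ (fun=> -1) 1 _ a1c)).
have h1 : forall x : R, `|(fun=> -1 : R) x| <= 1 by move=> _; rewrite normrN normr1.
apply: approximable_ext (approximableD g1 (g2 h1)) _ => u x hu /=.
rewrite (phase_integralE _ box_symbol_half_strip)//.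
under eq_Rintegral do rewrite phase_kernel_half_strip.
have i0c := sqint_mul (decaying_kernel_sqint d0c x) hu.
have i0s := sqint_mul (decaying_kernel_sqint d0s x) hu.
have i1c := sqint_mul (decaying_kernel_sqint d1c x) hu.
have i1s := sqint_mul (decaying_kernel_sqint d1s x) hu.
set a := cos (theta x + tau); set a' := sin (theta x + tau).
rewrite -RintegralD//.
have i2 := integrableD measurableT i0c i1s.
rewrite -RintegralZl//.
rewrite mulN1r -RintegralB// -RintegralZl//; last exact: (integrableB measurableT i0s i1c).
rewrite -RintegralD//; last 2 first.
- exact: (integrableZl measurableT a i2).
- exact: (integrableZl measurableT a' (integrableB measurableT i0s i1c)).
by apply: eq_Rintegral => y _; rewrite /=; ring.
Qed.

End HalfStripApproximable.

(** * From half strips to the symbol of the polygon *)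

Section SpanApproximable.
Variable R : realType.
Local Notation mu := (@lebesgue_measure R).

Lemma Rintegral_sum d (T : measurableType d) (m : {measure set T -> \bar R})
    (I : Type) (s : seq I) (c : I -> R) (F : I -> T -> R) :
  (forall i, m.-integrable setT (EFin \o F i)) ->
  m.-integrable setT (EFin \o (fun x => \sum_(i <- s) c i * F i x)) /\
  \int[m]_x (\sum_(i <- s) c i * F i x) = \sum_(i <- s) c i * \int[m]_x F i x.
Proof.
move=> hF; elim: s => [|i s [IH1 IH2]].
  under [X in Rintegral _ _ X]eq_fun do rewrite big_nil.
  rewrite big_nil Rintegral_cst// mul0r; split => //.
  rewrite (_ : EFin \o _ = cst 0%E); first exact: integrable0.
  by apply/funext => x /=; rewrite big_nil.
have iZ : m.-integrable setT (EFin \o (fun x => c i * F i x)).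
  exact: (integrableZl measurableT (c i) (hF i)).
split.
  rewrite (_ : EFin \o _ = ((EFin \o (fun x => c i * F i x)%R) \+
      (EFin \o (fun x => \sum_(j <- s) c j * F j x)%R))%E); first exact: integrableD.
  by apply/funext => x /=; rewrite big_cons.
under eq_Rintegral do rewrite big_cons.
by rewrite RintegralD// IH2 big_cons RintegralZl.
Qed.

Variables (f phi dphi : R * R -> R) (B M : R).
Hypothesis ht : lipschitz_test phi dphi B M.

(** The decomposition of [f] is known on a quadrant only; off the closed box of size [B] it is [phi]
    that vanishes, and [B + 1] leaves room for the strict inequalities. *)
Lemma span_mul_test (s : seq (R * half_strip R)) w :
  (forall z, z.1 < B + 1 -> z.2 < B + 1 ->
    f z = \sum_(q <- s) q.1 * half_strip_fun q.2 z) ->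
  f w * phi w = \sum_(q <- s) q.1 * (half_strip_fun q.2 w * phi w).
Proof.
move=> hs; have [hw|] := boolP ((B < `|w.1|) || (B < `|w.2|)).
  by rewrite (test_box ht hw) mulr0 big1// => q _; rewrite !mulr0.
rewrite negb_or -!leNgt => /andP[w1 w2].
rewrite hs; last 2 first.
- by apply: le_lt_trans (ler_norm _) _; lra.
- by apply: le_lt_trans (ler_norm _) _; lra.
by rewrite mulr_suml; apply: eq_bigr => q _; rewrite mulrA.
Qed.

Hypothesis hspan : half_strip_span (B + 1) f.

Lemma span_approximable tau : approximable (phase_integral (fun z => f z * phi z) tau).
Proof.
have [s hs] := hspan.
have h i := half_strip_approximable ht i tau.
apply: approximable_ext (approximable_sum s (fun q => q.1) (fun q => h q.2)) _ => u x hu.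
have [_ <-] := Rintegral_sum s (fun q => q.1) (fun q =>
  phase_integrand_integrable tau (box_symbol_half_strip ht q.2) x hu).
apply: eq_Rintegral => z _; rewrite (span_mul_test _ hs).
by rewrite mulr_sumr mulr_suml; apply: eq_bigr => q _; rewrite mulrCA !mulrA.
Qed.

Lemma span_box_symbol : (forall z, `|f z| <= 1) ->
  box_symbol (fun z => f z * phi z) B M.
Proof.
have [s hs] := hspan; move=> f1; split.
- rewrite (_ : (fun z => _) = (fun w => \sum_(q <- s) q.1 * (half_strip_fun q.2 w * phi w))).
    apply: measurable_sum => q; apply: measurable_funM => //.
    exact: (box_meas (box_symbol_half_strip ht q.2)).
  by apply/funext => w; exact: span_mul_test.
- move=> z; rewrite normrM -[leRHS]mul1r ler_pM//; exact: (test_le ht).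
- by move=> z hz; rewrite (test_box ht hz) mulr0.
Qed.

End SpanApproximable.

(** * Orthonormal families and Bessel's inequality *)

(** Rows of [C] are coefficient vectors. A further row has to lie in the left kernel of [A] and be
    orthogonal for [G] to the [m] rows already found: [r + m] linear conditions, fewer than [k].
    Positivity of [G] permits the normalisation. *)
Lemma orthonormal_kernel (R : rcfType) (k r m : nat) (G : 'M[R]_k) (A : 'M[R]_(k, r)) :
  G^T = G -> (forall c : 'rV_k, c != 0 -> 0 < (c *m G *m c^T) 0 0) ->
  (m + r <= k)%N ->
  exists C : 'M[R]_(m, k), C *m A = 0 /\ C *m G *m C^T = 1%:M.
Proof.
move=> Gt Gp; elim: m => [|m IH] mrk.
  by exists 0; split; apply/matrixP => -[].
have [|C [CA CG]] := IH; first by apply: leq_trans mrk; rewrite leq_add2r.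
pose K := kermx (row_mx A (G *m C^T)).
have K0 : K != 0.
  rewrite -mxrank_eq0 mxrank_ker subn_eq0 -ltnNge.
  apply: leq_ltn_trans (rank_leq_col _) _.
  by rewrite addnC.
pose v := nz_row K.
have v0 : v != 0 by rewrite nz_row_eq0.
have : v *m row_mx A (G *m C^T) = 0 by apply/sub_kermxP; exact: nz_row_sub.
rewrite mul_mx_row -[0]row_mx0 => /eq_row_mx[vA vGC].
set q := (v *m G *m v^T) 0 0.
have q0 : 0 < q by exact: Gp.
pose c := (Num.sqrt q)^-1 *: v.
have cA : c *m A = 0 by rewrite -scalemxAl vA scaler0.
have cGC : c *m G *m C^T = 0 by rewrite -!scalemxAl -mulmxA vGC scaler0.
have cGc : c *m G *m c^T = 1%:M.
  rewrite [LHS]mx11_scalar; congr _%:M.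
  rewrite linearZ -scalemxAr -!scalemxAl scalerA mxE -/q.
  by rewrite -invfM -expr2 sqr_sqrtr ?ltW// mulVf// gt_eqF.
have CGc : C *m G *m c^T = 0.
  by apply: trmx_inj; rewrite !trmx_mul trmxK Gt mulmxA cGC trmx0.
have e1 : col_mx c C *m A = 0 by rewrite mul_col_mx cA CA col_mx0.
have e2 : col_mx c C *m G *m (col_mx c C)^T = 1%:M.
  by rewrite mul_col_mx tr_col_mx mul_col_row cGC cGc CG CGc -scalar_mx_block.
by exists (col_mx c C).
Qed.

Section RealInnerProduct.
Variable R : realType.
Local Notation mu := (@lebesgue_measure R).

Definition ipR (f g : R -> R) : R := \int[mu]_x (f x * g x).

Lemma ipRC f g : ipR f g = ipR g f.
Proof. by apply: eq_Rintegral => x _; rewrite mulrC. Qed.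

Lemma ipR_ge0 f : 0 <= ipR f f.
Proof. by apply: Rintegral_ge0 => x _; rewrite -expr2 sqr_ge0. Qed.

Lemma ipR_suml (I : Type) (s : seq I) (c : I -> R) (F : I -> R -> R) g :
  (forall i, sqint (F i)) -> sqint g ->
  ipR (fun x => \sum_(i <- s) c i * F i x) g = \sum_(i <- s) c i * ipR (F i) g.
Proof.
move=> hF hg.
have [_ <-] := @Rintegral_sum R _ _ mu I s c (fun i x => F i x * g x) (fun i => sqint_mul (hF i) hg).
apply: eq_Rintegral => x _; rewrite mulr_suml; apply: eq_bigr => i _.
by rewrite mulrA.
Qed.

Lemma ipR_sum (I : Type) (s : seq I) (c d : I -> R) (F : I -> R -> R) :
  (forall i, sqint (F i)) ->
  ipR (fun x => \sum_(i <- s) c i * F i x) (fun x => \sum_(i <- s) d i * F i x) =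
  \sum_(i <- s) \sum_(j <- s) c i * d j * ipR (F i) (F j).
Proof.
move=> hF; rewrite ipR_suml//; last exact: sqint_sum.
apply: eq_bigr => i _; rewrite ipRC ipR_suml// mulr_sumr.
by apply: eq_bigr => j _; rewrite mulrA ipRC.
Qed.

Lemma ipRBB k g : sqint k -> sqint g ->
  ipR (fun x => k x - g x) (fun x => k x - g x) = ipR k k - 2 * ipR k g + ipR g g.
Proof.
move=> hk hg; rewrite /ipR.
have ikk := sqint_mul hk hk; have ikg := sqint_mul hk hg; have igg := sqint_mul hg hg.
have i2 : mu.-integrable setT (EFin \o (fun x => 2 * (k x * g x))).
  exact: (integrableZl measurableT 2 ikg).
rewrite -RintegralZl// -RintegralB// -RintegralD//; last exact: (integrableB measurableT ikk i2).
by apply: eq_Rintegral => x _; ring.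
Qed.

(** The pairs [(F i, G i)] are orthonormal for the real inner product of complex functions; this is
    Bessel's inequality for the pair [(k, 0)]. *)
Lemma bessel m (F G : 'I_m -> R -> R) (k : R -> R) :
  (forall i, sqint (F i)) -> (forall i, sqint (G i)) -> sqint k ->
  (forall i j, ipR (F i) (F j) + ipR (G i) (G j) = (i == j)%:R) ->
  \sum_i ipR k (F i) ^+ 2 <= ipR k k.
Proof.
move=> hF hG hk ortho.
pose a i := ipR k (F i).
pose f x := \sum_i a i * F i x; pose g x := \sum_i a i * G i x.
have sf : sqint f by exact: sqint_sum.
have kf : ipR k f = \sum_i a i ^+ 2.
  rewrite ipRC ipR_suml//; apply: eq_bigr => i _.
  by rewrite ipRC expr2.
have fg : ipR f f + ipR g g = \sum_i a i ^+ 2.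
  rewrite !ipR_sum// -big_split; apply: eq_bigr => i _ /=.
  rewrite -big_split /= (bigD1 i)//= -mulrDr ortho eqxx mulr1 big1 ?addr0 ?expr2//.
  by move=> j ji; rewrite -mulrDr ortho eq_sym (negbTE ji) mulr0.
have := ipR_ge0 (fun x => k x - f x); rewrite ipRBB// kf.
by have := ipR_ge0 g; rewrite -/a; lra.
Qed.

Lemma ipR_eq0_ae f : sqint f -> ipR f f = 0 -> {ae mu, forall x, f x = 0}.
Proof.
move=> [mf if2] f0.
have h : (\int[mu]_x `|(f x ^+ 2)%:E| = 0)%E.
  rewrite -[RHS]/(0%:E) -f0 /ipR /Rintegral fineK.
    by apply: eq_integral => x _; rewrite gee0_abs ?lee_fin ?sqr_ge0// expr2.
  exact: integrable_fin_num if2.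
have m2 : measurable_fun setT (EFin \o (fun x => f x ^+ 2)).
  by apply/measurable_EFinP; exact: measurable_funX.
have := (ae_eq_integral_abs mu measurableT m2).1 h.
apply: filterS => x /= /(_ I) [] /eqP.
by rewrite sqrf_eq0 => /eqP.
Qed.

End RealInnerProduct.

(** * Counting eigenvalues by a Hilbert-Schmidt bound *)

Section EigenCount.
Variable R : realType.
Local Notation mu := (@lebesgue_measure R).

Section Gram.
Variables (k : nat) (U V : 'I_k -> R -> R) (z : 'I_k -> R) (lambda : R).
Hypotheses (sU : forall l, sqint (U l)) (sV : forall l, sqint (V l)).
Hypothesis ortho : forall l l', z l != z l' -> ipR (U l) (U l') + ipR (V l) (V l') = 0.
Hypothesis free : forall c : 'I_k -> R,
  {ae mu, forall x, \sum_l c l * U l x = 0 /\ \sum_l c l * V l x = 0} -> forall l, c l = 0.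
Hypothesis lambda0 : 0 <= lambda.
Hypothesis z_ge : forall l, lambda <= `|z l|.

Let comb (W : 'I_k -> R -> R) (c : 'I_k -> R) (x : R) := \sum_l c l * W l x.

(** Real inner products of the complex functions [U l + i V l]; within one eigenspace these need not
    be orthogonal. *)
Definition gram : 'M[R]_k := \matrix_(l, l') (ipR (U l) (U l') + ipR (V l) (V l')).

Lemma gramE (c d : 'rV[R]_k) :
  ipR (comb U (c 0)) (comb U (d 0)) + ipR (comb V (c 0)) (comb V (d 0)) =
  (c *m gram *m d^T) 0 0.
Proof.
rewrite /comb !ipR_sum// -big_split mxE.
rewrite [RHS](eq_bigr (fun j => \sum_i c 0 i * d 0 j * gram i j)); last first.
  by move=> j _; rewrite !mxE mulr_suml; apply: eq_bigr => i _; rewrite mulrAC.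
rewrite [RHS]exchange_big /=; apply: eq_bigr => i _; rewrite -big_split /=.
by apply: eq_bigr => j _; rewrite mxE mulrDr.
Qed.

Lemma gram_sym : gram^T = gram.
Proof. by apply/matrixP => i j; rewrite !mxE ipRC [in X in _ + X]ipRC. Qed.

Lemma gram_pos (c : 'rV[R]_k) : c != 0 -> 0 < (c *m gram *m c^T) 0 0.
Proof.
move=> c0; rewrite -gramE lt_neqAle addr_ge0 ?ipR_ge0// andbT eq_sym.
apply: contra c0 => /eqP h0.
have sCU : sqint (comb U (c 0)) by exact: sqint_sum.
have sCV : sqint (comb V (c 0)) by exact: sqint_sum.
have h1 : ipR (comb U (c 0)) (comb U (c 0)) = 0.
  by have := ipR_ge0 (comb U (c 0)); have := ipR_ge0 (comb V (c 0)); lra.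
have h2 : ipR (comb V (c 0)) (comb V (c 0)) = 0 by lra.
apply/eqP/rowP => l; rewrite [RHS]mxE; apply: free.
by move: (ipR_eq0_ae sCU h1) (ipR_eq0_ae sCV h2); apply: (@filterS2 _ _ (ae_filter_ringOfSetsType mu)) => x; split.
Qed.

(* For eigenvalues z_l at least lambda in modulus, z_l z_l' - lambda^2 = nu_l nu_l' with
   nu_l = sqrt (z_l^2 - lambda^2) wherever the Gram matrix does not vanish. *)
Lemma gram_coercive (c : 'rV[R]_k) :
  lambda ^+ 2 * (c *m gram *m c^T) 0 0 <=
  ipR (comb U (fun l => c 0 l * z l)) (comb U (fun l => c 0 l * z l)) +
  ipR (comb V (fun l => c 0 l * z l)) (comb V (fun l => c 0 l * z l)).
Proof.
pose nu l := Num.sqrt (z l ^+ 2 - lambda ^+ 2).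
have nu2 l : nu l * nu l = z l ^+ 2 - lambda ^+ 2.
  rewrite -expr2 sqr_sqrtr// subr_ge0 -[z l ^+ 2]real_normK ?num_real//.
  by rewrite lerXn2r ?nnegrE.
pose cz := \row_l (c 0 l * z l); pose cn := \row_l (c 0 l * nu l).
have e1 W : comb W (fun l => c 0 l * z l) = comb W (cz 0).
  by apply/funext => x; apply: eq_bigr => l _; rewrite mxE.
rewrite !e1 gramE.
suff -> : (cz *m gram *m cz^T) 0 0 =
    lambda ^+ 2 * (c *m gram *m c^T) 0 0 + (cn *m gram *m cn^T) 0 0.
  by rewrite lerDl -gramE addr_ge0 ?ipR_ge0.
have E (a : 'rV[R]_k) : (a *m gram *m a^T) 0 0 = \sum_j \sum_i a 0 i * a 0 j * gram i j.
  by rewrite mxE; apply: eq_bigr => j _; rewrite !mxE mulr_suml; apply: eq_bigr => i _; rewrite mulrAC.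
rewrite !E mulr_sumr -big_split; apply: eq_bigr => j _ /=.
rewrite mulr_sumr -big_split; apply: eq_bigr => i _ /=.
rewrite !mxE; have [zz|zz] := eqVneq (z i) (z j); last by rewrite ortho// !mulr0 addr0.
have -> : nu i = nu j by rewrite /nu zz.
rewrite zz; have := nu2 j; move: (ipR _ _ + ipR _ _) => g h.
have -> : c 0 i * nu j * (c 0 j * nu j) * g = c 0 i * c 0 j * g * (nu j * nu j) by ring.
by rewrite h; ring.
Qed.

End Gram.

Definition sqint_linear (T : (R -> R) -> R -> R) : Prop :=
  forall k (c : 'I_k -> R) (F : 'I_k -> R -> R) x, (forall l, sqint (F l)) ->
    T (fun y => \sum_l c l * F l y) x = \sum_l c l * T (F l) x.

Lemma sqr_integral_le (h : R -> R) (E : R) : sqint h ->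
  (\int[mu]_y (h y ^+ 2)%:E <= E%:E)%E -> ipR h h <= E.
Proof.
move=> [mh h2] hE; rewrite -lee_fin; apply: le_trans hE.
rewrite /ipR /Rintegral fineK; last first.
  have := integrable_fin_num measurableT h2.
  by under eq_integral do rewrite /= expr2.
by rewrite le_eqVlt; apply/orP; left; apply/eqP; apply: eq_integral => y _; rewrite expr2.
Qed.

(** The system says [kappa (Tc + i Ts) (U + i V) = z (U + i V)]. Among real combinations of the
    eigenfunctions, [k - r] orthonormal ones are killed by all functionals. Each has an image of
    square norm at least [lambda^2], while Bessel's inequality bounds the sum of these square norms
    by the remainders. *)
Lemma eigen_count (Tc Ts : (R -> R) -> R -> R) (kappa : R) :
  approximable Tc -> approximable Ts -> sqint_linear Tc -> sqint_linear Ts ->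
  exists2 C, 0 <= C & forall (N k : nat) (U V : 'I_k -> R -> R) (z : 'I_k -> R) lambda,
    (2 <= N)%N -> (forall l, sqint (U l)) -> (forall l, sqint (V l)) ->
    (forall l l', z l != z l' -> ipR (U l) (U l') + ipR (V l) (V l') = 0) ->
    (forall c : 'I_k -> R,
      {ae mu, forall x, \sum_l c l * U l x = 0 /\ \sum_l c l * V l x = 0} ->
      forall l, c l = 0) ->
    0 <= lambda -> (forall l, lambda <= `|z l|) ->
    (forall l, {ae mu, forall x,
      kappa * (Tc (U l) x - Ts (V l) x) = z l * U l x /\
      kappa * (Ts (U l) x + Tc (V l) x) = z l * V l x}) ->
    C * (N%:R * ln N%:R) <= k%:R ->
    lambda ^+ 2 * (k%:R - C * (N%:R * ln N%:R)) <= C * (ln N%:R / N%:R).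
Proof.
move=> [Cc Cc0 hc] [Cs Cs0 hs] linc lins.
(* Each functional of [Tc] and [Ts] is imposed on real and imaginary parts, hence the 2 in [C1]. The
   4 in [C2] is 2 from [(a - b)^2 <= 2 a^2 + 2 b^2] times 2 because every row is tested against both
   [F] and [H]. *)
pose C1 := 2 * (Cc + Cs); pose C2 := 4 * kappa ^+ 2 * (Cc + Cs).
have C10 : 0 <= C1 by rewrite mulr_ge0// addr_ge0.
have k20 : 0 <= kappa ^+ 2 by exact: sqr_ge0.
have k24 : 0 <= 4 * kappa ^+ 2 by exact: mulr_ge0.
have C20 : 0 <= C2 by apply: mulr_ge0 => //; exact: addr_ge0.
exists (C1 + C2); first exact: addr_ge0.
move=> N k U V z lambda N2 sU sV ortho free lam0 z_ge eig hk.
have /andP[l2 lN] := @lnN_ge R N N2.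
have lN0 : 0 <= ln (N%:R : R) by rewrite (le_trans _ lN)// ltW.
have [rc [lc [Ec [c1 c2 [mEc Ec0] c4 c5]]]] := hc N N2.
have [rs [ls [Es [s1 s2 [mEs Es0] s4 s5]]]] := hs N N2.
pose r := ((rc + rc) + (rs + rs))%N.
have rC : r%:R <= C1 * (N%:R * ln N%:R) by rewrite /r !natrD /C1; lra.
have CN0 : 0 <= C2 * (N%:R * ln N%:R) by rewrite mulr_ge0// mulr_ge0.
have rk : (r <= k)%N by rewrite -(ler_nat R); lra.
pose A (q : nat) (l : nat -> R -> R) (W : 'I_k -> R -> R) : 'M[R]_(k, q) :=
  \matrix_(i, j) ipR (l j) (W i).
pose AA := row_mx (row_mx (A rc lc U) (A rc lc V)) (row_mx (A rs ls U) (A rs ls V)).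
have mk : ((k - r) + r <= k)%N by rewrite subnK.
have [C [CA CG]] := orthonormal_kernel AA (gram_sym U V) (gram_pos sU sV free) mk.
move: CA; rewrite /AA !mul_mx_row -[0]row_mx0 => /eq_row_mx[].
rewrite -[X in row_mx _ _ = X]row_mx0 => /eq_row_mx[Acu Acv].
rewrite -[X in row_mx _ _ = X]row_mx0 => /eq_row_mx[Asu Asv].
set m := (k - r)%N in C CG Acu Acv Asu Asv.
pose F i x := \sum_l C i l * U l x; pose H i x := \sum_l C i l * V l x.
have sF i : sqint (F i) by exact: sqint_sum.
have sH i : sqint (H i) by exact: sqint_sum.
have ann q l (W : 'I_k -> R -> R) : (forall j, sqint (l j)) -> (forall j, sqint (W j)) ->
    C *m A q l W = 0 -> forall i j, (j < q)%N -> ipR (l j) (fun x => \sum_l C i l * W l x) = 0.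
  move=> sl sW /matrixP h i j jq; have := h i (Ordinal jq).
  have e := ipR_suml (index_enum 'I_k) (C i) sW (sl j).
  rewrite !mxE => h0; rewrite ipRC; apply: etrans e _; apply: etrans h0.
  by apply: eq_bigr => t _; rewrite mxE ipRC.
have rowE3 i j : (row i C *m gram U V *m (row j C)^T) 0 0 = (C *m gram U V *m C^T) i j.
  rewrite -row_mul mxE [RHS]mxE; apply: eq_bigr => l _.
  by congr (_ * _); rewrite mxE // [LHS]mxE [RHS]mxE.
have orthoFH i j : ipR (F i) (F j) + ipR (H i) (H j) = (i == j)%:R.
  have := gramE sU sV (row i C) (row j C).
  rewrite rowE3 CG mxE => <-; congr (_ + _); congr ipR;
  by apply/funext => x; apply: eq_bigr => l _; rewrite mxE.
have orthoHF i j : ipR (H i) (H j) + ipR (F i) (F j) = (i == j)%:R by rewrite addrC.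
(* By the eigenvalue equations, [w1 i] and [w2 i] are almost everywhere the real and imaginary parts
   of the image of [F i + i H i]. *)
pose w1 i x := \sum_l (C i l * z l) * U l x; pose w2 i x := \sum_l (C i l * z l) * V l x.
have sw1 i : sqint (w1 i) by exact: sqint_sum.
have sw2 i : sqint (w2 i) by exact: sqint_sum.
have coer i : lambda ^+ 2 <= ipR (w1 i) (w1 i) + ipR (w2 i) (w2 i).
  have := gram_coercive sU sV ortho lam0 z_ge (row i C).
  rewrite rowE3 CG mxE eqxx mulr1 => h; apply: le_trans h _.
  rewrite le_eqVlt; apply/orP; left; apply/eqP.
  by congr (ipR _ _ + ipR _ _); apply/funext => x; apply: eq_bigr => l _; rewrite mxE.
pose W i x := w1 i x ^+ 2 + w2 i x ^+ 2.
have bound : {ae mu, forall x, setT x ->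
    ((\sum_i 1 * W i x)%:E <= (4 * kappa ^+ 2 * (Ec x + Es x))%:E)%E}.
  have := @filter_forall _ _ _ _ (ae_filter_ringOfSetsType mu) eig.
  apply: (@filterS _ _ (ae_filter_ringOfSetsType mu)) => x hx _; rewrite lee_fin.
  (* The rows depend on [x], so Bessel's inequality is applied at each [x] outside the null set
     where some eigenvalue equation fails. *)
  have [kc [skc kcE hkc]] := c5 x; have [ks [sks ksE hks]] := s5 x.
  have w1E i : w1 i x = kappa * (ipR kc (F i) - ipR ks (H i)).
    rewrite -[ipR kc _]hkc//; last by move=> j jr; exact: (ann rc lc U c2 sU Acu i j jr).
    rewrite -[ipR ks _]hks//; last by move=> j jr; exact: (ann rs ls V s2 sV Asv i j jr).
    rewrite /F /H linc// lins// -sumrB mulr_sumr; apply: eq_bigr => l _.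
    by rewrite -mulrA -(hx l).1; ring.
  have w2E i : w2 i x = kappa * (ipR ks (F i) + ipR kc (H i)).
    rewrite -[ipR kc _]hkc//; last by move=> j jr; exact: (ann rc lc V c2 sV Acv i j jr).
    rewrite -[ipR ks _]hks//; last by move=> j jr; exact: (ann rs ls U s2 sU Asu i j jr).
    rewrite /F /H linc// lins// -big_split mulr_sumr; apply: eq_bigr => l _ /=.
    by rewrite -mulrA -(hx l).2; ring.
  have b1 := bessel sF sH skc orthoFH; have b2 := bessel sH sF skc orthoHF.
  have b3 := bessel sF sH sks orthoFH; have b4 := bessel sH sF sks orthoHF.
  have e1 := sqr_integral_le skc kcE; have e2 := sqr_integral_le sks ksE.
  apply: (@le_trans _ _ (\sum_i (2 * kappa ^+ 2 * (ipR kc (F i) ^+ 2) +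
     2 * kappa ^+ 2 * (ipR kc (H i) ^+ 2) + 2 * kappa ^+ 2 * (ipR ks (F i) ^+ 2) +
     2 * kappa ^+ 2 * (ipR ks (H i) ^+ 2)))).
    apply: ler_sum => i _; rewrite mul1r /W w1E w2E.
    move: (ipR kc _) (ipR kc _) (ipR ks _) (ipR ks _) => a b c d.
    have : 0 <= kappa ^+ 2 * ((b + d) ^+ 2 + (c - a) ^+ 2).
      by rewrite mulr_ge0 ?sqr_ge0// addr_ge0 ?sqr_ge0.
    by lra.
  rewrite !big_split /= -!mulr_sumr -!mulrDr.
  have -> : 4 * kappa ^+ 2 * (Ec x + Es x) =
    2 * kappa ^+ 2 * (Ec x + Ec x + Es x + Es x) by ring.
  by apply: ler_wpM2l; [rewrite mulr_ge0// sqr_ge0|lra].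
have sW i : mu.-integrable setT (EFin \o W i).
  exact: (integrableD measurableT (sw1 i).2 (sw2 i).2).
have [iW intW] := Rintegral_sum (index_enum 'I_m) (fun=> 1) sW.
have lower : m%:R * lambda ^+ 2 <= \int[mu]_x (\sum_i 1 * W i x).
  rewrite intW -[m in m%:R]card_ord -sumr_const mulr_suml; apply: ler_sum => i _.
  rewrite !mul1r; apply: le_trans (coer i) _.
  rewrite /W (RintegralD measurableT (sw1 i).2 (sw2 i).2).
  rewrite le_eqVlt; apply/orP; left; apply/eqP.
  by congr (_ + _); apply: eq_Rintegral => x _; rewrite expr2.
have upper : \int[mu]_x (\sum_i 1 * W i x) <= C2 * (ln N%:R / N%:R).
  rewrite -lee_fin /Rintegral fineK; last exact: integrable_fin_num iW.
  have le1 := ae_ge0_le_integral _ _ _ _ _ bound.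
  apply: le_trans (le1 _ _ _ _ _) _ => //.
  - by move=> x _; rewrite lee_fin; apply: sumr_ge0 => i _; rewrite mul1r addr_ge0// sqr_ge0.
  - exact: measurable_int iW.
  - by move=> x _; rewrite lee_fin; apply: mulr_ge0 => //; exact: addr_ge0.
  - by apply/measurable_EFinP; apply: measurable_funM => //; exact: measurable_funD.
  under eq_integral do rewrite EFinM.
  have E0 x : setT x -> (0 <= (Ec x + Es x)%:E)%E by move=> _; rewrite lee_fin addr_ge0.
  have mE : measurable_fun setT (EFin \o (fun x => Ec x + Es x)).
    by apply/measurable_EFinP; exact: measurable_funD.
  rewrite ge0_integralZl_EFin//.
  under eq_integral do rewrite EFinD.
  rewrite ge0_integralD//; last 4 first.
  - by move=> x _; rewrite lee_fin.
  - exact/measurable_EFinP.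
  - by move=> x _; rewrite lee_fin.
  - exact/measurable_EFinP.
  apply: (@le_trans _ _ ((4 * kappa ^+ 2)%:E * ((Cc * (ln N%:R / N%:R))%:E + (Cs * (ln N%:R / N%:R))%:E))%E).
    by apply: lee_wpmul2l; [rewrite lee_fin mulr_ge0// sqr_ge0|exact: leeD].
  by rewrite -EFinD -EFinM lee_fin -mulrDl mulrA.
have h1 : lambda ^+ 2 * (k%:R - (C1 + C2) * (N%:R * ln N%:R)) <= m%:R * lambda ^+ 2.
  rewrite mulrC ler_wpM2r ?sqr_ge0// natrB// lerD2l lerN2.
  by apply: le_trans rC _; rewrite mulrDl lerDl.
apply: le_trans h1 _; apply: le_trans lower _; apply: le_trans upper _.
by rewrite ler_wpM2r ?divr_ge0// lerDr.
Qed.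

End EigenCount.

(** * Symmetry of the operator *)

Section PhaseSymmetry.
Variable R : realType.
Local Notation mu := (@lebesgue_measure R).
Variables (f : R * R -> R) (B M : R).
Hypothesis hf : box_symbol f B M.
Hypothesis B0 : 0 <= B.

Lemma phase_integral_linear tau : sqint_linear (phase_integral f tau).
Proof.
move=> k c F x sF.
rewrite (phase_integralE _ hf); last exact: sqint_sum.
under [RHS]eq_bigr do rewrite (phase_integralE _ hf)//.
have sk := phase_kernel_sqint tau hf x.
have := ipR_suml (index_enum 'I_k) c sF sk.
rewrite /ipR => e; under eq_Rintegral do rewrite mulrC.
by rewrite e; apply: eq_bigr => i _; congr (_ * _); apply: eq_Rintegral => y _; rewrite mulrC.
Qed.

(** Exchanging [x] and [y] keeps the midpoint and reverses the sign of [x - y]. The cosine part is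
    even in it and the sine part odd, which together say that the kernel is Hermitian. *)
Lemma phase_kernel_cosC x y : phase_kernel f 0 x y = phase_kernel f 0 y x.
Proof.
apply: eq_Rintegral => k _; rewrite !addr0 [y + x]addrC; congr (_ * _).
by rewrite -cosN -mulNr opprB.
Qed.

Lemma phase_kernel_sinC x y :
  phase_kernel f (- (pi / 2)) x y = - phase_kernel f (- (pi / 2)) y x.
Proof.
rewrite /phase_kernel -[RHS]mulN1r -RintegralZl//; last exact: phase_kernel_integrable hf _ _.
apply: eq_Rintegral => k _; rewrite [y + x]addrC mulrA; congr (_ * _).
rewrite !cosB cos_pihalf sin_pihalf !mulr0 !add0r !mulr1 mulN1r.
by rewrite -sinN -mulNr opprB.
Qed.

Let band (x y : R) : R := \1_(`[- (2 * B), 2 * B]%classic) (x + y).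

(** A Schur test: the kernel is bounded and lives in the band [|x + y| <= 2 B], whose sections in
    either variable have length [4 B], and [|u v| <= u^2 + v^2]. This justifies exchanging the
    integrals in [pairingC]. *)
Lemma phase_pairing_integrable tau u v : sqint u -> sqint v ->
  (mu \x mu)%E.-integrable setT
    (EFin \o (fun w : R * R => phase_kernel f tau w.1 w.2 * u w.2 * v w.1)).
Proof.
move=> [mu_ iu] [mv iv].
have B0' := B0.
pose g (w : R * R) := band w.1 w.2.
have mg : measurable_fun setT g.
  apply: (@measurableT_comp _ _ _ _ _ _ (\1_(`[- (2 * B), 2 * B]%classic) : R -> R)) => //.
  exact: measurable_funD.
have g0 w : 0 <= g w by rewrite /g /band indicE.
have mass (a : R) : (\int[mu]_y (\1_(`[- (2 * B), 2 * B]%classic) (a + y))%:E = (4 * B)%:E)%E.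
  have := @integral_scale_itv R 1 (- (2 * B) - a) (2 * B - a) ler01.
  have -> : 1 * (2 * B - a - (- (2 * B) - a)) = 4 * B by lra.
  move=> <-; last by lra.
  apply: eq_integral => y _; rewrite mul1e; congr EFin; rewrite !indicE; congr (_%:R).
  congr nat_of_bool; rewrite !mem_setE !in_itv/=.
  by apply/andP/andP => -[? ?]; split; lra.
have mb (a : R) : measurable_fun setT (fun y => (\1_(`[- (2 * B), 2 * B]%classic) (a + y))%:E : \bar R).
  apply/measurable_EFinP.
  apply: (@measurableT_comp _ _ _ _ _ _ (\1_(`[- (2 * B), 2 * B]%classic) : R -> R)) => //.
  exact: measurable_funD.
have tail (h : R -> R) : mu.-integrable setT (EFin \o (fun x => h x ^+ 2)) ->
    (\int[mu]_x \int[mu]_y `|(h x ^+ 2 * \1_(`[- (2 * B), 2 * B]%classic) (x + y))%:E| < +oo)%E.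
  move=> ih; have ih2 := integrableZr measurableT (4 * B) ih.
  have /integrableP[_] := ih2; apply: le_lt_trans.
  rewrite le_eqVlt; apply/orP; left; apply/eqP; apply: eq_integral => x _.
  have h2 : 0 <= h x ^+ 2 := sqr_ge0 _.
  rewrite /= ger0_norm; last by rewrite mulr_ge0// mulr_ge0.
  rewrite EFinM -(mass x) -ge0_integralZl//.
  - by apply: eq_integral => y _; rewrite /= ger0_norm// mulr_ge0// indicE.
  - exact: mb.
have i1 : (mu \x mu)%E.-integrable setT (EFin \o (fun w => v w.1 ^+ 2 * g w)).
  apply/integrable12ltyP.
    apply/measurable_EFinP; apply: measurable_funM => //.
    by apply: measurable_funX; exact: measurableT_comp.
  apply: le_lt_trans (tail v iv); rewrite le_eqVlt; apply/orP; left; apply/eqP.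
  by apply: eq_integral => x _; apply: eq_integral => y _ /=.
have i2 : (mu \x mu)%E.-integrable setT (EFin \o (fun w => u w.2 ^+ 2 * g w)).
  apply/integrable21ltyP.
    apply/measurable_EFinP; apply: measurable_funM => //.
    by apply: measurable_funX; exact: measurableT_comp.
  apply: le_lt_trans (tail u iu); rewrite le_eqVlt; apply/orP; left; apply/eqP.
  apply: eq_integral => y _; apply: eq_integral => x _ /=.
  by rewrite /g /band/= addrC.
pose M' := \int[mu]_k (M * \1_(`[- B, B]%classic) k).
have M'0 : 0 <= M'.
  by have := phase_kernel_le tau hf 0 0; apply: le_trans.
have := integrableZl measurableT M' (integrableD measurableT i1 i2).
apply: le_integrable => //.
- apply/measurable_EFinP; apply: measurable_funM; last exact: measurableT_comp.
  by apply: measurable_funM; [exact: (measurable_phase_kernel tau hf)|exact: measurableT_comp].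
- move=> w _; rewrite /= lee_fin [leRHS]ger0_norm; last first.
    by rewrite mulr_ge0// addr_ge0// mulr_ge0// sqr_ge0.
  have [h|h] := ltP (2 * B) `|w.1 + w.2|.
    rewrite (phase_kernel_out tau hf h) !mul0r normr0.
    by rewrite mulr_ge0// addr_ge0// mulr_ge0// sqr_ge0.
  have -> : g w = 1 by rewrite /g /band indicE mem_set//= in_itv/= -ler_norml.
  rewrite !mulr1 -mulrA normrM; apply: ler_pM => //; first exact: (phase_kernel_le tau hf).
  rewrite normrM -[u _ ^+ 2]real_normK ?num_real// -[v _ ^+ 2]real_normK ?num_real//.
  by have := sqr_ge0 (`|u w.2| - `|v w.1|); have := sqr_ge0 (`|u w.2| + `|v w.1|); nra.
Qed.

Lemma phase_integral_mulrE tau u x c : sqint u ->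
  (\int[mu]_y (phase_kernel f tau x y * u y * c)%:E)%E = (phase_integral f tau u x * c)%:E.
Proof.
move=> hu; have i := sqint_mul (phase_kernel_sqint tau hf x) hu.
have ic : mu.-integrable setT (EFin \o (fun y => phase_kernel f tau x y * u y * c)).
  by have := integrableZr measurableT c i.
rewrite (phase_integralE _ hf)// -RintegralZr// /Rintegral fineK//.
exact: integrable_fin_num ic.
Qed.

Definition pairing tau u v : R := \int[mu]_x (phase_integral f tau u x * v x).

Lemma pairing_integrable tau u v : sqint u -> sqint v ->
  mu.-integrable setT (EFin \o (fun x => phase_integral f tau u x * v x)).
Proof.
move=> hu hv; have := integrable_fubini_F (phase_pairing_integrable tau hu hv).
apply: eq_integrable => // x _.
by rewrite /fubini_F /= phase_integral_mulrE.
Qed.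

Lemma pairingC tau (e : R) u v : sqint u -> sqint v ->
  (forall x y, phase_kernel f tau x y = e * phase_kernel f tau y x) ->
  pairing tau u v = e * pairing tau v u.
Proof.
move=> hu hv sym.
rewrite /pairing -RintegralZl//; last exact: pairing_integrable.
congr fine.
transitivity (\int[mu]_x \int[mu]_y (phase_kernel f tau x y * u y * v x)%:E)%E.
  by apply: eq_integral => x _; rewrite phase_integral_mulrE.
transitivity (\int[mu]_y \int[mu]_x (phase_kernel f tau x y * u y * v x)%:E)%E.
  exact: (Fubini (phase_pairing_integrable tau hu hv)).
apply: eq_integral => y _; rewrite mulrCA -phase_integral_mulrE//.
apply: eq_integral => x _; congr EFin; rewrite sym; ring.
Qed.

Lemma pairing_cosC u v : sqint u -> sqint v -> pairing 0 u v = pairing 0 v u.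
Proof.
move=> hu hv; rewrite (@pairingC _ 1)// ?mul1r// => x y.
by rewrite mul1r phase_kernel_cosC.
Qed.

Lemma pairing_sinC u v : sqint u -> sqint v ->
  pairing (- (pi / 2)) u v = - pairing (- (pi / 2)) v u.
Proof.
move=> hu hv; rewrite (@pairingC _ (-1))// ?mulN1r// => x y.
by rewrite mulN1r phase_kernel_sinC.
Qed.

Lemma ae_pairing (kappa z : R) tau1 tau2 (u1 u2 w v : R -> R) (e : R) :
  sqint u1 -> sqint u2 -> sqint w -> sqint v ->
  {ae mu, forall x, kappa * (phase_integral f tau1 u1 x + e * phase_integral f tau2 u2 x) =
    z * w x} ->
  z * ipR w v = kappa * (pairing tau1 u1 v + e * pairing tau2 u2 v).
Proof.
move=> h1 h2 hw hv hae.
have i1 := pairing_integrable tau1 h1 hv; have i2 := pairing_integrable tau2 h2 hv.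
have i3 := sqint_mul hw hv.
have i2e := integrableZl measurableT e i2.
have i12 := integrableD measurableT i1 i2e.
rewrite /ipR /pairing -!RintegralZl// -RintegralD// -RintegralZl//.
have i4 : mu.-integrable setT (EFin \o (fun x => z * (w x * v x))).
  exact: (integrableZl measurableT z i3).
have i5 : mu.-integrable setT (EFin \o (fun x => kappa *
    (phase_integral f tau1 u1 x * v x + e * (phase_integral f tau2 u2 x * v x)))).
  exact: (integrableZl measurableT kappa i12).
congr fine; apply: ae_eq_integral => //.
- exact: measurable_int i4.
- exact: measurable_int i5.
move: hae; apply: (@filterS _ _ (ae_filter_ringOfSetsType mu)) => x /= hx _.
by congr EFin; rewrite mulrA -hx; ring.
Qed.

(* The operator is symmetric for the real inner product of L^2(R; C). *)
Lemma eigen_orthogonal (kappa z z' : R) (u1 u2 v1 v2 : R -> R) :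
  sqint u1 -> sqint u2 -> sqint v1 -> sqint v2 ->
  let C := phase_integral f 0 in let S := phase_integral f (- (pi / 2)) in
  {ae mu, forall x, kappa * (C u1 x - S u2 x) = z * u1 x /\
                    kappa * (S u1 x + C u2 x) = z * u2 x} ->
  {ae mu, forall x, kappa * (C v1 x - S v2 x) = z' * v1 x /\
                    kappa * (S v1 x + C v2 x) = z' * v2 x} ->
  z != z' -> ipR u1 v1 + ipR u2 v2 = 0.
Proof.
move=> s1 s2 t1 t2 C S hu hv zz.
have split12 (a1 a2 w1 w2 : R -> R) (c : R) :
    {ae mu, forall x, kappa * (C a1 x - S a2 x) = c * w1 x /\
                      kappa * (S a1 x + C a2 x) = c * w2 x} ->
    {ae mu, forall x, kappa * (C a1 x + -1 * S a2 x) = c * w1 x} /\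
    {ae mu, forall x, kappa * (S a1 x + 1 * C a2 x) = c * w2 x}.
  by move=> h; split; move: h; apply: (@filterS _ _ (ae_filter_ringOfSetsType mu)) => x [h h'];
    rewrite ?mulN1r ?mul1r.
have [hu1 hu2] := split12 _ _ _ _ _ hu; have [hv1 hv2] := split12 _ _ _ _ _ hv.
have e1 := ae_pairing s1 s2 s1 t1 hu1; have e2 := ae_pairing s1 s2 s2 t2 hu2.
have e3 := ae_pairing t1 t2 t1 s1 hv1; have e4 := ae_pairing t1 t2 t2 s2 hv2.
rewrite (ipRC v1) (pairing_cosC t1 s1) (pairing_sinC t2 s1) in e3.
rewrite (ipRC v2) (pairing_sinC t1 s2) (pairing_cosC t2 s2) in e4.
have : (z - z') * (ipR u1 v1 + ipR u2 v2) = 0.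
  have -> : (z - z') * (ipR u1 v1 + ipR u2 v2) =
    (z * ipR u1 v1 + z * ipR u2 v2) - (z' * ipR u1 v1 + z' * ipR u2 v2) by ring.
  rewrite e1 e2 e3 e4.
  move: (pairing 0 u1 v1) (pairing (- (pi / 2)) u2 v1)
    (pairing (- (pi / 2)) u1 v2) (pairing 0 u2 v2) => a b c d; ring.
by move/eqP; rewrite mulf_eq0 subr_eq0 (negbTE zz)/= => /eqP.
Qed.

End PhaseSymmetry.

(** * Eigenfunctions and the final estimate *)

Section Weyl.
Variable R : realType.
Local Notation mu := (@lebesgue_measure R).
Local Open Scope complex_scope.

Lemma complex_eqP (a b : R[i]) : complex.Re a = complex.Re b -> complex.Im a = complex.Im b -> a = b.
Proof. by case: a b => [? ?] [? ?] /= -> ->. Qed.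

Lemma Re_sum (I : Type) (s : seq I) (F : I -> R[i]) :
  complex.Re (\sum_(i <- s) F i) = \sum_(i <- s) complex.Re (F i).
Proof.
elim: s => [|i s IH]; first by rewrite !big_nil.
by rewrite !big_cons -IH; case: (F i) => ? ?; case: (\sum_(_ <- _) _).
Qed.

Lemma Im_sum (I : Type) (s : seq I) (F : I -> R[i]) :
  complex.Im (\sum_(i <- s) F i) = \sum_(i <- s) complex.Im (F i).
Proof.
elim: s => [|i s IH]; first by rewrite !big_nil.
by rewrite !big_cons -IH; case: (F i) => ? ?; case: (\sum_(_ <- _) _).
Qed.

Lemma ReZ (c : R) (a : R[i]) : complex.Re (c%:C * a) = c * complex.Re a.
Proof. by case: a => a b /=; rewrite mul0r subr0. Qed.

Lemma ImZ (c : R) (a : R[i]) : complex.Im (c%:C * a) = c * complex.Im a.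
Proof. by case: a => a b /=; rewrite mul0r addr0. Qed.

Lemma weylE (Omega : set (R * R)) (phi : R * R -> R) B M (u : R -> R[i]) x :
  box_symbol (fun z => \1_Omega z * phi z) B M ->
  sqint (fun y => complex.Re (u y)) -> sqint (fun y => complex.Im (u y)) ->
  let C := phase_integral (fun z => \1_Omega z * phi z) 0 in
  let S := phase_integral (fun z => \1_Omega z * phi z) (- (pi / 2)) in
  let u1 := fun y => complex.Re (u y) in let u2 := fun y => complex.Im (u y) in
  complex.Re (weyl Omega phi u x) = (2 * pi)^-1 * (C u1 x - S u2 x) /\
  complex.Im (weyl Omega phi u x) = (2 * pi)^-1 * (S u1 x + C u2 x).
Proof.
move=> hf s1 s2 C S u1 u2.
have c1 := phase_integrand_integrable 0 hf x s1.
have c2 := phase_integrand_integrable 0 hf x s2.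
have d1 := phase_integrand_integrable (- (pi / 2)) hf x s1.
have d2 := phase_integrand_integrable (- (pi / 2)) hf x s2.
rewrite /weyl ReZ ImZ /cintegral /=; split; congr (_ * _).
- rewrite -RintegralB//; apply: eq_Rintegral => -[y k] _ /=.
  rewrite addr0 cosB cos_pihalf sin_pihalf !mulr0 mulr1 add0r.
  by rewrite /u1 /u2; case: (u y) => a b /=; ring.
- rewrite -RintegralD//; apply: eq_Rintegral => -[y k] _ /=.
  rewrite addr0 cosB cos_pihalf sin_pihalf !mulr0 mulr1 add0r.
  by rewrite /u1 /u2; case: (u y) => a b /=; ring.
Qed.

Lemma seq_card_le (s : seq nat) (A : set nat) n : uniq s ->
  (forall i, i \in s -> A i) -> (A #= `I_n)%card -> (size s <= n)%N.
Proof.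
move=> us sA An; rewrite -card_le_II.
have inj : {in `I_(size s) &, injective (nth 0%N s)}.
  by move=> i j; rewrite !inE => hi hj /eqP; rewrite nth_uniq// => /eqP.
have h1 := inj_card_eq inj.
move: h1; rewrite card_eq_le => /andP[_ h1].
apply: card_le_trans h1 _; move: An; rewrite card_eq_le => /andP[An _].
apply: card_le_trans An; apply: subset_card_le => _ [i hi <-].
by apply: sA; rewrite mem_nth.
Qed.

Lemma mem_iota_tail (a n : nat) : (a < n)%N -> a.+1 \in iota (1 + a) (n - a).
Proof. by move=> an; rewrite mem_iota add1n leqnn /= addSn ltnS subnKC// ltnW. Qed.

(* e l is taken from the chosen basis of its eigenspace, at the position of l
   among the indices carrying the same eigenvalue. *)
Lemma eigenfunction_family (neg : bool) (A : (R -> R[i]) -> (R -> R[i])) (lam : nat -> R) K :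
  eigenvalue_sequence neg A lam -> 0 < lam K ->
  exists e : 'I_K -> R -> R[i],
    (forall l : 'I_K, eigenfunction A ((-1) ^+ neg * lam l.+1) (e l)) /\
    forall (z : R) (c : 'I_K -> R[i]), (forall l : 'I_K, lam l.+1 != z -> c l = 0) ->
      {ae mu, forall x, \sum_l c l * e l x = 0} -> forall l, c l = 0.
Proof.
move=> [lam0 lamle hz] lamK.
have lampos (l : 'I_K) : 0 < lam l.+1.
  by apply: lt_le_trans lamK _; apply: lamle; rewrite /= ltn_ord.
(* The premise [0 < z] inside [P] allows a choice for every real [z], with an empty dummy family
   where no eigenspace is provided. *)
pose P (z : R) (nb : {n & 'I_n -> R -> R[i]}) := 0 < z ->
  [/\ forall j, eigenfunction A ((-1) ^+ neg * z) (projT2 nb j),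
      forall c : 'I_(projT1 nb) -> R[i],
          {ae mu, forall x, \sum_j c j * projT2 nb j x = 0} -> forall j, c j = 0 &
      ([set k | (1 <= k)%N /\ lam k = z] #= `I_(projT1 nb))%card].
have ex z : exists nb, P z nb.
  have [z0|z0] := ltP 0 z; last first.
    by exists (existT (fun n => 'I_n -> R -> R[i]) 0%N (fun _ _ => 0)); rewrite /P ltNge z0.
  have [n [b [b1 b2 b3]] hn] := hz z z0.
  by exists (existT (fun n => 'I_n -> R -> R[i]) n b).
have [nb hnb] := choice ex.
(* Ordinals start at 0 and the sequence at 1, so [iota 1 l] lists the indices before [l.+1]. A level
   set has as many elements as its eigenspace has dimensions, hence [pos l] is a valid position in
   the basis. *)
pose s (l : 'I_K) := [seq l' <- iota 1 K | lam l' == lam l.+1].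
pose pos (l : 'I_K) := count (fun l' => lam l' == lam l.+1) (iota 1 l).
have posE (l : 'I_K) : (pos l < size (s l))%N.
  rewrite /pos /s size_filter.
  have -> : iota 1 K = iota 1 l ++ iota (1 + l) (K - l).
    by rewrite -iotaD subnKC// ltnW.
  rewrite count_cat -[X in (X < _)%N]addn0 ltn_add2l.
  by rewrite -has_count; apply/hasP; exists l.+1; rewrite ?eqxx//; exact: mem_iota_tail.
have pos_lt (l : 'I_K) : (pos l < projT1 (nb (lam l.+1)))%N.
  apply: leq_trans (posE l) _.
  have [_ _ h] := hnb _ (lampos l).
  apply: seq_card_le h; first by rewrite filter_uniq// iota_uniq.
  by move=> i; rewrite mem_filter mem_iota => /andP[/eqP h1 /andP[h2 _]].
pose e (l : 'I_K) := projT2 (nb (lam l.+1)) (Ordinal (pos_lt l)).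
exists e; split; first by move=> l; have [h _ _] := hnb _ (lampos l); exact: h.
move=> z c c0 hc l; apply/eqP; apply: contraT => cl.
have lz : lam l.+1 = z by apply/eqP; apply: contraT => /c0 h; move: cl; rewrite h eqxx.
have zpos : 0 < z by rewrite -lz.
have [h1 h2 _] := hnb _ zpos.
(* Coefficients are regrouped by position in the basis; as [pos] is injective on a level, each sum
   has at most one term. *)
pose d (j : 'I_(projT1 (nb z))) := \sum_(l' : 'I_K | (lam l'.+1 == z) && (pos l' == val j)) c l'.
have eE (l' : 'I_K) x : lam l'.+1 = z ->
    forall j : 'I_(projT1 (nb z)), pos l' = val j -> e l' x = projT2 (nb z) j x.
  rewrite /e => lz'; move: (pos_lt l'); rewrite lz' => hp j jp.
  by have -> : Ordinal hp = j by apply: val_inj.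
have pos_z (l' : 'I_K) : lam l'.+1 = z -> (pos l' < projT1 (nb z))%N.
  by move=> <-; exact: pos_lt.
have hd : forall j, d j = 0.
  apply: h2; move: hc; apply: (@filterS _ _ (ae_filter_ringOfSetsType mu)) => x hx.
  rewrite -[RHS]hx.
  rewrite [RHS](bigID (fun l' : 'I_K => lam l'.+1 == z)) /= [X in _ + X]big1 ?addr0; last first.
    by move=> l' /c0 ->; rewrite mul0r.
  rewrite [RHS](eq_bigr (fun l' : 'I_K => \sum_(j < projT1 (nb z) | pos l' == val j)
       c l' * projT2 (nb z) j x)); last first.
    move=> l' /eqP lz'; rewrite (big_pred1 (Ordinal (pos_z l' lz'))).
      by rewrite -(eE l' x lz').
    by move=> j /=; apply/eqP/eqP => [h|-> //]; apply: val_inj.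
  rewrite (exchange_big_dep xpredT) //=; apply: eq_bigr => j _.
  by rewrite /d mulr_suml.
have pos_inj (l' : 'I_K) : lam l'.+1 = z -> pos l' = pos l -> l' = l.
  have lt (a b : 'I_K) : lam a.+1 = z -> lam b.+1 = z -> (a < b)%N -> (pos a < pos b)%N.
    move=> az bz ab; rewrite /pos az bz.
    have -> : iota 1 b = iota 1 a ++ iota (1 + a) (b - a).
      by rewrite -iotaD subnKC// ltnW.
    rewrite count_cat -[X in (X < _)%N]addn0 ltn_add2l.
    by rewrite -has_count; apply/hasP; exists a.+1; rewrite ?az ?eqxx//; exact: mem_iota_tail.
  move=> lz' pl; apply: val_inj => /=; case: (ltngtP l' l) => // h.
    by have := lt _ _ lz' lz h; rewrite pl ltnn.
  by have := lt _ _ lz lz' h; rewrite pl ltnn.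
have := hd (Ordinal (pos_z l lz)).
rewrite /d (big_pred1 l); first by move=> h; move: cl; rewrite h eqxx.
move=> l' /=; apply/andP/eqP => [[/eqP g1 /eqP g2]|->]; first exact: pos_inj.
by rewrite lz !eqxx.
Qed.

End Weyl.

(** * Choice of the grid and conclusion *)

Section Main.
Variable R : realType.
Local Notation mu := (@lebesgue_measure R).

(** [N] is the integer part of [k / (2 (C + 1) ln k)], so the finite rank part costs at most
    [k / 2]. Then [x^2 <= 8 ((C + 1) ln k / k)^2], and 3 majorises the root of 8. The lower bound on
    [k] ensures [N >= 2] through [ln k <= 2 sqrt k]. *)
Lemma log_decay (C x k : R) : 0 <= C -> 0 <= x -> 1 <= ln k -> 64 * (C + 1) ^+ 2 <= k ->
  (forall N : nat, (2 <= N)%N -> C * (N%:R * ln N%:R) <= k ->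
    x ^+ 2 * (k - C * (N%:R * ln N%:R)) <= C * (ln N%:R / N%:R)) ->
  x <= 3 * (C + 1) * (k^-1 * ln k).
Proof.
move=> C0 x0 lk kC H; set D := C + 1 in kC *.
have D1 : 1 <= D by rewrite /D lerDr.
have D0 : 0 < D by lra.
have k0 : 0 < k by apply: lt_le_trans kC; rewrite mulr_gt0// exprn_gt0.
pose r := Num.sqrt k.
have r0 : 0 < r by rewrite sqrtr_gt0.
have rr : r ^+ 2 = k by rewrite sqr_sqrtr// ltW.
have Dr : 8 * D <= r.
  rewrite -(@ler_pXn2r _ 2%N)// ?nnegrE ?mulr_ge0 ?(ltW r0) ?(ltW D0)//.
  by rewrite rr exprMn; apply: le_trans kC; rewrite -natrX.
have lnr : ln k <= 2 * r.
  rewrite -rr expr2 lnM ?posrE//.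
  by have := ln_sublinear r0; lra.
have tk : 4 * D * ln k <= k.
  apply: (@le_trans _ _ (8 * D * r)).
    have -> : 8 * D * r = 4 * D * (2 * r) by ring.
    by rewrite ler_wpM2l// mulr_ge0// ltW.
  by rewrite -rr expr2 ler_wpM2r// ltW.
have s0 : 0 < 2 * D * ln k by rewrite !mulr_gt0//; lra.
pose t := k / (2 * D * ln k).
have t2 : 2 <= t by rewrite /t ler_pdivlMr//; lra.
pose N := Num.truncn t.
have /andP[N1 N2] : N%:R <= t < N.+1%:R by apply: truncn_itv; lra.
have N2' : (2 <= N)%N by rewrite /N truncn_ge_nat//; lra.
have Nr : 2 <= (N%:R : R) by rewrite ler_nat.
have Nt : t / 2 <= N%:R by move: N2; rewrite -natr1; lra.
have tlek : t <= k.
  rewrite /t ler_pdivrMr// ler_peMr ?(ltW k0)//.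
  by have := ler_pM ler01 ler01 D1 lk; lra.
have lN : ln N%:R <= ln k by rewrite ler_ln ?posrE//; lra.
have lN0 : 0 <= ln (N%:R : R) by rewrite ln_ge0//; lra.
have CN : C * (N%:R * ln N%:R) <= k / 2.
  apply: (@le_trans _ _ (D * (t * ln k))).
    apply: ler_pM => //; [exact: mulr_ge0|by rewrite /D lerDl|exact: ler_pM].
  rewrite le_eqVlt; apply/orP; left; apply/eqP; rewrite /t; field.
  by rewrite !gt_eqF//; lra.
have h1 := H N N2' (le_trans CN _).
have {}h1 : x ^+ 2 * (k - C * (N%:R * ln N%:R)) <= C * (ln N%:R / N%:R).
  by apply: h1; lra.
have x2 : 0 <= x ^+ 2 := sqr_ge0 _.
have h2 : x ^+ 2 * (k / 2) <= x ^+ 2 * (k - C * (N%:R * ln N%:R)).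
  by rewrite ler_wpM2l//; lra.
have h3 : C * (ln N%:R / N%:R) <= D * (ln k * (2 / t)).
  apply: ler_pM => //; [by rewrite divr_ge0|by rewrite /D lerDl|].
  apply: ler_pM => //; rewrite -invf_div lef_pV2 ?posrE//; lra.
have h4 : D * (ln k * (2 / t)) = (2 * D * (ln k / k)) ^+ 2 * k.
  by rewrite /t; field; rewrite !gt_eqF//; lra.
have h5 : x ^+ 2 <= 2 * (2 * D * (ln k / k)) ^+ 2.
  have : x ^+ 2 * (k / 2) <= (2 * D * (ln k / k)) ^+ 2 * k by lra.
  have -> : x ^+ 2 * (k / 2) = (x ^+ 2 / 2) * k by ring.
  by rewrite ler_pM2r//; lra.
have y0 : 0 <= D * (ln k / k) by rewrite mulr_ge0 ?divr_ge0 ?(ltW k0) ?(ltW D0)//; lra.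
have -> : 3 * D * (k^-1 * ln k) = 3 * (D * (ln k / k)) by ring.
rewrite -(@ler_pXn2r _ 2%N)// ?nnegrE//; last exact: mulr_ge0.
apply: le_trans h5 _.
have : 0 <= (D * (ln k / k)) ^+ 2 by exact: sqr_ge0.
have -> : 2 * D * (ln k / k) = 2 * (D * (ln k / k)) by ring.
by rewrite !exprMn; lra.
Qed.

Lemma ipR_ae0 (f g : R -> R) : sqint f -> sqint g -> {ae mu, forall x, g x = 0} -> ipR f g = 0.
Proof.
move=> sf sg g0.
rewrite -[RHS](mul0r (fine (mu setT))) -Rintegral_cst//.
congr fine; apply: ae_eq_integral => //.
- exact: measurable_int (sqint_mul sf sg).
- move: g0; apply: (@filterS _ _ (ae_filter_ringOfSetsType mu)) => x /= -> _.
  by rewrite mulr0.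
Qed.

End Main.

Theorem corollary1p3 (R : realType) (Omega : set (R * R)) (phi : R * R -> R)
    (hOmega : polygon Omega) (hphi : test_function phi)
    (neg : bool) (lam : nat -> R)
    (hlam : eigenvalue_sequence neg (weyl Omega phi) lam) :
  (lam : nat -> R^o) =O_\oo (fun k : nat => (k%:R)^-1 * ln k%:R : R^o).
Proof.
have [B [M ht]] := test_function_lipschitz hphi.
have hs := polygon_half_strips (B + 1) hOmega.
have hf : box_symbol (fun z => \1_Omega z * phi z) B M.
  apply: (span_box_symbol ht hs) => z.
  by rewrite indicE; case: (_ \in _); rewrite ?normr1 ?normr0.
have B0 := ltW (test_B0 ht).
have [C C0 hC] := eigen_count (2 * pi)^-1 (span_approximable ht hs 0)
  (span_approximable ht hs (- (pi / 2))) (phase_integral_linear hf 0)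
  (phase_integral_linear hf (- (pi / 2))).
have [lam0 lamle _] := hlam.
have key (N K : nat) : (2 <= N)%N -> (1 <= K)%N -> 0 < lam K ->
    C * (N%:R * ln N%:R) <= K%:R ->
    lam K ^+ 2 * (K%:R - C * (N%:R * ln N%:R)) <= C * (ln N%:R / N%:R).
  move=> N2 K1 lamK.
  have [e [eigf free]] := eigenfunction_family hlam lamK.
  pose U l x := complex.Re (e l x); pose V l x := complex.Im (e l x).
  pose z (l : 'I_K) : R := (-1) ^+ neg * lam l.+1.
  have sU l : sqint (U l) by apply: Lfun2_sqint; have [[]] := eigf l.
  have sV l : sqint (V l) by apply: Lfun2_sqint; have [[]] := eigf l.
  have lamz (l l' : 'I_K) : lam l.+1 != lam l'.+1 -> z l != z l'.
    apply: contra; rewrite /z => /eqP h; apply/eqP.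
    by move: h; apply: mulfI; rewrite signr_eq0.
  have eig l : {ae lebesgue_measure, forall x,
      (2 * pi)^-1 * (phase_integral (fun z => \1_Omega z * phi z) 0 (U l) x -
        phase_integral (fun z => \1_Omega z * phi z) (- (pi / 2)) (V l) x) = z l * U l x /\
      (2 * pi)^-1 * (phase_integral (fun z => \1_Omega z * phi z) (- (pi / 2)) (U l) x +
        phase_integral (fun z => \1_Omega z * phi z) 0 (V l) x) = z l * V l x}.
    have [_ ] := eigf l.
    apply: (@filterS _ _ (ae_filter_ringOfSetsType lebesgue_measure)) => x hx.
    have [h1 h2] := weylE x hf (sU l) (sV l).
    by rewrite -h1 -h2 hx ReZ ImZ.
  have ortho l l' : z l != z l' -> ipR (U l) (U l') + ipR (V l) (V l') = 0.
    move=> zz; exact: (eigen_orthogonal hf B0 (sU l) (sV l) (sU l') (sV l') (eig l) (eig l') zz).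
  apply: (hC N K U V z (lam K)) => //; last 2 first.
  - exact: ltW.
  - move=> l; rewrite /z normrM normrX normrN normr1 expr1n mul1r ger0_norm; last exact: lam0.
    by apply: lamle; rewrite /= ltn_ord.
  (* Independence is known only inside one eigenspace. Let [c'] keep the coefficients of the level
     of [l0]. Different levels being orthogonal, [c' G c'^T = c' G c^T = 0] for the Gram matrix [G],
     so the part of the combination on that level vanishes almost everywhere by itself. *)
  move=> c hc l0.
  pose z0 := lam l0.+1.
  pose c' (l : 'I_K) : R := if lam l.+1 == z0 then c l else 0.
  have hcU : {ae lebesgue_measure, forall x, \sum_l c l * U l x = 0}.
    by move: hc; apply: (@filterS _ _ (ae_filter_ringOfSetsType lebesgue_measure)) => x [].
  have hcV : {ae lebesgue_measure, forall x, \sum_l c l * V l x = 0}.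
    by move: hc; apply: (@filterS _ _ (ae_filter_ringOfSetsType lebesgue_measure)) => x [].
  have sc (W : 'I_K -> R -> R) (a : 'I_K -> R) : (forall l, sqint (W l)) ->
    sqint (fun x => \sum_l a l * W l x) by move=> sW; exact: sqint_sum.
  pose rc := \row_l c l; pose rc' := \row_l c' l.
  have rE (a : 'I_K -> R) (W : 'I_K -> R -> R) :
    (fun x => \sum_l (\row_l a l) 0 l * W l x) = (fun x => \sum_l a l * W l x).
    by apply/funext => x; apply: eq_bigr => l _; rewrite mxE.
  have z1 := gramE sU sV rc' rc; have z2 := gramE sU sV rc' rc'.
  rewrite /rc /rc' !rE in z1 z2.
  rewrite !ipR_ae0 ?addr0 // in z1; try exact: sc.
  have z3 : (rc' *m gram U V *m rc'^T) 0 0 = (rc' *m gram U V *m rc^T) 0 0.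
    rewrite !mxE; apply: eq_bigr => j _; rewrite !mxE.
    rewrite /c'; have [//|jz] := eqVneq (lam j.+1) z0.
    rewrite mulr0 big1 ?mul0r// => i _; rewrite !mxE /c'.
    have [iz|iz] := eqVneq (lam i.+1) z0; last by rewrite mul0r.
    by rewrite ortho ?mulr0//; apply: lamz; rewrite iz eq_sym.
  rewrite -/rc -/rc' z3 -z1 in z2.
  have p1 := ipR_ge0 (fun x => \sum_l c' l * U l x).
  have p2 := ipR_ge0 (fun x => \sum_l c' l * V l x).
  have q1 := ipR_eq0_ae (sc U c' sU); have q2 := ipR_eq0_ae (sc V c' sV).
  have {}q1 := q1 ltac:(lra); have {}q2 := q2 ltac:(lra).
  have := free z0 (fun l => (c' l)%:C%C) _ _ l0.
  rewrite /c' eqxx => H; suff : (c l0)%:C%C = 0 :> R[i]%C by case.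
  apply: H; first by move=> l /negbTE ->.
  move: q1 q2; apply: (@filterS2 _ _ (ae_filter_ringOfSetsType lebesgue_measure)) => x h1 h2.
  apply: complex_eqP; rewrite ?Re_sum ?Im_sum.
  - by rewrite -[RHS]h1; apply: eq_bigr => l _; rewrite ReZ.
  - by rewrite -[RHS]h2; apply: eq_bigr => l _; rewrite ImZ.
apply/eqOP; near=> c; near=> k.
have k1 : (1 <= k)%N by near: k; exact: nbhs_infty_ge.
have klog : expR 1 <= (k%:R : R) by near: k; exact: nbhs_infty_ger.
have k64 : 64 * (C + 1) ^+ 2 <= k%:R by near: k; exact: nbhs_infty_ger.
have c3 : 3 * (C + 1) <= c by near: c; apply: nbhs_pinfty_ge; exact: num_real.
have kp : 0 < (k%:R : R) by rewrite ltr0n.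
have lk : 1 <= ln (k%:R : R) by rewrite -[leLHS]expRK ler_ln ?posrE ?expR_gt0.
have kl0 : 0 <= (k%:R : R)^-1 * ln k%:R by rewrite mulr_ge0 ?invr_ge0//; lra.
rewrite /= (ger0_norm (lam0 k k1)) (ger0_norm kl0).
apply: (@le_trans _ _ (3 * (C + 1) * (k%:R^-1 * ln k%:R))); last by rewrite ler_wpM2r.
(* A vanishing term has no eigenfunctions attached to it, but then the bound is immediate. *)
have [lk0|lk0] := leP (lam k) 0.
  by apply: le_trans lk0 _; rewrite mulr_ge0// mulr_ge0// addr_ge0.
by apply: log_decay => // [|N N2]; [exact: lam0|exact: key].
Unshelve. all: by end_near.
Qed.
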